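(* Let $0<\alpha<\frac16$. A uniformly random size $n$ finitely generated subgroup of $\mathrm{PSL}_2(\mathbb Z)$ is non-parabolic with probability $O(n^{-\alpha})$. Likewise, a uniformly random size $n$ $\mathrm{PSL}_2(\mathbb Z)$-cyclically reduced finitely generated subgroup of $\mathrm{PSL}_2(\mathbb Z)$ is non-parabolic with probability $O(n^{-\alpha})$.
   Context: $\mathrm{PSL}_2(\mathbb Z)=\langle a,b\mid a^2=b^3=1\rangle$. Each element has a unique shortest (geodesic) representative: these are the words over $\{a,b,b^{-1}\}$ of length at most 1 and the words alternating the letter $a$ and letters in $\{b,b^{-1}\}$. The Schreier graph of a subgroup $H$ has as vertices the cosets $Hg$, with an $a$-edge from $Hg$ to $Hga$ (viewed as undirected) and a directed $b$-edge from $Hg$ to $Hgb$ (read as $b$ forward, $b^{-1}$ backward). The Stallings graph $(\Gamma(H),v_0)$ is the subgraph spanned by the loops at $v_0=H$ labeled by the geodesic representatives of the elements of $H$, rooted at $v_0$. It is finite if and only if $H$ is finitely generated, and it determines $H$. The size of a finitely generated subgroup $H$ is the number of vertices of $\Gamma(H)$; there are finitely many subgroups of each size. $H$ is called $\mathrm{PSL}_2(\mathbb Z)$-cyclically reduced if every vertex of $\Gamma(H)$ (including the root) is adjacent to an $a$-edge and to a $b$-edge of $\Gamma(H)$ (loops allowed). The parabolic elements of $\mathrm{PSL}_2(\mathbb Z)$ are the conjugates of non-trivial powers of $ab$. A subgroup is non-parabolic if it contains no parabolic element. *)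

(* Defs.v *)
From HB Require Import structures.
From mathcomp Require Import all_boot all_order all_algebra.
From mathcomp Require Import finmap.
From mathcomp Require Import all_classical all_reals all_analysis.

Set Implicit Arguments.
Unset Strict Implicit.
Unset Printing Implicit Defensive.

Import Order.TTheory GRing.Theory Num.Theory.
Import numFieldNormedType.Exports.

Local Open Scope classical_set_scope.
Local Open Scope card_scope.
Local Open Scope quotient_scope.
Local Open Scope group_scope.

(* PSL_2(Z) is the group < a, b | a^2 = b^3 = 1 >, realized as the quotient of
   the words over a, b and the inverse [Lb'] of b; [a] is its own inverse. *)
Variant letter := La | Lb | Lb'.

Definition letter_code (l : letter) : option bool :=
  match l with La => None | Lb => Some true | Lb' => Some false end.
Definition letter_decode (o : option bool) : letter :=
  match o with None => La | Some true => Lb | Some false => Lb' end.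
Fact letter_codeK : cancel letter_code letter_decode. Proof. by case. Qed.
HB.instance Definition _ := Finite.copy letter (can_type letter_codeK).

Definition word : Type := seq letter.

(* The congruence on words generated by the relations of the presentation and
   by the cancellation of [b] against its inverse. *)
Inductive psl_eqv : word -> word -> Prop :=
| psl_refl w : psl_eqv w w
| psl_sym u v : psl_eqv u v -> psl_eqv v u
| psl_trans u v w : psl_eqv u v -> psl_eqv v w -> psl_eqv u w
| psl_cat u u' v v' : psl_eqv u u' -> psl_eqv v v' -> psl_eqv (u ++ v) (u' ++ v')
| psl_aa : psl_eqv [:: La; La] [::]
| psl_bbb : psl_eqv [:: Lb; Lb; Lb] [::]
| psl_bb' : psl_eqv [:: Lb; Lb'] [::]
| psl_b'b : psl_eqv [:: Lb'; Lb] [::].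

Definition psl_eqvb (u v : word) : bool := `[< psl_eqv u v >].

Fact psl_eqvb_refl : reflexive psl_eqvb.
Proof. by move=> w; apply/asboolP/psl_refl. Qed.
Fact psl_eqvb_sym : symmetric psl_eqvb.
Proof.
by move=> u v; apply/asboolP/asboolP => uv; apply: psl_sym.
Qed.
Fact psl_eqvb_trans : transitive psl_eqvb.
Proof.
by move=> v u w /asboolP uv /asboolP vw; apply/asboolP; apply: psl_trans vw.
Qed.

Canonical psl_equiv_rel :=
  EquivRel psl_eqvb psl_eqvb_refl psl_eqvb_sym psl_eqvb_trans.

Definition PSL2Z : Type := {eq_quot psl_equiv_rel}.
HB.instance Definition _ := Choice.on PSL2Z.
HB.instance Definition _ := EqQuotient.on PSL2Z.

Definition elt (w : word) : PSL2Z := \pi_PSL2Z w.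

Lemma eltP u v : elt u = elt v <-> psl_eqv u v.
Proof. by split=> [/eqmodP/asboolP|uv] //; apply/eqmodP/asboolP. Qed.

Definition letter_inv (l : letter) : letter :=
  match l with La => La | Lb => Lb' | Lb' => Lb end.

Definition word_inv (w : word) : word := rev (map letter_inv w).

Lemma elt_reprK : cancel (@repr _ PSL2Z) elt.
Proof. exact: reprK. Qed.

Lemma psl_eqv_reprK w : psl_eqv (repr (elt w)) w.
Proof. exact/eltP/elt_reprK. Qed.

Lemma word_invK : involutive word_inv.
Proof.
move=> w; rewrite /word_inv map_rev revK -map_comp -[RHS]map_id.
by apply: eq_map; case.
Qed.

Lemma word_inv_cat u v : word_inv (u ++ v) = word_inv v ++ word_inv u.
Proof. by rewrite /word_inv map_cat rev_cat. Qed.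

Lemma psl_mulVw w : psl_eqv (word_inv w ++ w) [::].
Proof.
elim: w => [|l w IH]; first exact: psl_refl.
rewrite -cat1s word_inv_cat -catA; apply: psl_trans IH.
apply: psl_cat; first exact: psl_refl.
rewrite catA -[X in psl_eqv _ X]cat0s; apply: psl_cat; last exact: psl_refl.
by case: l; [apply: psl_aa|apply: psl_b'b|apply: psl_bb'].
Qed.

Definition psl_mul (x y : PSL2Z) : PSL2Z := elt (repr x ++ repr y).
Definition psl_inv (x : PSL2Z) : PSL2Z := elt (word_inv (repr x)).

Lemma psl_mulE u v : psl_mul (elt u) (elt v) = elt (u ++ v).
Proof. by apply/eltP/psl_cat; apply: psl_eqv_reprK. Qed.

Fact psl_mulA : associative psl_mul.
Proof.
move=> x y z; rewrite -[x]elt_reprK -[y]elt_reprK -[z]elt_reprK.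
by rewrite !psl_mulE catA.
Qed.
Fact psl_mul1 : left_id (elt [::]) psl_mul.
Proof. by move=> x; rewrite -[x]elt_reprK psl_mulE. Qed.
Fact psl_mulr1 : right_id (elt [::]) psl_mul.
Proof. by move=> x; rewrite -[x]elt_reprK psl_mulE cats0. Qed.
Fact psl_mulV : left_inverse (elt [::]) psl_inv psl_mul.
Proof.
by move=> x; rewrite -[X in psl_mul _ X]elt_reprK psl_mulE; apply/eltP/psl_mulVw.
Qed.
Fact psl_mulrV : right_inverse (elt [::]) psl_inv psl_mul.
Proof.
move=> x; rewrite -[X in psl_mul X _]elt_reprK psl_mulE.
by rewrite -[X in X ++ _]word_invK; apply/eltP/psl_mulVw.
Qed.

HB.instance Definition _ := isGroup.Build PSL2Z
  psl_mulA psl_mul1 psl_mulr1 psl_mulV psl_mulrV.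

Lemma eltM u v : elt (u ++ v) = elt u * elt v.
Proof. by rewrite -psl_mulE. Qed.

Definition ga : PSL2Z := elt [:: La].
Definition gb : PSL2Z := elt [:: Lb].

Lemma ga2 : ga ^+ 2 = 1.
Proof. by rewrite -[LHS]/(ga * ga) -eltM; apply/eltP/psl_aa. Qed.

Lemma gb3 : gb ^+ 3 = 1.
Proof. by rewrite -[LHS]/(gb * (gb * gb)) /gb -!eltM; apply/eltP/psl_bbb. Qed.

Definition is_a (l : letter) : bool := l == La.

(* Words of length at most 1 are [sorted] for every relation. *)
Definition geodesic (w : word) : bool := sorted (fun l m => is_a l != is_a m) w.

(* [nf w] rewrites [w] into an alternating word; used only to check that the
   alternating words are exactly the shortest representatives. *)
Definition nf_cons (l : letter) (w : word) : word :=
  match l, w with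
  | La, La :: w' => w'
  | Lb, Lb :: w' => Lb' :: w'
  | Lb, Lb' :: w' => w'
  | Lb', Lb :: w' => w'
  | Lb', Lb' :: w' => Lb :: w'
  | _, _ => l :: w
  end.
Definition nf_onto (r w : word) : word := foldr nf_cons r w.
Definition nf (w : word) : word := nf_onto [::] w.

Lemma nfE l w : nf (l :: w) = nf_cons l (nf w). Proof. by []. Qed.

Lemma nf_cons_geodesic l w : geodesic w -> geodesic (nf_cons l w).
Proof. by case: l; case: w => [|[] [|[] w]] //=. Qed.

Lemma nf_onto_geodesic r w : geodesic r -> geodesic (nf_onto r w).
Proof. by move=> gr; elim: w => //= l w; apply: nf_cons_geodesic. Qed.

Lemma nf_onto_eqv u v : psl_eqv u v ->
  forall r, geodesic r -> nf_onto r u = nf_onto r v.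
Proof.
elim=> {u v} //.
- by move=> u v _ IH r gr; rewrite IH.
- by move=> u v w _ IH1 _ IH2 r gr; rewrite IH1 ?IH2.
- move=> u u' v v' _ IH1 _ IH2 r gr; rewrite /nf_onto !foldr_cat -!/(nf_onto _ _).
  by rewrite (IH2 r gr) IH1 //; apply: nf_onto_geodesic.
- by move=> [|[] [|[] w]].
- by move=> [|[] [|[] w]].
- by move=> [|[] [|[] w]].
- by move=> [|[] [|[] w]].
Qed.

Lemma nf_cons_eqv l w : psl_eqv (nf_cons l w) (l :: w).
Proof.
have bb : psl_eqv [:: Lb; Lb] [:: Lb'].
  apply: psl_trans (psl_cat (psl_refl [:: Lb; Lb]) (psl_sym psl_bb')) _.
  exact: (psl_cat psl_bbb (psl_refl [:: Lb'])).
have b'b' : psl_eqv [:: Lb'; Lb'] [:: Lb].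
  apply: psl_trans (psl_cat (psl_refl [:: Lb'; Lb']) (psl_sym psl_bbb)) _.
  apply: (@psl_trans _ [:: Lb'; Lb; Lb]); last first.
    exact: (psl_cat psl_b'b (psl_refl [:: Lb])).
  apply: (psl_cat (psl_refl [:: Lb'])).
  exact: (psl_cat psl_b'b (psl_refl [:: Lb; Lb])).
case: l; case: w => [|[] w] /=; try exact: psl_refl; apply: psl_sym.
- exact: (psl_cat psl_aa (psl_refl w)).
- exact: (psl_cat bb (psl_refl w)).
- exact: (psl_cat psl_bb' (psl_refl w)).
- exact: (psl_cat psl_b'b (psl_refl w)).
- exact: (psl_cat b'b' (psl_refl w)).
Qed.

Lemma nf_eqv w : psl_eqv (nf w) w.
Proof.
elim: w => [|l w IH] /=; first exact: psl_refl.
apply: psl_trans (nf_cons_eqv _ _) _.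
exact: (psl_cat (psl_refl [:: l]) IH).
Qed.

Lemma nf_id w : geodesic w -> nf w = w.
Proof.
elim: w => // l w IH gw; rewrite nfE IH; last first.
  exact: path_sorted gw.
by case: l gw; case: w {IH} => [|[]].
Qed.

Lemma size_nf_cons l w : (size (nf_cons l w) <= (size w).+1)%N.
Proof. by case: l; case: w => [|[] w] //=; apply: leqW. Qed.

Lemma size_nf w : (size (nf w) <= size w)%N.
Proof.
by elim: w => // l w IH; rewrite nfE; apply: leq_trans (size_nf_cons _ _) _.
Qed.

Lemma size_nf_eq w : size (nf w) = size w -> nf w = w.
Proof.
elim: w => // l w IH; rewrite nfE [size (l :: w)]/= => sz.
have szw : size (nf w) = size w.
  apply/eqP; rewrite eqn_leq size_nf /= -ltnS -sz; exact: size_nf_cons.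
move: sz; rewrite -szw (IH szw); case: l; case: (w) => [|[] w'] //= /eqP;
  by rewrite ?eqSS ltn_eqF // ltnS.
Qed.

Lemma geodesicP w :
  geodesic w <-> forall w', elt w' = elt w -> (size w <= size w')%N.
Proof.
split=> [gw w' /eltP/nf_onto_eqv/(_ [::] isT) e|].
  by rewrite -(nf_id gw) /nf -e; apply: size_nf.
move=> /(_ (nf w)) min; suff <- : nf w = w by apply: nf_onto_geodesic.
apply: size_nf_eq; apply/eqP; rewrite eqn_leq size_nf min //.
exact/eltP/nf_eqv.
Qed.

Lemma geodesic_exists x : exists2 w, geodesic w & elt w = x.
Proof.
exists (nf (repr x)); first exact: nf_onto_geodesic.
by rewrite -[RHS]reprK; apply/eltP/nf_eqv.
Qed.

Lemma geodesic_inj u v : geodesic u -> geodesic v -> elt u = elt v -> u = v.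
Proof.
by move=> /nf_id {2}<- /nf_id {2}<- /eltP /nf_onto_eqv; apply.
Qed.

Definition is_subgroup (H : set PSL2Z) : Prop := group_closed (mem H).

Definition finitely_generated (H : set PSL2Z) : Prop :=
  exists2 S : set PSL2Z, finite_set S & H = smallest is_subgroup S.

Definition zexpg (x : PSL2Z) (k : int) : PSL2Z :=
  match k with Posz n => x ^+ n | Negz n => x ^- n.+1 end.

(* [ga * gb] has infinite order, so its non-trivial powers are the [k]-th powers
   with [k] non-zero. *)
Definition parabolic (x : PSL2Z) : Prop :=
  exists (g : PSL2Z) (k : int), k <> 0%R /\ x = zexpg (ga * gb) k ^ g.

Lemma parabolicE x : parabolic x <->
  exists (g : PSL2Z) (n : nat), (0 < n)%N /\
    (x = g^-1 * (ga * gb) ^+ n * g \/ x = g^-1 * (ga * gb) ^- n * g).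
Proof.
split=> [[g [[n|n] [k0 ->]]]|[g [n [n0 [] ->]]]].
- by exists g, n; split; [case: n k0|left; rewrite /conjg mulgA].
- by exists g, n.+1; split=> //; right; rewrite /conjg mulgA.
- by exists g, (Posz n); rewrite /conjg mulgA; split=> // -[n00]; rewrite n00 in n0.
- by exists g, (Negz n.-1); rewrite /conjg mulgA /= prednK.
Qed.

Definition non_parabolic (H : set PSL2Z) : Prop :=
  forall x, H x -> ~ parabolic x.

Record lgraph (V : Type) := LGraph {
  lg_vert : set V;
  lg_a : V -> V -> Prop;
  lg_b : V -> V -> Prop;
  lg_root : V
}.

(* The [a]-edges are undirected; the letter [Lb'] reads [b]-edges backward. *)
Definition reads V (G : lgraph V) (l : letter) (v v' : V) : Prop :=
  match l with
  | La => lg_a G v v' \/ lg_a G v' v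
  | Lb => lg_b G v v'
  | Lb' => lg_b G v' v
  end.

Fixpoint walk V (G : lgraph V) (v : V) (w : word) (v' : V) : Prop :=
  match w with
  | [::] => v = v'
  | l :: w' => exists2 u, reads G l v u & walk G u w' v'
  end.

Definition visited V (G : lgraph V) (L : set word) (v : V) : Prop :=
  exists w1 w2 : word,
    [/\ L (w1 ++ w2), walk G (lg_root G) w1 v & walk G v w2 (lg_root G)].

Definition traversed V (G : lgraph V) (L : set word) (l : letter) (v v' : V) :
    Prop :=
  exists w1 w2 : word,
    [/\ L (w1 ++ l :: w2), walk G (lg_root G) w1 v, reads G l v v'
      & walk G v' w2 (lg_root G)].

(* The subgraph made of the vertices and edges of the loops at the root that
   are labeled by words of [L]. *)
Definition spanned V (G : lgraph V) (L : set word) : lgraph V := {|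
  lg_vert := [set v | lg_vert G v /\ visited G L v];
  lg_a := fun v v' => traversed G L La v v' \/ traversed G L La v' v;
  lg_b := fun v v' => traversed G L Lb v v' \/ traversed G L Lb' v' v;
  lg_root := lg_root G |}.

Definition rcoset_of (H : set PSL2Z) (g : PSL2Z) : set PSL2Z :=
  [set h * g | h in H].

Definition schreier (H : set PSL2Z) : lgraph (set PSL2Z) := {|
  lg_vert := range (rcoset_of H);
  lg_a := fun v v' => exists2 g, v = rcoset_of H g & v' = rcoset_of H (g * ga);
  lg_b := fun v v' => exists2 g, v = rcoset_of H g & v' = rcoset_of H (g * gb);
  lg_root := H |}.

Definition stallings (H : set PSL2Z) : lgraph (set PSL2Z) :=
  spanned (schreier H) [set w | geodesic w /\ H (elt w)].

Definition has_size (n : nat) (H : set PSL2Z) : Prop :=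
  lg_vert (stallings H) #= `I_n.

Definition cyclically_reduced (H : set PSL2Z) : Prop :=
  forall v, lg_vert (stallings H) v ->
    (exists v', lg_a (stallings H) v v' \/ lg_a (stallings H) v' v) /\
    (exists v', lg_b (stallings H) v v' \/ lg_b (stallings H) v' v).

Definition fg_subgroups (n : nat) : set (set PSL2Z) :=
  [set H | [/\ is_subgroup H, finitely_generated H & has_size n H]].

Definition cr_fg_subgroups (n : nat) : set (set PSL2Z) :=
  fg_subgroups n `&` [set H | cyclically_reduced H].

(* The probability that a uniformly random element of the finite set [E] lies in
   [A]; by totality of the division it is 0 if [E] is empty. [fset_set] is the
   enumeration of a finite set (and is empty on infinite sets, which the sets of
   subgroups of a given size are not). *)
Definition unif_prob (R : realType) (T : choiceType) (E A : set T) : R :=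
  (#|` fset_set (E `&` A)|%:R / #|` fset_set E|%:R)%R.

(* Main.v *)
(** Numbering the vertices of the Stallings graph of a subgroup of size [n] turns
    the subgroup into a pair [(a, b)] on [n] points: [a] is an involution, and [b]
    is a permutation [beta] with cycles of length at most 3, made undefined on a
    set [D] containing exactly one point of each 2-cycle. A pair of this kind comes
    from a subgroup as soon as it is transitive, and each subgroup has [n!]
    numberings. The subgroup is non-parabolic only if every cycle of "[beta], then
    [a]" meets [D].

    Fix [b], put [k = #|D|], and reveal [a] one point at a time. As long as [m > k]
    points are left, one of them, [x], is outside [D]; matching [x] with its current
    image closes a cycle that avoids [D], and any other choice leads to a similar
    problem with fewer points. Every step thus loses a factor close to [1 - 1/m] and
    uses up (mostly) two points, so that a proportion of about [sqrt (k / n)] of the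
    involutions survives. The mean of [k] is [O(n^(2/3))], which gives [n^(-1/6)].

    If [T_n] is the number of all pairs, then [T_n / n!] grows like [n^(n/6)], so that
    intransitive pairs are a vanishing proportion, as are those in which the root is a
    fixed point of [a] or [beta] (these account for subgroups whose root lacks an
    edge). *)

Require Import Defs.
From HB Require Import structures.
From mathcomp Require Import all_boot all_order all_algebra all_fingroup.
From mathcomp Require Import all_classical all_reals all_analysis.
From mathcomp Require Import finmap zify ring lra.
Import Order.TTheory GRing.Theory Num.Theory.
Import numFieldNormedType.Exports.
Set Implicit Arguments.
Unset Strict Implicit.
Unset Printing Implicit Defensive.

(** * Counting involutions and b-structures *)

(** The bound $\alpha<1/6$ enters as $c=3\alpha<1/2$. A loss of $1/m$ spread over mostly two points
    is a loss of $c/i$ per point for any $c<1/2$ once $i$ is large; the slack absorbs the steps that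
    use up a single point. What survives is $(k/n)^c$, and for $k$ of order $n^{2/3}$ this is
    $n^{-c/3}=n^{-\alpha}$. The mean of $k$ suffices because $x^c\le 1+x$, used with $x=k/n^{2/3}$.
    That mean is the product of the mean numbers of fixed points of b-structures on $n$ and on $n-1$
    points, and these are controlled by Cauchy-Schwarz together with the 3-cycle term of the
    recurrence, without asymptotics for the counting sequences.

    On the graph side, the obstacle is that a Stallings graph is spanned by geodesic loops, whereas
    transitivity only provides some walk to each point. Walks are therefore lifted to states that
    remember the type of the next letter; reachability between states is symmetric, which yields an
    alternating loop through every edge. *)

Section Involutions.
Import mathcomp.boot.fintype mathcomp.boot.finset mathcomp.fingroup.fingroup mathcomp.fingroup.perm.

Section PermOn.
Local Open Scope group_scope.
Variable T : finType.
Implicit Types (X Y D E : {set T}) (a b c s : {perm T}).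

Lemma perm_on_divl X Y b c : perm_on Y c -> perm_on X b -> Y \subset X ->
  {in Y, b =1 c} -> perm_on (X :\: Y) (b * c^-1).
Proof.
move=> cY bX YX bc; apply/subsetP=> x; rewrite !inE permM => ne.
have [xY|xY] := boolP (x \in Y); first by rewrite bc // permK eqxx in ne.
apply: contraR ne => /(out_perm bX) ->.
by rewrite (out_perm (perm_onV cY)).
Qed.

Lemma perm_on_stable X Y b u : perm_on (X :\: Y) b -> (b u \in Y) = (u \in Y).
Proof.
move=> bXY; have [uY|uY] := boolP (u \in Y).
  by rewrite (out_perm bXY) // inE uY.
apply/negbTE; have [uX|uX] := boolP (u \in X).
  by have := perm_closed u bXY; rewrite !inE uY uX /= => /andP[].
by rewrite (out_perm bXY) // inE (negbTE uX) andbF.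
Qed.

Lemma mul_perm_on_in X Y b c : perm_on (X :\: Y) b ->
  {in Y, b * c =1 c}.
Proof. by move=> bXY u uY; rewrite permM (out_perm bXY) // inE uY. Qed.

Lemma mul_perm_on_out X Y b c u : perm_on Y c -> perm_on (X :\: Y) b ->
  u \notin Y -> (b * c) u = b u.
Proof.
by move=> cY bXY uY; rewrite permM (out_perm cY) // (perm_on_stable _ bXY).
Qed.

Lemma perm_on_mulr X Y b c : perm_on Y c -> Y \subset X ->
  perm_on (X :\: Y) b -> perm_on X (b * c).
Proof.
move=> cY YX bXY; apply: perm_onM; last exact: subset_trans cY YX.
by apply: subset_trans bXY _; apply: subsetDl.
Qed.

Lemma card_fiber_perm (S : {set {perm T}}) (X : {set T}) x :
  (forall a, a \in S -> a x \in X) ->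
  #|S| = \sum_(y in X) #|[set a in S | a x == y]|.
Proof.
move=> SX; rewrite -sum1_card (partition_big (fun a => a x) (mem X)) //=.
by apply: eq_bigr => y _; rewrite -sum1_card; apply: eq_bigl => a; rewrite !inE.
Qed.

Definition Invols X : {set {perm T}} :=
  [set a | perm_on X a && [forall x, a (a x) == x]].

Lemma InvolsP X a : reflect (perm_on X a /\ involutive a) (a \in Invols X).
Proof.
rewrite inE; apply: (iffP andP) => -[aX inv]; split=> //.
  by move=> x; apply/eqP/(forallP inv).
by apply/forallP=> x; rewrite inv.
Qed.

(** The prescribed part on [Y] splits off as a factor: [b = a * c^-1] is supported outside [Y]. *)
Lemma Invols_fiber X Y c : Y \subset X -> c \in Invols Y ->
  [set a in Invols X | [forall u in Y, a u == c u]] =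
  (fun b => b * c) @: Invols (X :\: Y).
Proof.
move=> YX /InvolsP[cY cK]; apply/setP=> a; apply/idP/imsetP => [|[b /InvolsP[bXY bK] ->]].
  rewrite inE => /andP[/InvolsP[aX aK] /forall_inP/= ac].
  have {}ac : {in Y, a =1 c} by move=> u uY; apply/eqP/ac.
  have bXY := perm_on_divl cY aX YX ac.
  exists (a * c^-1); last by rewrite mulgKV.
  apply/InvolsP; split=> // u; have [uY|uY] := boolP (u \in Y).
    by rewrite !(out_perm bXY) // inE uY.
  have e v : v \notin Y -> (a * c^-1) v = a v.
    move=> vY; rewrite -[in RHS](mulgKV c a) -/(a * c^-1).
    by rewrite (mul_perm_on_out cY bXY).
  have uY' : (a * c^-1) u \notin Y by rewrite (perm_on_stable _ bXY).
  by rewrite (e _ uY') (e _ uY) aK.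
rewrite inE; apply/andP; split; last first.
  by apply/forall_inP => u uY; rewrite (mul_perm_on_in _ bXY).
apply/InvolsP; split=> [|u]; first exact: perm_on_mulr bXY.
have [uY|uY] := boolP (u \in Y).
  by rewrite ?(mul_perm_on_in c bXY) // ?cK // perm_closed.
by rewrite ?(mul_perm_on_out cY bXY) // ?bK // (perm_on_stable _ bXY).
Qed.

Lemma tperm_Invols x y : tperm x y \in Invols [set x; y].
Proof. by apply/InvolsP; split; [apply: tperm_on|apply: tpermK]. Qed.

Lemma Invols_at X x y : x \in X -> y \in X ->
  [set a in Invols X | a x == y] =
  (fun b => b * tperm x y) @: Invols (X :\: [set x; y]).
Proof.
move=> xX yX; rewrite -Invols_fiber ?tperm_Invols ?subUset ?sub1set ?xX //.
apply/setP=> a; rewrite !inE; apply: andb_id2l => /andP[_ /forallP aK].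
apply/eqP/forall_inP => [e u|/(_ x)].
  by rewrite !inE => /orP[]/eqP->; rewrite ?tpermL ?tpermR ?e // -e.
by rewrite tpermL => /(_ (set21 _ _))/eqP.
Qed.

Lemma card_Invols_at X x y : x \in X -> y \in X ->
  #|[set a in Invols X | a x == y]| = #|Invols (X :\: [set x; y])|.
Proof. by move=> xX yX; rewrite Invols_at // card_imset //; apply: mulIg. Qed.

Lemma Invols_fix X x : x \in X -> [set a in Invols X | a x == x] = Invols (X :\ x).
Proof.
move=> xX; rewrite Invols_at // tperm1 setUid -[RHS]imset_id.
by apply: eq_imset => a; rewrite mulg1.
Qed.

End PermOn.

(** The telephone numbers: a given point is fixed or exchanged with one of the [k] others. *)
Fixpoint invn (n : nat) : nat :=
  match n with
  | 0 | 1 => 1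
  | (m.+1 as k).+1 => invn k + k * invn m
  end.

Lemma invnSS m : invn m.+2 = invn m.+1 + m.+1 * invn m. Proof. by []. Qed.

Lemma card_setD2 (T : finType) (X : {set T}) x y : x \in X -> y \in X :\ x ->
  #|X :\: [set x; y]| = (#|X| - 2)%N.
Proof.
move=> xX; rewrite 2!inE => /andP[yx yX]; rewrite cardsD (setIidPr _).
  by rewrite cards2 eq_sym yx.
by rewrite subUset !sub1set xX.
Qed.

Lemma card_Invols (T : finType) (X : {set T}) : #|Invols X| = invn #|X|.
Proof.
have [m] := ubnP #|X|; elim: m X => // m IH X ltm.
have [->|[x xX]] := set_0Vmem X.
  rewrite cards0 -[RHS](cards1 (1%g : {perm T})); apply: eq_card => a.
  rewrite !inE; apply/andP/eqP => [[a0 _]|->].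
    by apply: (perm_on_id a0); rewrite cards0.
  by split; [apply: perm_on1|apply/forallP => x; rewrite !perm1].
rewrite (@card_fiber_perm _ _ X x); last first.
  by move=> a /InvolsP[aX _]; rewrite perm_closed.
rewrite (big_setD1 x) //= Invols_fix // IH; last first.
  by rewrite (cardsD1 x) xX in ltm.
rewrite (eq_bigr (fun=> invn (#|X| - 2))) => [|y yXx]; last first.
  have yX : y \in X by move: yXx; rewrite inE => /andP[].
  rewrite card_Invols_at // IH card_setD2 //.
  by have := cardsD1 x X; rewrite xX; lia.
have := cardsD1 x X; rewrite xX sum_nat_const.
case: #|X :\ x| => [|k] -> //=; rewrite !add1n ?invnSS ?subSS ?subn0 //.
Qed.

End Involutions.

Section BStructures.
Import mathcomp.boot.fintype mathcomp.boot.finset mathcomp.fingroup.fingroup mathcomp.fingroup.perm.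

Section BStruct.
Local Open Scope group_scope.
Variable T : finType.
Implicit Types (X Y D E : {set T}) (b c s : {perm T}) (p : {perm T} * {set T}).

(* [D] marks the point of each 2-cycle of [b] at which the partial map that [b]
   represents is undefined. *)
Definition block_ok b D x :=
  (b (b (b x)) == x) && (x \notin D)
  || (b (b x) == x) && ((x \in D) (+) (b x \in D)).

Definition Bst X : {set {perm T} * {set T}} :=
  [set p | perm_on X p.1 && [forall x, block_ok p.1 p.2 x]].

Lemma BstP X p :
  reflect (perm_on X p.1 /\ forall x, block_ok p.1 p.2 x) (p \in Bst X).
Proof. by rewrite inE; apply: (iffP andP) => -[? /forallP]. Qed.

Lemma block_ok_fix b D x : b x = x -> block_ok b D x = (x \notin D).
Proof. by move=> bx; rewrite /block_ok !bx eqxx addbb orbF. Qed.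

Lemma Bst_subset X p : p \in Bst X -> p.2 \subset X.
Proof.
case/BstP=> bX ok; apply/subsetP=> x; apply: contraTT => xX.
by have := ok x; rewrite block_ok_fix // (out_perm bX).
Qed.

Lemma block_ok_out X Y b c D E u : perm_on Y c -> perm_on (X :\: Y) b ->
  E \subset Y -> u \notin Y -> block_ok (b * c) (D :|: E) u = block_ok b D u.
Proof.
move=> cY bXY EY uY; have ne v : v \notin Y -> (v \in D :|: E) = (v \in D).
  by move=> vY; rewrite inE (contraNF (subsetP EY v)) ?orbF.
have e v : v \notin Y -> (b * c) v = b v := mul_perm_on_out cY bXY.
have bY v : v \notin Y -> b v \notin Y by rewrite (perm_on_stable _ bXY).
by rewrite /block_ok !(e u) // !(e (b u)) ?bY // ?(e (b (b u))) ?ne ?bY.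
Qed.

Lemma block_ok_in X Y b c D E u : perm_on Y c -> perm_on (X :\: Y) b ->
  [disjoint D & Y] -> u \in Y -> block_ok (b * c) (D :|: E) u = block_ok c E u.
Proof.
move=> cY bXY DY uY; have ne v : v \in Y -> (v \in D :|: E) = (v \in E).
  by move=> vY; rewrite inE (disjointFl DY).
have e v : v \in Y -> (b * c) v = c v by apply: (mul_perm_on_in c bXY).
have cv v : v \in Y -> c v \in Y by rewrite perm_closed.
by rewrite /block_ok !(e u) // !(e (c u)) ?cv // ?(e (c (c u))) ?ne ?cv.
Qed.

Lemma Bst_fiber X Y c E : Y \subset X -> perm_on Y c -> E \subset Y ->
  {in Y, forall u, block_ok c E u} ->
  [set p in Bst X | [forall u in Y, p.1 u == c u] && (p.2 :&: Y == E)] =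
  (fun p => (p.1 * c, p.2 :|: E)) @: Bst (X :\: Y).
Proof.
move=> YX cY EY ok; apply/setP=> -[b D]; apply/idP/imsetP => [|[[b' D'] bXY /= [-> ->]]].
  rewrite inE /= => /and3P[/BstP[/= bX bK] /forall_inP/= bc /eqP DE].
  have {}bc : {in Y, b =1 c} by move=> u uY; apply/eqP/bc.
  have bXY := perm_on_divl cY bX YX bc.
  have eD : D = (D :\: Y) :|: E by rewrite -DE setUC setID.
  exists (b * c^-1, D :\: Y); last by rewrite /= mulgKV -eD.
  apply/BstP; split=> //= u; have [uY|uY] := boolP (u \in Y).
    by rewrite block_ok_fix ?inE ?uY // (out_perm bXY) // inE uY.
  by rewrite -(block_ok_out (D :\: Y) cY bXY EY uY) mulgKV -eD.
have /= D'X := Bst_subset bXY; case/BstP: bXY => /= bXY bK.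
have DY : [disjoint D' & Y] by case/subsetDP: D'X.
rewrite inE; apply/and3P => /=; split.
- apply/BstP; split=> [|u] /=; first exact: perm_on_mulr bXY.
  have [uY|uY] := boolP (u \in Y).
    by rewrite (block_ok_in E cY bXY DY uY) ok.
  by rewrite (block_ok_out D' cY bXY EY uY).
- by apply/forall_inP => u uY; rewrite (mul_perm_on_in _ bXY).
- by rewrite setIUl (setIidPl EY) (disjoint_setI0 DY) set0U.
Qed.

Lemma card_Bst_fiber X Y c E : Y \subset X -> perm_on Y c -> E \subset Y ->
  {in Y, forall u, block_ok c E u} ->
  #|[set p in Bst X | [forall u in Y, p.1 u == c u] && (p.2 :&: Y == E)]| =
  #|Bst (X :\: Y)|.
Proof.
move=> YX cY EY ok; rewrite Bst_fiber // card_in_imset // => -[b D] [b' D'].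
move=> /Bst_subset/= DX /Bst_subset/= D'X /= [/mulIg -> e]; congr (_, _).
have d (F : {set T}) : F \subset X :\: Y -> (F :|: E) :\: Y = F.
  rewrite subsetD => /andP[_ FY]; rewrite setDUl (setDidPl FY).
  by move: EY; rewrite -setD_eq0 => /eqP ->; rewrite setU0.
by rewrite -(d D) // e d.
Qed.

Lemma Bst_fix X x : x \in X -> [set p in Bst X | p.1 x == x] = Bst (X :\ x).
Proof.
move=> xX; apply/setP=> -[b D]; rewrite inE /=; apply/andP/BstP => /=.
  case=> /BstP[/= bX ok] /eqP bx; split=> //; apply/subsetP=> u ubu.
  rewrite 2!inE (subsetP bX) // andbT; apply: contraNneq ubu => -> /=.
  exact/eqP.
case=> /= bX ok; split; first apply/BstP; first split => //=.
  by apply: subset_trans bX _; apply: subsetDl.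
by rewrite (out_perm bX) // !inE eqxx.
Qed.

Lemma card_Bst_edge X x y : x \in X -> y \in X :\ x ->
  #|[set p in Bst X | (p.1 x == y) && (x \in p.2)]| =
  #|Bst (X :\: [set x; y])|.
Proof.
move=> xX; rewrite 2!inE => /andP[yx yX].
rewrite -(@card_Bst_fiber _ _ (tperm x y) [set x]) ?tperm_on //; last 3 first.
- by rewrite subUset !sub1set xX.
- by rewrite sub1set set21.
- move=> u; rewrite /block_ok !tpermK eqxx /= => /set2P[]->.
    by rewrite tpermL !inE (negbTE yx) eqxx orbT.
  by rewrite tpermR !inE (negbTE yx) eqxx orbT.
apply: eq_card => -[b D]; rewrite [LHS]inE [RHS]inE /=.
apply: andb_id2l => /BstP[/= bX ok]; apply/andP/andP => -[].
  move=> /eqP bx xD; have := ok x; rewrite /block_ok bx xD andbF /=.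
  case/andP=> /eqP byx yD; split.
    by apply/forall_inP=> u /set2P[]->; rewrite ?tpermL ?tpermR ?bx ?byx.
  apply/eqP/setP=> u; rewrite !inE; have [->|ux] := eqVneq u x; first by rewrite xD.
  by have [->|uy] := eqVneq u y; rewrite ?(negbTE yD) ?andbF.
move=> /forall_inP/(_ x (set21 _ _)); rewrite tpermL => bx /eqP/setP/(_ x).
by rewrite !inE eqxx andbT.
Qed.

Lemma card_Bst_coedge X x y : x \in X -> y \in X :\ x ->
  #|[set p in Bst X | (p.1 x == y) && (y \in p.2)]| =
  #|Bst (X :\: [set x; y])|.
Proof.
move=> xX yXx; have := yXx; rewrite 2!inE => /andP[yx yX].
rewrite setUC -card_Bst_edge ?inE ?xX 1?eq_sym ?yx //.
apply: eq_card => -[b D]; rewrite [LHS]inE [RHS]inE /=; apply: andb_id2l => /BstP[/= bX ok].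
apply: andb_id2r => yD; have okx := ok x; have oky := ok y.
apply/eqP/eqP=> [bx|byx].
  move: oky; rewrite /block_ok yD andbF /= -{1 2}bx => /andP[/eqP/perm_inj e _].
  by rewrite -bx.
by move: oky; rewrite /block_ok yD byx andbF => /andP[/eqP].
Qed.

Lemma card_Bst_triangle X x y z : x \in X -> y \in X :\ x ->
  z \in X :\: [set x; y] ->
  #|[set p in Bst X | (p.1 x == y) && (p.1 y == z)]| =
  #|Bst (X :\: [set x; y] :\ z)|.
Proof.
move=> xX; rewrite 2!inE => /andP[yx yX].
rewrite !inE negb_or => /andP[/andP[zx zy] zX].
pose c := tperm x y * tperm x z.
have cx : c x = y by rewrite permM tpermL tpermD // eq_sym.
have cy : c y = z by rewrite permM tpermR tpermL.
have cz : c z = x by rewrite permM [tperm x y z]tpermD ?tpermR // eq_sym.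
rewrite setDDl -(@card_Bst_fiber _ _ c set0) ?sub0set //; last 3 first.
- by rewrite !subUset !sub1set xX yX.
- apply: perm_onM.
    by apply: subset_trans (tperm_on _ _) _; rewrite subsetUl.
  apply: subset_trans (tperm_on _ _) _.
  by rewrite subUset !sub1set !inE !eqxx /= ?orbT.
- move=> u; rewrite /block_ok !inE /= andbT -orbA => /or3P[]/eqP->;
  by rewrite ?(cx, cy, cz) eqxx.
apply: eq_card => -[b D]; rewrite [LHS]inE [RHS]inE /=.
apply: andb_id2l => /BstP[/= bX ok]; apply/andP/andP => -[]; last first.
  move=> /forall_inP => e _.
  by split; [rewrite -cx|rewrite -cy]; apply: e; rewrite !inE eqxx ?orbT.
move=> /eqP bx /eqP byz.
have bz : b z = x /\ x \notin D.
  have := ok x; rewrite /block_ok bx byz (negbTE zx) /= orbF => /andP[/eqP //].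
have yD : y \notin D.
  have := ok y; rewrite /block_ok byz bz.1 [x == y]eq_sym (negbTE yx) /= orbF.
  by case/andP.
have zD : z \notin D.
  have := ok z; rewrite /block_ok bz.1 bx [y == z]eq_sym (negbTE zy) /= orbF.
  by case/andP.
split.
  by apply/forall_inP=> u; rewrite !inE -orbA => /or3P[]/eqP->;
    rewrite ?(bx, byz, bz.1, cx, cy, cz).
apply/eqP/setP=> u; rewrite !inE andbC; apply/negbTE.
by apply/negP => /andP[]; rewrite -orbA => /or3P[]/eqP->; apply/negP; case: bz.
Qed.

End BStruct.

(** Recurrence on the block of a given point among [r.+1]: it is fixed, or in a 2-cycle with one of
    [r] partners and two choices for the point of [D], or in a 3-cycle given by its ordered pair of
    successors. *)
Fixpoint bstn (n : nat) : nat :=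
  match n with
  | 0 | 1 => 1
  | 2 => 3
  | ((p.+1 as q).+1 as r).+1 => bstn r + 2 * r * bstn q + r * q * bstn p
  end.

Lemma bstnSSS p :
  bstn p.+3 = bstn p.+2 + 2 * p.+2 * bstn p.+1 + p.+2 * p.+1 * bstn p.
Proof. by []. Qed.

Lemma card_Bst (T : finType) (X : {set T}) : #|Bst X| = bstn #|X|.
Proof.
have [m] := ubnP #|X|; elim: m X => // m IH X ltm.
have [->|[x xX]] := set_0Vmem X.
  rewrite cards0 -[RHS](cards1 ((1%g, set0) : {perm T} * {set T})).
  apply: eq_card => -[b D]; rewrite !inE.
  apply/idP/eqP => [bD|[-> ->]]; last first.
    rewrite perm_on1; apply/forallP => x.
    by rewrite block_ok_fix /= ?perm1 // inE.
  have := @Bst_subset T set0 (b, D); rewrite inE bD => /(_ isT) /=.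
  rewrite subset0 => /eqP ->; case/andP: bD => b0 _.
  by congr (_, _); apply: (perm_on_id b0); rewrite cards0.
have cX := cardsD1 x X; rewrite xX in cX.
rewrite -sum1_card (partition_big (fun p : {perm T} * {set T} => p.1 x) (mem X)) /=; last first.
  by move=> p /BstP[bX _]; rewrite perm_closed.
rewrite (big_setD1 x) //= sum1dep_card Bst_fix // IH; last by rewrite cX in ltm.
rewrite (eq_bigr (fun=> 2 * bstn (#|X| - 2) + (#|X| - 2) * bstn (#|X| - 3))).
  rewrite sum_nat_const cX; case: #|X :\ x| => [|[|k]] //.
  by rewrite !add1n !subSS !subn0 bstnSSS; lia.
move=> y yXx; have cXy := card_setD2 xX yXx.
(* If [b y = x], the block is a 2-cycle, whose point of [D] is either [x] or [y]; otherwise it is a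
   3-cycle through some third point [z]. *)
rewrite (bigID (fun p : {perm T} * {set T} => p.1 y == x)) /=; congr addn.
  rewrite (bigID (fun p : {perm T} * {set T} => x \in p.2)) /= mul2n -addnn; congr addn.
    rewrite -cXy -IH ?cXy; last by lia.
    rewrite -card_Bst_edge // -sum1dep_card; apply: eq_bigl => -[b D] /=.
    rewrite -!andbA; apply: andb_id2l => /BstP[/= _ ok].
    apply: andb_id2l => /eqP bx; rewrite andbC; apply: andb_idr => xD.
    by have := ok x; rewrite /block_ok bx xD andbF /= => /andP[].
  rewrite -cXy -IH ?cXy; last by lia.
  rewrite -card_Bst_coedge // -sum1dep_card; apply: eq_bigl => -[b D] /=.
  rewrite -!andbA; apply: andb_id2l => /BstP[/= _ ok].
  apply: andb_id2l => /eqP bx; apply/andP/idP => [[/eqP byx xD]|yD].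
    have := ok x; rewrite /block_ok bx byx (negbTE xD) bx /=.
    by move: yXx; rewrite !eqxx 2!inE => /andP[/negbTE->].
  have := ok y; rewrite /block_ok yD andbF /= -{1 2}bx => /andP[/eqP/perm_inj byx].
  by rewrite bx in byx; rewrite byx eqxx.
rewrite (partition_big (fun p : {perm T} * {set T} => p.1 y)
  (mem (X :\: [set x; y]))) /=; last first.
  move=> -[b D] /= /andP[/andP[/BstP[/= bX _] /eqP bx] byx].
  move: yXx; rewrite 2!inE => /andP[yx yX].
  rewrite !inE (negbTE byx) perm_closed // yX andbT /=.
  by apply: contraNneq yx => byy; apply/eqP/(@perm_inj _ b); rewrite byy bx.
rewrite -cXy -sum_nat_const; apply: eq_bigr => z zX.
have cz : #|X :\: [set x; y] :\ z| = #|X| - 3.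
  by have := cardsD1 z (X :\: [set x; y]); rewrite zX; lia.
rewrite -cz -IH ?cz; last by lia.
rewrite -card_Bst_triangle // -sum1dep_card; apply: eq_bigl => -[b D] /=.
rewrite -!andbA; apply: andb_id2l => _; apply: andb_id2l => _.
rewrite andbC; apply: andb_idr => /eqP ->.
by move: zX; rewrite !inE negb_or => /andP[/andP[]].
Qed.

End BStructures.

(** * Closing cycles by peeling *)

Section OrbitCounting.
Import mathcomp.boot.fintype mathcomp.boot.finset mathcomp.fingroup.fingroup mathcomp.fingroup.perm.

Section Moments.
Variable T : finType.
Implicit Types (X : {set T}).

(** Double count of the pairs of a structure and a point of its [D]: the point has $|X|-1$ possible
    images, and its 2-cycle is then removed. *)
Lemma sum_card_Bst_ends X :
  \sum_(p in Bst X) #|p.2| = #|X| * (#|X| - 1) * bstn (#|X| - 2).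
Proof.
under eq_bigr => p pX.
  rewrite -sum1_card big_mkcond (bigID (mem X)) /= [X in _ + X]big1 ?addn0; last first.
    by move=> x xX; rewrite (contraNF (subsetP (Bst_subset pX) x)).
  over.
rewrite /= exchange_big /= -mulnA -sum_nat_const; apply: eq_bigr => x xX.
have cX := cardsD1 x X; rewrite xX in cX.
rewrite -big_mkcondr /=.
rewrite (partition_big (fun p : {perm T} * {set T} => p.1 x)
  (mem (X :\ x))) /=; last first.
  move=> -[b D] /= /andP[/BstP[/= bX ok] xD]; rewrite !inE perm_closed // xX andbT.
  by apply/eqP => bx; have := ok x; rewrite block_ok_fix // xD.
rewrite cX add1n subn1 /= -sum_nat_const; apply: eq_bigr => y yX.
rewrite sum1dep_card -[(_.+1 - 2)%N]/(#|X :\ x|.+1 - 2)%N -add1n -cX.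
rewrite -(card_setD2 xX yX) -card_Bst -card_Bst_edge //.
by apply: eq_card => p; rewrite !inE -!andbA [(_ \in _) && _]andbC.
Qed.

Lemma sum_fix_Bst X :
  \sum_(p in Bst X) #|[set x in X | p.1 x == x]| = #|X| * bstn (#|X| - 1).
Proof.
under eq_bigr do rewrite -sum1_card big_mkcond /=.
rewrite exchange_big /= (bigID (mem X)) /= [X in _ + X]big1 ?addn0; last first.
  by move=> x xX; apply: big1 => p _; rewrite inE (negbTE xX).
rewrite -sum_nat_const; apply: eq_bigr => x xX; rewrite -big_mkcondr /=.
rewrite sum1dep_card; have := cardsD1 x X; rewrite xX => ->; rewrite add1n subn1 /=.
by rewrite -card_Bst -Bst_fix //; apply: eq_card => p; rewrite !inE xX.
Qed.

(** Ordered pairs of fixed points: the first term counts the distinct ones, the second the equal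
    ones. *)
Lemma sum_fix2_Bst X :
  \sum_(p in Bst X) #|[set x in X | p.1 x == x]| ^ 2 =
  #|X| * (#|X| - 1) * bstn (#|X| - 2) + #|X| * bstn (#|X| - 1).
Proof.
transitivity (\sum_(x in X) \sum_(y in X)
    #|[set p in Bst X | (p.1 x == x) && (p.1 y == y)]|).
  under eq_bigr do rewrite -mulnn -sum1_card big_distrlr /= big_mkcond /=.
  rewrite exchange_big /= (bigID (mem X)) /= [X in _ + X]big1 ?addn0; last first.
    by move=> x xX; apply: big1 => p _; rewrite inE (negbTE xX).
  apply: eq_bigr => x xX; rewrite -big_mkcondr /=.
  under eq_bigr do rewrite big_mkcond /=.
  rewrite exchange_big /= (bigID (mem X)) /= [X in _ + X]big1 ?addn0; last first.
    by move=> y yX; apply: big1 => p _; rewrite inE (negbTE yX).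
  apply: eq_bigr => y yX; rewrite -big_mkcondr /= sum1dep_card.
  by apply: eq_card => p; rewrite !inE xX yX /= !andbA.
have -> : #|X| * (#|X| - 1) * bstn (#|X| - 2) + #|X| * bstn (#|X| - 1) =
  #|X| * ((#|X| - 1) * bstn (#|X| - 2) + bstn (#|X| - 1)) by lia.
rewrite -sum_nat_const; apply: eq_bigr => x xX.
have cX := cardsD1 x X; rewrite xX in cX.
rewrite (big_setD1 x) //= addnC; congr addn.
  have -> : #|X| - 1 = #|X :\ x| by lia.
  rewrite -sum_nat_const; apply: eq_bigr => y yX.
  have -> : #|X| - 2 = #|X :\ x :\ y| by have := cardsD1 y (X :\ x); rewrite yX; lia.
  rewrite -card_Bst -Bst_fix // -Bst_fix //; apply: eq_card => p.
  by rewrite !inE -!andbA.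
have -> : #|X| - 1 = #|X :\ x| by lia.
rewrite -card_Bst -Bst_fix //; apply: eq_card => p.
by rewrite !inE andbb.
Qed.

End Moments.

Lemma leq_sum_sqr (I : finType) (P : {pred I}) (f : I -> nat) :
  (\sum_(i in P) f i) ^ 2 <= #|P| * \sum_(i in P) f i ^ 2.
Proof.
rewrite -(leq_pmul2l (isT : 0 < 2)) -mulnn big_distrlr /= big_distrr /=.
apply: (@leq_trans (\sum_(i in P) \sum_(j in P) (f i ^ 2 + f j ^ 2))).
  apply: leq_sum => i _; rewrite big_distrr /=; apply: leq_sum => j _.
  exact: nat_Cauchy.
under eq_bigr do rewrite big_split /= sum_nat_const.
by rewrite big_split /= -big_distrr /= sum_nat_const addnn mul2n.
Qed.

(** The squared first moment of the number of fixed points is at most the product of the zeroth and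
    second moments. In terms of ratios, the mean number of fixed points grows by at most 1 when a
    point is added. *)
Lemma bstn_CS m :
  (m.+1 * bstn m) ^ 2 <= bstn m.+1 * (m.+1 * m * bstn m.-1 + m.+1 * bstn m).
Proof.
have := leq_sum_sqr (mem (Bst [set: 'I_m.+1]))
  (fun p => #|[set x in [set: 'I_m.+1] | p.1 x == x]|).
rewrite sum_fix_Bst sum_fix2_Bst card_Bst cardsT card_ord subn1 /=.
by rewrite -subn1 subn1 -[(m.+1 - 2)%N]/(m - 1)%N subn1.
Qed.

Section Peeling.
Local Open Scope group_scope.
Variable T : finType.
Implicit Types (X Y D E : {set T}) (a b c s t : {perm T}).

Definition orbits_meet X D s := [forall x in X, ~~ [disjoint porbit s x & D]].

Lemma orbits_meetP X D s :
  reflect (forall x, x \in X -> exists i, iter i s x \in D) (orbits_meet X D s).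
Proof.
apply: (iffP forall_inP) => H x /H.
  by case/pred0Pn=> y /= /andP[/porbitP[i ->] yD]; exists i; rewrite -permX.
case=> i iD; apply/pred0Pn; exists (iter i s x) => /=.
by rewrite iD -permX mem_porbit.
Qed.

(* The point [x] is skipped in its cycle; if it belongs to [D], its role is taken
   over by its predecessor, which lies on the same cycle of [t * a]. *)
Lemma orbits_meet_contract X D t x : x \in X -> perm_on X t ->
  exists t' D', [/\ perm_on (X :\ x) t', #|D'| <= #|D|
    & forall a, perm_on (X :\ x) a -> orbits_meet X D (t * a) ->
       orbits_meet (X :\ x) D' (t' * a)].
Proof.
move=> xX tX; pose t' := t * tperm x (t x).
pose D' := (D :\ x) :|: [set y | (x \in D) && (t y == x)].
exists t', D'; split.
- apply/subsetP=> u; rewrite 2!inE permM => ne; have [e|ux] := eqVneq u x.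
    by rewrite e tpermR eqxx in ne.
  rewrite inE ux /=; apply: contraR ne => uX; rewrite (out_perm tX uX) tpermD //.
    by rewrite eq_sym.
  by rewrite -(out_perm tX uX) (inj_eq perm_inj) eq_sym.
- rewrite (leq_trans (leq_card_setU _ _)) // (cardsD1 x D).
  have [xD|xD] := boolP (x \in D); last first.
    rewrite add0n -[leqRHS]addn0 leq_add2l leqn0 cards_eq0.
    by apply/eqP/setP=> y; rewrite !inE.
  rewrite addnC leq_add2r /= -(cards1 (t^-1 x)).
  apply: subset_leq_card; apply/subsetP=> y; rewrite !inE /= => /eqP <-.
  by rewrite permK.
move=> a aX /orbits_meetP H; have ax : a x = x by rewrite (out_perm aX) // !inE eqxx.
apply/orbits_meetP => u; rewrite !inE => /andP[ux /H[i]] {H}.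
have [n] := ubnP i; elim: n i u ux => // n IH [|i] u ux ltn.
  by move=> uD; exists 0; rewrite /= !inE ux uD.
rewrite iterSr permM => iD; have [tux|tux] := eqVneq (t u) x; last first.
  have e : t' u = t u.
    by rewrite permM tpermD // 1?eq_sym // (inj_eq perm_inj).
  have [||j jD] := IH i (a (t u)) _ _ iD; [by rewrite -ax (inj_eq perm_inj)|by []|].
  by exists j.+1; rewrite iterSr permM e.
have [xD|xD] := boolP (x \in D).
  by exists 0; rewrite /= !inE xD tux eqxx orbT.
case: i ltn iD => [|i] ltn; first by rewrite /= tux ax (negbTE xD).
rewrite iterSr permM tux ax => iD.
have [||j jD] := IH i (a (t x)) _ _ iD; last 2 first.
- exact: ltnW.
- by exists j.+1; rewrite iterSr permM permM tux tpermL.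
rewrite -[X in _ != X]ax (inj_eq perm_inj); apply: contraNneq ux => txx.
by apply/eqP/(@perm_inj _ t); rewrite tux txx.
Qed.
(* Bounds the number of involutions [a] such that [t * a] has no cycle avoiding
   a set of at most [K] points; see [card_Invols_orbits_meet]. *)
Fixpoint peeln (K n : nat) : nat :=
  match n with
  | 0 | 1 => 1
  | (m.+1 as k).+1 =>
      if n <= K then invn n else peeln K k + m * peeln K m
  end.

Lemma peeln_le K n : n <= K -> peeln K n = invn n.
Proof. by case: n => [|[|n]] //= ->. Qed.

Lemma peelnSS K m : K < m.+2 -> peeln K m.+2 = peeln K m.+1 + m * peeln K m.
Proof. by move=> Km; rewrite [LHS]/= leqNgt Km. Qed.

Lemma invn_gt0 n : 0 < invn n.
Proof. by elim/ltn_ind: n => -[|[|n]] // IH; rewrite invnSS ltn_addr ?IH. Qed.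

Lemma leq_invnS n : invn n <= invn n.+1.
Proof. by case: n => // n; rewrite invnSS leq_addr. Qed.

Lemma leq_peelnS K n : peeln K n <= peeln K n.+1.
Proof.
case: n => // n; have [nK|Kn] := leqP n.+2 K.
  by rewrite !peeln_le ?leq_invnS // ltnW.
by rewrite peelnSS // leq_addr.
Qed.

(** Once [a x = y] is known, [a = b * tperm x y] and the transposition, which commutes with [b], is
    absorbed into [t]. The points [x] and [y] are then contracted away one after the other, which
    does not enlarge [D]. The case [x = y] is that of a fixed point. *)
Lemma Invols_at_orbits_meet X D t x y : x \in X -> y \in X -> perm_on X t ->
  exists t' D', [/\ perm_on (X :\: [set x; y]) t', #|D'| <= #|D|
    & #|[set a in Invols X | (a x == y) && orbits_meet X D (t * a)]| <=
      #|[set a in Invols (X :\: [set x; y]) | orbits_meet (X :\: [set x; y]) D' (t' * a)]| ].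
Proof.
move=> xX yX tX; pose t1 := t * tperm x y.
have t1X : perm_on X t1.
  apply: perm_onM => //; apply: subset_trans (tperm_on x y) _.
  by rewrite subUset !sub1set xX.
have [t' [D' [t'X D'D H]]] : exists t' D',
  [/\ perm_on (X :\: [set x; y]) t', #|D'| <= #|D|
    & forall a, perm_on (X :\: [set x; y]) a -> orbits_meet X D (t1 * a) ->
        orbits_meet (X :\: [set x; y]) D' (t' * a)].
  have [t2 [D2 [t2X D2D H2]]] := orbits_meet_contract D xX t1X.
  have [<-|xy] := eqVneq x y; first by rewrite setUid; exists t2, D2.
  have yXx : y \in X :\ x by rewrite !inE eq_sym xy.
  have [t3 [D3 [t3X D3D H3]]] := orbits_meet_contract D2 yXx t2X.
  rewrite setDDl in t3X H3; exists t3, D3; split=> //.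
    exact: leq_trans D3D D2D.
  move=> a aX /H2 => H; apply: H3 => //; apply: H.
  by apply: subset_trans aX _; rewrite setDS // subsetUl.
exists t', D'; split=> //.
rewrite -[leqRHS](card_imset _ (mulIg (tperm x y))); apply: subset_leq_card.
apply/subsetP => a; rewrite inE => /and3P[aX axy aD].
have : a \in [set a in Invols X | a x == y] by rewrite inE aX.
rewrite Invols_at // => /imsetP[b bX ab]; apply/imsetP; exists b => //.
rewrite inE bX /=; have [bXp _] := InvolsP _ _ bX; apply: H => //.
rewrite /t1 -mulgA; move: aD; rewrite ab.
suff -> : b * tperm x y = tperm x y * b by [].
apply: perm_onC bXp (tperm_on x y) _.
by rewrite -setI_eq0 setDE -setIA [_ :&: [set x; y]]setIC setICr setI0.
Qed.

(** As long as more than [K] points are left, some [x] lies outside [D]. The choice [a x = t x] is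
    excluded, since it makes [x] a fixed point of [t * a]. The choice [a x = x] leaves a problem
    with one point less, the other choices leave problems with two points less. *)
Lemma card_Invols_orbits_meet K X D t : perm_on X t -> #|D| <= K ->
  #|[set a in Invols X | orbits_meet X D (t * a)]| <= peeln K #|X|.
Proof.
have [m] := ubnP #|X|; elim: m X D t => // m IH X D t ltm tX DK.
have [XK|KX] := leqP #|X| K.
  rewrite peeln_le // -card_Invols subset_leq_card //.
  by apply/subsetP=> a; rewrite inE => /andP[].
have /subsetPn[x xX xD] : ~~ (X \subset D).
  by apply: contraTN (leq_ltn_trans DK KX) => /subset_leq_card; rewrite -leqNgt.
have cX := cardsD1 x X; rewrite xX in cX.
pose S y := [set a in Invols X | (a x == y) && orbits_meet X D (t * a)].
have Stx : #|S (t x)| = 0.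
  apply: eq_card0 => a; apply/negP; rewrite /S inE.
  case/and3P=> /InvolsP[aX aK] /eqP ax /orbits_meetP/(_ x xX)[i].
  have fx : (t * a) x = x by rewrite permM -ax aK.
  by rewrite iter_fix // (negbTE xD).
have SE : #|[set a in Invols X | orbits_meet X D (t * a)]| =
    #|S x| + \sum_(y in X :\ x) #|S y|.
  rewrite (@card_fiber_perm _ _ X x).
    rewrite (big_setD1 x) //=; congr (_ + _); last (apply: eq_bigr => y _);
    by apply: eq_card => a; rewrite !inE -!andbA [orbits_meet _ _ _ && _]andbC.
  by move=> a; rewrite inE => /andP[/InvolsP[aX _] _]; rewrite perm_closed.
have Sx : #|S x| <= peeln K (#|X| - 1).
  have [t' [D' [t'X D'D H]]] := Invols_at_orbits_meet D xX xX tX.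
  rewrite setUid in t'X H.
  have -> : #|X| - 1 = #|X :\ x| by lia.
  by apply: leq_trans H _; apply: IH => //; lia.
have Sy y : y \in X :\ x -> #|S y| <= peeln K (#|X| - 2).
  move=> yXx; have yX : y \in X by move: yXx; rewrite 2!inE => /andP[].
  have [t' [D' [t'X D'D H]]] := Invols_at_orbits_meet D xX yX tX.
  have c2 := card_setD2 xX yXx; rewrite -c2.
  by apply: leq_trans H _; apply: IH => //; lia.
(* If [t x = x], the excluded choice is [a x = x], and monotonicity of [peeln] trades one two-point
   term for the missing one-point term. *)
rewrite SE; have [txx|txx] := eqVneq (t x) x.
  rewrite -{1}txx Stx add0n.
  apply: (@leq_trans (#|X :\ x| * peeln K (#|X| - 2))).
    by rewrite -sum_nat_const; apply: leq_sum => y /Sy.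
  move: KX; rewrite cX; case: #|X :\ x| => [|k] //; rewrite add1n => KX.
  by rewrite subSS subn1 peelnSS // mulSn leq_add2r leq_peelnS.
have txX : t x \in X :\ x by rewrite !inE txx perm_closed.
rewrite (big_setD1 (t x)) //= Stx add0n.
have cX2 := cardsD1 (t x) (X :\ x); rewrite txX in cX2.
apply: (@leq_trans (peeln K (#|X| - 1) + #|X :\ x :\ t x| * peeln K (#|X| - 2))).
  rewrite leq_add // -sum_nat_const; apply: leq_sum => y.
  by rewrite inE => /andP[_ /Sy].
move: KX; rewrite cX cX2 !add1n subSS subSS subn0 subn1 /= => KX.
by rewrite -[X in _ <= X]/(peeln K _.+2) peelnSS.
Qed.

End Peeling.

End OrbitCounting.

(** * Intransitive pairs *)

Section Intransitive.
Import mathcomp.boot.fintype mathcomp.boot.finset mathcomp.fingroup.fingroup mathcomp.fingroup.perm.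

Section Stable.
Local Open Scope group_scope.
Variable T : finType.
Implicit Types (S X Y D E : {set T}) (a b c s t : {perm T}).

Lemma stable_mem S s u : s @: S = S -> (s u \in S) = (u \in S).
Proof. by move=> sS; rewrite -{1}sS mem_imset //; apply: perm_inj. Qed.

Lemma stable_setC S s : s @: S = S -> s @: (~: S) = ~: S.
Proof.
move=> sS; apply/eqP; rewrite eqEcard card_imset ?leqnn ?andbT; last exact: perm_inj.
by apply/subsetP=> _ /imsetP[u uS ->]; rewrite inE (stable_mem _ sS) -in_setC.
Qed.

Lemma restr_stable S s u : s @: S = S ->
  restr_perm S s u = if u \in S then s u else u.
Proof.
move=> sS; case: ifPn => uS; last by rewrite (out_perm (restr_perm_on S s)).
rewrite restr_permE // !inE /=; apply/subsetP=> v vS.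
by rewrite inE /= apermE (stable_mem _ sS).
Qed.

Lemma restr_perm_inj2 S s t : s @: S = S -> t @: S = S ->
  restr_perm S s = restr_perm S t -> restr_perm (~: S) s = restr_perm (~: S) t ->
  s = t.
Proof.
move=> sS tS /permP e /permP e'; apply/permP => u.
have := e u; have := e' u; rewrite !restr_stable ?stable_setC // inE.
by case: (u \in S).
Qed.

Lemma restr_Invols S a : a @: S = S -> involutive a -> restr_perm S a \in Invols S.
Proof.
move=> aS aK; apply/InvolsP; split=> [|u]; first exact: restr_perm_on.
rewrite !(restr_stable _ aS); have [uS|/negbTE->] // := boolP (u \in S).
by rewrite (stable_mem _ aS) uS aK.
Qed.

Lemma restr_Bst S b D : b @: S = S -> (forall x, block_ok b D x) ->
  (restr_perm S b, D :&: S) \in Bst S.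
Proof.
move=> bS ok; apply/BstP; split=> [|u] /=; first exact: restr_perm_on.
have [uS|uS] := boolP (u \in S); last first.
  by rewrite block_ok_fix ?(restr_stable _ bS) ?(negbTE uS) // inE (negbTE uS) andbF.
have := ok u; rewrite /block_ok !(restr_stable _ bS) uS (stable_mem _ bS) uS.
by rewrite (stable_mem _ bS) (stable_mem _ bS) uS !inE (stable_mem _ bS) uS !andbT.
Qed.

Lemma card_Invols_stable S :
  #|[set a in Invols [set: T] | a @: S == S]| <= invn #|S| * invn #|~: S|.
Proof.
rewrite -!card_Invols -cardsX.
rewrite -(@card_in_imset _ _ (fun a => (restr_perm S a, restr_perm (~: S) a))).
  apply: subset_leq_card; apply/subsetP=> _ /imsetP[a + ->].
  rewrite inE => /andP[/InvolsP[_ aK] /eqP aS].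
  by rewrite inE !restr_Invols // stable_setC.
move=> a a'; rewrite [a \in _]inE [a' \in _]inE.
move=> /andP[_ /eqP aS] /andP[_ /eqP a'S] [].
exact: restr_perm_inj2.
Qed.

Lemma card_Bst_stable S :
  #|[set p in Bst [set: T] | p.1 @: S == S]| <= bstn #|S| * bstn #|~: S|.
Proof.
rewrite -!card_Bst -cardsX.
pose f (p : {perm T} * {set T}) := ((restr_perm S p.1, p.2 :&: S),
  (restr_perm (~: S) p.1, p.2 :&: ~: S)).
rewrite -(@card_in_imset _ _ f).
  apply: subset_leq_card; apply/subsetP=> _ /imsetP[p + ->].
  rewrite inE => /andP[/BstP[_ ok] /eqP aS].
  by rewrite inE !restr_Bst // stable_setC.
move=> [b D] [b' D']; rewrite [_ \in _]inE [X in _ -> is_true X -> _]inE /=.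
move=> /andP[_ /eqP bS] /andP[_ /eqP b'S] [e1 e2 e3 e4]; congr (_, _).
  exact: restr_perm_inj2 e1 e3.
by rewrite -(setID D S) -(setID D' S) !setDE e2 e4.
Qed.

Definition transitive_pair a b :=
  [forall S : {set T}, [&& S != set0, a @: S == S & b @: S == S] ==> (S == setT)].

(** Union bound over the stable sets. Passing to the complement, which is stable too, brings the
    size down to at most half; a pair with a given stable set is determined by its restrictions to
    the two sides. *)
Lemma card_intransitive :
  #|[set x in setX (Invols [set: T]) (Bst [set: T]) | ~~ transitive_pair x.1 x.2.1]|
  <= \sum_(S : {set T} | (0 < #|S|) && (2 * #|S| <= #|T|))
       invn #|S| * invn #|~: S| * (bstn #|S| * bstn #|~: S|).
Proof.
pose A S := setX [set a in Invols [set: T] | a @: S == S]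
  [set p in Bst [set: T] | p.1 @: S == S].
apply: (@leq_trans (\sum_(S : {set T} | (0 < #|S|) && (2 * #|S| <= #|T|)) #|A S|)).
  under eq_bigr do rewrite -sum1_card big_mkcond /=.
  rewrite exchange_big -sum1_card big_mkcond /=; apply: leq_sum => -[a [b D]] _.
  case: ifPn => //; rewrite !inE /= => /andP[/andP[aI bI]].
  case/forallPn=> S; rewrite negb_imply => /andP[/and3P[S0 /eqP aS /eqP bS] ST].
  have [S1 S1P [a1 b1]] : exists2 S1 : {set T}, (0 < #|S1|) && (2 * #|S1| <= #|T|)
      & a @: S1 = S1 /\ b @: S1 = S1.
    have [S2|S2] := leqP (2 * #|S|) #|T|; first by exists S; rewrite // card_gt0 S0.
    exists (~: S); last by rewrite !stable_setC.
    have : 0 < #|~: S|.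
      by rewrite card_gt0; apply: contraNneq ST => e; rewrite -[S]setCK e setC0.
    by have := cardsC S; lia.
  by rewrite (bigD1 S1) //= !inE /= a1 b1 !eqxx !andbT aI bI.
apply: leq_sum => S _; rewrite cardsX.
by apply: leq_mul; [apply: card_Invols_stable|apply: card_Bst_stable].
Qed.

End Stable.

Lemma card_intransitive_ord n :
  #|[set x in setX (Invols [set: 'I_n]) (Bst [set: 'I_n]) |
      ~~ transitive_pair x.1 x.2.1]|
  <= \sum_(1 <= s < (n./2).+1)
       'C(n, s) * (invn s * invn (n - s) * (bstn s * bstn (n - s))).
Proof.
apply: leq_trans (card_intransitive _) _; rewrite card_ord.
rewrite (partition_big (fun S : {set 'I_n} => inord #|S| : 'I_n.+1)
  (fun i => (0 < i) && (i < (n./2).+1))) /=; last first.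
  move=> S /andP[S0 S2]; rewrite inordK; first by rewrite S0 /=; lia.
  by rewrite ltnS (leq_trans (max_card _)) ?card_ord.
rewrite big_geq_mkord /= (big_ord_widen_cond n.+1 (fun i => 0 < i) (fun s =>
  'C(n, s) * (invn s * invn (n - s) * (bstn s * bstn (n - s))))); last by lia.
apply: leq_sum => i /andP[i0 in2].
have -> : 'C(n, i) = #|[set S : {set 'I_n} | #|S| == i]|.
  by rewrite card_draws card_ord.
rewrite -sum_nat_const [leqRHS](eq_bigl (fun S : {set 'I_n} => #|S| == i)); last first.
  by move=> S; rewrite inE.
rewrite [leqRHS]big_mkcond [leqLHS]big_mkcond; apply: leq_sum => S _.
case: ifP => // /andP[_ /eqP e]; rewrite -e inordK; last first.
  by rewrite ltnS (leq_trans (max_card _)) ?card_ord.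
have -> : #|~: S| = n - #|S| by have := cardsC S; rewrite card_ord; lia.
by rewrite eqxx.
Qed.

End Intransitive.

(** * Growth of the counting sequences *)

Section Growth.
Local Open Scope ring_scope.
Variable R : realType.

(** Sixth roots turn all rates into integral powers: consecutive ratios are about [z ^+ 3] for
    involutions and [z ^+ 4] for b-structures, against [z ^+ 2] for the mean number of fixed
    points. *)
Definition root6 (i : nat) : R := i%:R `^ (6%:R)^-1.
Local Notation z := root6.

Lemma root6_pow6 i : z i ^+ 6 = i%:R.
Proof.
rewrite /z -powR_mulrn ?powR_ge0 // -powRrM mulVf ?pnatr_eq0 //.
by rewrite powRr1 ?ler0n.
Qed.

Lemma root6_ge0 i : 0 <= z i. Proof. exact: powR_ge0. Qed.

Lemma root6_gt0 i : (0 < i)%N -> 0 < z i.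
Proof. by move=> i0; rewrite /z powR_gt0 // ltr0n. Qed.

Lemma le_root6 i j : (i <= j)%N -> z i <= z j.
Proof. by move=> ij; rewrite -(@ler_pXn2r _ 6) ?nnegrE ?root6_ge0 // !root6_pow6 ler_nat. Qed.

Lemma root6_ge1 i : (0 < i)%N -> 1 <= z i.
Proof.
move=> i0; rewrite -(@ler_pXn2r _ 6) ?nnegrE ?root6_ge0 // root6_pow6 expr1n.
by rewrite ler1n.
Qed.

Lemma root6_large (A : R) : exists N : nat, forall i, (N <= i)%N -> A <= z i.
Proof.
exists (Num.bound (`|A| ^+ 6)) => i Ni.
apply: le_trans (ler_norm _) _; rewrite -(@ler_pXn2r _ 6) ?nnegrE ?root6_ge0 // root6_pow6.
apply: le_trans (ler_norm _) _; apply: ltW.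
apply: lt_le_trans (archi_boundP _) _; rewrite ?normr_ge0 //.
by rewrite ?normrX ?normr_id ?ler_nat // exprn_ge0.
Qed.

Lemma invn_pos n : 0 < (invn n)%:R :> R. Proof. by rewrite ltr0n invn_gt0. Qed.

Lemma bstn_gt0 n : (0 < bstn n)%N.
Proof. by elim/ltn_ind: n => -[|[|[|n]]] // IH; rewrite bstnSSS !addn_gt0 IH. Qed.

Lemma bstn_pos n : 0 < (bstn n)%:R :> R. Proof. by rewrite ltr0n bstn_gt0. Qed.

(** The bounds are proved together: the recurrence turns a ratio $\rho$ into $1+(n+1)/\rho$, a
    decreasing function of $\rho$, so that each bound yields the other one at the next index. *)
Lemma invn_ratio n : z n.+1 ^+ 3 * (invn n)%:R <= (invn n.+1)%:R :> R /\
  (invn n.+1)%:R <= (z n.+1 ^+ 3 + 1) * (invn n)%:R :> R.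
Proof.
elim: n => [|n [IH1 IH2]].
  have -> : z 1 = 1 by rewrite /z powR1.
  by rewrite /= !expr1n mul1r mulr1; split=> //; lra.
rewrite invnSS natrD natrM.
have e1 : (z n.+1 ^+ 3) ^+ 2 = n.+1%:R by rewrite -exprM root6_pow6.
have e2 : (z n.+2 ^+ 3) ^+ 2 = n.+1%:R + 1 by rewrite -exprM root6_pow6 -natr1.
have le : z n.+1 ^+ 3 <= z n.+2 ^+ 3 by rewrite lerXn2r ?nnegrE ?root6_ge0 ?le_root6.
move: IH1 IH2 e1 e2 le (invn_pos n) (invn_pos n.+1).
have := exprn_ge0 3 (root6_ge0 n.+1).
have := exprn_gt0 3 (root6_gt0 (isT : (0 < n.+1)%N)).
move: (z n.+1 ^+ 3) (z n.+2 ^+ 3) (n.+1%:R : R) => u v m u0 _.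
move: ((invn n)%:R : R) ((invn n.+1)%:R : R) => a b ub bu um vm uv a0 b0.
split; last by rewrite -um; nra.
(* Here $u=\sqrt{n+1}$ and $v=\sqrt{n+2}$; the bound $\rho\le u+1$ gives a next ratio of at least
   $1+u^2/(u+1)=u+1/(u+1)$. *)
have v0 : v <= u + (u + 1)^-1.
  have i0 : 0 < (u + 1)^-1 by rewrite invr_gt0; lra.
  have ie : (u + 1)^-1 * (u + 1) = 1 by rewrite mulVf //; lra.
  rewrite -(@ler_pXn2r _ 2) ?nnegrE //; try lra.
  rewrite vm -um; move: i0 ie; move: (u + 1)^-1 => i i0 ie.
  have ui : u * i = 1 - i by rewrite -ie; ring.
  have -> : (u + i) ^+ 2 = u ^+ 2 + 2 * (u * i) + i ^+ 2 by ring.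
  by have := sqr_ge0 (1 - i); rewrite ui; lra.
apply: le_trans (ler_wpM2r (ltW b0) v0) _.
have bia : b * (u + 1)^-1 <= a by rewrite ler_pdivrMr; [lra|lra].
have ie : (u + 1)^-1 * (u + 1) = 1 by rewrite mulVf //; lra.
have u2 : 0 <= u ^+ 2 by rewrite sqr_ge0.
have := ler_wpM2l u2 bia; rewrite -um; move: ie; move: (u + 1)^-1 => i ie.
have -> : u ^+ 2 * (b * i) = b * ((u - 1) * (i * (u + 1)) + i) by ring.
by rewrite ie; lra.
Qed.


Arguments bstn : simpl never.

(* The mean number of fixed points of a b-structure on [n] points. *)
Definition loopmean (n : nat) : R := n%:R * (bstn n.-1)%:R / (bstn n)%:R.

Lemma loopmean_ge0 n : 0 <= loopmean n.
Proof. by rewrite /loopmean !mulr_ge0 ?invr_ge0 ?ler0n. Qed.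

(* Cauchy-Schwarz for the number of fixed points. *)
Lemma loopmeanS n : loopmean n.+1 <= loopmean n + 1.
Proof.
rewrite /loopmean /= -[X in _ + X](@divff _ (bstn n)%:R) ?gt_eqF ?bstn_pos //.
rewrite -mulrDl ler_pdivrMr ?bstn_pos // mulrAC ler_pdivlMr ?bstn_pos //.
rewrite -!natrM -natrD -!natrM ler_nat -(leq_pmul2l (ltn0Sn n)).
by have := bstn_CS n; rewrite -mulnn; lia.
Qed.

(** With $J$ for [bstn] and $m=n+3$, the product telescopes to $m(m-1)(m-2)J_{m-3}/J_m$, and
    $(m-1)(m-2)J_{m-3}$ is the 3-cycle term in the recurrence for $J_m$. *)
Lemma loopmean3 n : loopmean n.+3 * loopmean n.+2 * loopmean n.+1 <= n.+3%:R.
Proof.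
have := bstn_pos n.+1; have := bstn_pos n.+2; have := bstn_pos n.+3.
have : (n.+2 * n.+1 * bstn n)%:R <= (bstn n.+3)%:R :> R.
  by rewrite ler_nat bstnSSS leq_addl.
rewrite /loopmean !natrM /=.
move: ((bstn n.+1)%:R : R) ((bstn n.+2)%:R : R) ((bstn n.+3)%:R : R) => a b c.
move: ((bstn n)%:R : R) => d le c0 b0 a0.
have -> : n.+3%:R * b / c * (n.+2%:R * a / b) * (n.+1%:R * d / a) =
   n.+3%:R * ((n.+2%:R * n.+1%:R * d) / c) by field; rewrite !gt_eqF.
by rewrite ler_piMr ?ler0n // ler_pdivrMr // mul1r.
Qed.

(** Let $c=n^{1/3}$. Were this mean above $c+2$, the two preceding ones would be above $c+1$ and
    $c$, since means grow by at most 1 per step, and the product of the three would exceed $n$. *)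
Lemma loopmean_le n : (0 < n)%N -> loopmean n <= z n ^+ 2 + 2.
Proof.
case: n => // -[|[|n]] _.
- by rewrite /loopmean /= /bstn mul1r divr1; have := sqr_ge0 (z 1); lra.
- by rewrite /loopmean /= /bstn; have := sqr_ge0 (z 2); lra.
have e : (z n.+3 ^+ 2) ^+ 3 = n.+3%:R by rewrite -exprM root6_pow6.
have := loopmean3 n; have := loopmeanS n.+2; have := loopmeanS n.+1; rewrite -e.
move: (exprn_gt0 2 (root6_gt0 (isT : (0 < n.+3)%N))).
move: (z n.+3 ^+ 2) (loopmean n.+3) (loopmean n.+2) (loopmean n.+1).
move=> c g3 g2 g1 c0 h1 h2; apply: contraTT; rewrite -!ltNge => lt.
have g1c : c < g1 by lra.
have g2c : c < g2 by lra.
have g3c : c < g3 by lra.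
have -> : c ^+ 3 = c * c * c by ring.
by rewrite !ltr_pM ?mulr_ge0 // ltW.
Qed.

Lemma bstn_ratio n : (0 < n)%N ->
  n%:R * (bstn n.-1)%:R <= (z n ^+ 2 + 2) * (bstn n)%:R :> R.
Proof. by move=> n0; rewrite -ler_pdivrMr ?bstn_pos // loopmean_le. Qed.

(** The mean size of [D] is a product of two consecutive mean numbers of fixed points, each at most
    $3n^{1/3}$. *)
Lemma mean_ends n :
  (n * (n - 1) * bstn (n - 2))%:R <= 9 * z n ^+ 4 * (bstn n)%:R :> R.
Proof.
case: n => [|[|m]]; rewrite ?mul0n ?muln0 ?mulr_ge0 ?exprn_ge0 ?root6_ge0 //.
rewrite !subSS !subn0 -ler_pdivrMr ?bstn_pos //.
have -> : (m.+2 * m.+1 * bstn m)%:R / (bstn m.+2)%:R =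
    loopmean m.+2 * loopmean m.+1.
  by rewrite /loopmean /= !natrM; field; rewrite !gt_eqF ?bstn_pos.
have z1 : 1 <= z m.+2 ^+ 2 by rewrite exprn_ege1 // root6_ge1.
have b1 := loopmean_le (isT : (0 < m.+2)%N).
have b2 := loopmean_le (isT : (0 < m.+1)%N).
have b3 : z m.+1 ^+ 2 <= z m.+2 ^+ 2 by rewrite lerXn2r ?nnegrE ?root6_ge0 ?le_root6.
have -> : 9 * z m.+2 ^+ 4 = (3 * z m.+2 ^+ 2) * (3 * z m.+2 ^+ 2) by ring.
by apply: ler_pM; rewrite ?loopmean_ge0 //; lra.
Qed.

Fixpoint root6_fact (n : nat) : R := if n is m.+1 then root6_fact m * z n else 1.

Lemma root6_factS n : root6_fact n.+1 = root6_fact n * z n.+1. Proof. by []. Qed.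

Lemma root6_fact_pow6 n : root6_fact n ^+ 6 = (n`!)%:R.
Proof.
by elim: n => [|n IH]; rewrite ?expr1n //= exprMn IH root6_pow6 factS natrM mulrC.
Qed.

Lemma root6_fact_ge1 n : 1 <= root6_fact n.
Proof. by elim: n => //= n IH; rewrite mulr_ege1 // root6_ge1. Qed.

Lemma root6_fact_gt0 n : 0 < root6_fact n.
Proof. exact: lt_le_trans (root6_fact_ge1 n). Qed.

(** The initial values are absorbed into the constant, so an induction step valid from [N] on is
    enough. It has to hold for every [C], because the constant is chosen after [N]. *)
Lemma geometric_bound (lam : R) (u : nat -> nat) (k N : nat) : 1 < lam ->
  (forall C s, 0 <= C -> (N <= s)%N ->
    (forall j, (j < s)%N -> (u j)%:R <= C * lam ^+ j * root6_fact j ^+ k) ->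
    (u s)%:R <= C * lam ^+ s * root6_fact s ^+ k) ->
  exists2 C : R, 0 < C & forall s, (u s)%:R <= C * lam ^+ s * root6_fact s ^+ k.
Proof.
move=> lam1 step; pose C : R := 1 + \sum_(j < N) (u j)%:R.
have C0 : 0 < C by rewrite ltr_pwDl // sumr_ge0.
exists C => // s; elim/ltn_ind: s => s IH.
have [Ns|sN] := leqP N s; first by apply: step => //; apply: ltW.
have le : (u s)%:R <= C.
  rewrite /C (bigD1 (Ordinal sN)) //= addrCA ler_wpDr //.
  by rewrite addr_ge0 // sumr_ge0.
apply: le_trans le _; rewrite -mulrA ler_peMr ?(ltW C0) //.
by rewrite mulr_ege1 // exprn_ege1 ?root6_fact_ge1 // ltW.
Qed.

Lemma invn_growth (lam : R) : 1 < lam ->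
  exists2 C : R, 0 < C & forall s, (invn s)%:R <= C * lam ^+ s * root6_fact s ^+ 3.
Proof.
move=> lam1; have l2 : 0 < lam ^+ 2 - 1 by nra.
(* Beyond this threshold [lam] is at most [(lam ^+ 2 - 1) * z m.+2], so that the one-point term fits
   into the gap between $u^3$ and $\lambda^2v^3$. *)
have [N HN] := root6_large (lam / (lam ^+ 2 - 1)).
apply: (@geometric_bound _ _ _ N.+2) => // C [|[|m]] // C0 Nm IH.
rewrite invnSS natrD natrM -(root6_pow6 m.+1).
apply: le_trans (lerD (IH _ (ltnSn _)) (ler_wpM2l _ (IH _ (leqW (ltnSn _))))) _.
  by rewrite exprn_ge0 ?root6_ge0.
have /HN : (N <= m.+2)%N by lia.
rewrite ler_pdivrMr // !root6_factS => zl.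
have z1 := root6_ge1 (isT : (0 < m.+1)%N); have z2 := root6_ge1 (isT : (0 < m.+2)%N).
have z12 := le_root6 (leqnSn m.+1).
move: zl z1 z2 z12; move: (z m.+1) (z m.+2) => u v zl u1 v1 uv.
set A := C * lam ^+ m * root6_fact m ^+ 3.
have A0 : 0 <= A.
  by rewrite !mulr_ge0 ?exprn_ge0 ?(ltW (root6_fact_gt0 _)) // ltW // (lt_trans ltr01).
have -> : C * lam ^+ m.+1 * (root6_fact m * u) ^+ 3 +
   u ^+ 6 * (C * lam ^+ m * root6_fact m ^+ 3) = A * u ^+ 3 * (lam + u ^+ 3).
  by rewrite /A exprS; ring.
have -> : C * lam ^+ m.+2 * (root6_fact m * u * v) ^+ 3 =
   A * u ^+ 3 * (lam ^+ 2 * v ^+ 3) by rewrite /A !exprS; ring.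
have u30 : 0 <= u ^+ 3 by rewrite exprn_ge0 // (le_trans ler01).
apply: ler_wpM2l; first by rewrite mulr_ge0.
have uv3 : u ^+ 3 <= v ^+ 3 by rewrite lerXn2r ?nnegrE // (le_trans ler01).
have v3 : v <= v ^+ 3 by rewrite exprS ler_peMr ?exprn_ege1 // (le_trans ler01).
have := ler_wpM2r (ltW l2) v3; lra.
Qed.

Lemma bstn_growth (lam : R) : 1 < lam ->
  exists2 C : R, 0 < C & forall s, (bstn s)%:R <= C * lam ^+ s * root6_fact s ^+ 4.
Proof.
move=> lam1; have l2 : 0 < lam ^+ 3 - 1 by rewrite subr_gt0 exprn_egt1.
have [N HN] := root6_large ((lam ^+ 2 + 2 * lam) / (lam ^+ 3 - 1)).
apply: (@geometric_bound _ _ _ N.+3) => // C [|[|[|m]]] // C0 Nm IH.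
have -> : (bstn m.+3)%:R = (bstn m.+2)%:R + 2 * z m.+2 ^+ 6 * (bstn m.+1)%:R +
    z m.+2 ^+ 6 * z m.+1 ^+ 6 * (bstn m)%:R :> R by rewrite !root6_pow6 bstnSSS; ring.
have i1 := IH m.+2 (ltnSn _).
have i2 := IH m.+1 (leqW (ltnSn _)).
have i3 := IH m (leqW (leqW (ltnSn _))).
have /HN : (N <= m.+3)%N by lia.
rewrite ler_pdivrMr // !root6_factS in i1 i2 i3 * => zl.
have u1 := root6_ge1 (isT : (0 < m.+1)%N); have v1 := root6_ge1 (isT : (0 < m.+2)%N).
have w1 := root6_ge1 (isT : (0 < m.+3)%N).
have uv := le_root6 (leqnSn m.+1); have vw := le_root6 (leqnSn m.+2).
move: zl u1 v1 w1 uv vw i1 i2 i3.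
move: (z m.+1) (z m.+2) (z m.+3) => u v w zl u1 v1 w1 uv vw i1 i2 i3.
set A := C * lam ^+ m * root6_fact m ^+ 4 in i3.
have A0 : 0 <= A.
  by rewrite !mulr_ge0 ?exprn_ge0 ?(ltW (root6_fact_gt0 _)) // ltW // (lt_trans ltr01).
have u0 : 0 <= u by lra. have v0 : 0 <= v by lra. have w0 : 0 <= w by lra.
have l0 : 0 <= lam by lra.
have k2 : 0 <= 2 * v ^+ 6 :> R by rewrite mulr_ge0 ?exprn_ge0.
have k3 : 0 <= v ^+ 6 * u ^+ 6 by rewrite mulr_ge0 ?exprn_ge0.
apply: le_trans (lerD (lerD i1 (ler_wpM2l k2 i2)) (ler_wpM2l k3 i3)) _.
have -> : C * lam ^+ m.+2 * (root6_fact m * u * v) ^+ 4 +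
   2 * v ^+ 6 * (C * lam ^+ m.+1 * (root6_fact m * u) ^+ 4) + v ^+ 6 * u ^+ 6 * A
   = A * (u ^+ 4 * v ^+ 4) * (lam ^+ 2 + 2 * lam * v ^+ 2 + v ^+ 2 * u ^+ 2).
  by rewrite /A !exprS; ring.
have -> : C * lam ^+ m.+3 * (root6_fact m * u * v * w) ^+ 4 =
   A * (u ^+ 4 * v ^+ 4) * (lam ^+ 3 * w ^+ 4) by rewrite /A !exprS; ring.
apply: ler_wpM2l; first by rewrite mulr_ge0 // mulr_ge0 // exprn_ge0.
have vw2 : v ^+ 2 <= w ^+ 2 by rewrite lerXn2r.
have uw2 : u ^+ 2 <= w ^+ 2 by rewrite lerXn2r // (le_trans uv).
have w12 : 1 <= w ^+ 2 by rewrite exprn_ege1.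
have w24 : w <= w ^+ 2 by rewrite expr2 ler_peMr.
have -> : w ^+ 4 = w ^+ 2 * w ^+ 2 by ring.
have : v ^+ 2 * u ^+ 2 <= w ^+ 2 * w ^+ 2 by rewrite ler_pM ?exprn_ge0.
have : 2 * lam * v ^+ 2 <= 2 * lam * w ^+ 2 by rewrite ler_wpM2l // mulr_ge0.
have : lam ^+ 2 <= lam ^+ 2 * w ^+ 2 by rewrite ler_peMr ?exprn_ge0.
have : lam ^+ 2 + 2 * lam <= w ^+ 2 * (lam ^+ 3 - 1).
  by apply: le_trans zl _; rewrite ler_wpM2r // ltW.
move=> h1; have := ler_wpM2r (le_trans ler01 w12) h1.
move: (w ^+ 2) (v ^+ 2) (u ^+ 2) (lam ^+ 2) (lam ^+ 3) => a b c d e; nra.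
Qed.

End Growth.

(** * Rarity of intransitive pairs *)

Section Connectivity.
Local Open Scope ring_scope.
Variable R : realType.
Local Notation z := (root6 R).
Local Notation root6_fact := (root6_fact R).

(** The ratio for involutions is at least $z^3$; the one for b-structures is at least $z^6/(z^2+2)$,
    hence at least $z^4/\lambda$ for large $z$. *)
Lemma pairs_step (lam : R) : 1 < lam -> exists N, forall i, (N <= i)%N ->
  z i.+1 ^+ 7 * ((invn i)%:R * (bstn i)%:R) <=
  lam * ((invn i.+1)%:R * (bstn i.+1)%:R).
Proof.
move=> lam1; have l0 : 0 < lam - 1 by lra.
have [N HN] := root6_large (2 / (lam - 1)); exists N => i Ni.
have [Iz _] := invn_ratio R i; have /= Jz := bstn_ratio R (ltn0Sn i).
have := HN _ (leqW Ni); rewrite ler_pdivrMr // => zl.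
have z1 := root6_ge1 R (ltn0Sn i).
move: Jz; rewrite -(root6_pow6 R i.+1) => Jz.
have a0 := invn_pos R i; have a1 := invn_pos R i.+1.
have b0 := bstn_pos R i; have b1 := bstn_pos R i.+1.
move: Iz Jz zl z1 a0 a1 b0 b1.
move: (z i.+1) ((invn i)%:R : R) ((invn i.+1)%:R : R).
move: ((bstn i)%:R : R) ((bstn i.+1)%:R : R) => b b' w a a' Iz Jz zl z1 a0 a1 b0 b1.
have w0 : 0 < w by lra.
have w2 : 0 < w ^+ 2 by rewrite exprn_gt0.
have Jz2 : w ^+ 4 * b <= lam * b'.
  rewrite -(ler_pM2l w2).
  have -> : w ^+ 2 * (w ^+ 4 * b) = w ^+ 6 * b by ring.
  apply: le_trans Jz _; rewrite mulrA ler_wpM2r ?(ltW b1) //.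
  have : w * (lam - 1) <= w ^+ 2 * (lam - 1).
    by rewrite ler_wpM2r ?(ltW l0) // expr2 ler_peMr // ltW.
  lra.
have -> : w ^+ 7 * (a * b) = (w ^+ 3 * a) * (w ^+ 4 * b) by ring.
have -> : lam * (a' * b') = a' * (lam * b') by ring.
by apply: ler_pM => //; rewrite mulr_ge0 ?exprn_ge0 // ltW.
Qed.

Lemma pairs_ratio (lam : R) : 1 < lam -> exists N, forall m s, (N <= m)%N ->
  root6_fact (m + s) ^+ 7 * ((invn m)%:R * (bstn m)%:R) <=
  lam ^+ s * root6_fact m ^+ 7 * ((invn (m + s))%:R * (bstn (m + s))%:R).
Proof.
move=> lam1; have [N HN] := pairs_step lam1; exists N => m s Nm.
elim: s => [|s IH]; first by rewrite addn0 mul1r.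
rewrite addnS root6_factS.
have := HN (m + s)%N (leq_trans Nm (leq_addr _ _)).
have z0 := root6_gt0 R (ltn0Sn (m + s)).
have c0 : 0 <= lam ^+ s * root6_fact m ^+ 7.
  by rewrite mulr_ge0 ?exprn_ge0 ?(ltW (root6_fact_gt0 _ _)) //; lra.
move: IH; move: (root6_fact (m + s)) (z (m + s).+1) z0 => a b b0.
move: (_ * (bstn m)%:R : R) (_ * (bstn (m + s))%:R : R) => x x' IH.
move: (_ * (bstn _)%:R : R) => x'' h.
have -> : (a * b) ^+ 7 * x = b ^+ 7 * (a ^+ 7 * x) by ring.
apply: le_trans (ler_wpM2l _ IH) _; first by rewrite exprn_ge0 // ltW.
have -> : b ^+ 7 * (lam ^+ s * root6_fact m ^+ 7 * x') =
  lam ^+ s * root6_fact m ^+ 7 * (b ^+ 7 * x') by ring.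
have -> : lam ^+ s.+1 * root6_fact m ^+ 7 * x'' =
  lam ^+ s * root6_fact m ^+ 7 * (lam * x'') by rewrite exprS; ring.
exact: ler_wpM2l.
Qed.

Lemma bin_ge_exp2 n s : (2 * s <= n)%N -> (2 ^ s <= 'C(n, s))%N.
Proof.
elim: s n => [|s IH] n sn; first by rewrite bin0.
case: n sn => [|n] // sn; rewrite -(leq_pmul2l (ltn0Sn s)) -mul_bin_diag.
rewrite expnS mulnA leq_mul //; first by lia.
by apply: IH; lia.
Qed.

Lemma bin_ge_n n s : (0 < s < n)%N -> (n <= 'C(n, s))%N.
Proof.
elim: n s => // n IH [|s] // /andP[_ sn]; rewrite binS.
have [e|ne] := eqVneq s.+1 n.
  by rewrite -e binn binSn add1n.
have := IH s.+1; have : (0 < 'C(n, s))%N by rewrite bin_gt0; lia.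
have -> : (0 < s.+1 < n)%N by lia.
by move=> h1 /(_ isT); lia.
Qed.

(** The twelfth power is $\binom ns^{-2}$. One factor provides $2^{-s}$, which makes the terms
    summable, and the other $1/n$, which makes their sum vanish. *)
Lemma root6_fact_ratio n s : (0 < s)%N -> (2 * s <= n)%N ->
  (root6_fact s * root6_fact (n - s) / root6_fact n) ^+ 12 * (n%:R * 2 ^+ s) <= 1.
Proof.
move=> s0 sn; have sln : (s <= n)%N by lia.
have e : (root6_fact s * root6_fact (n - s) / root6_fact n) ^+ 6 = ('C(n, s)%:R)^-1.
  rewrite !exprMn exprVn !root6_fact_pow6 -(bin_fact sln) !natrM.
  by field; rewrite !pnatr_eq0 -!lt0n !fact_gt0 bin_gt0 sln.
have c0 : 0 < 'C(n, s)%:R :> R by rewrite ltr0n bin_gt0.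
rewrite (exprM _ 6 2) e exprVn mulrC ler_pdivrMr ?exprn_gt0 // mul1r expr2.
rewrite -natrX -!natrM ler_nat leq_mul ?bin_ge_exp2 //.
by apply: bin_ge_n; lia.
Qed.

Lemma sum_geom_le (q : R) m : 0 <= q < 1 ->
  \sum_(1 <= s < m) q ^+ s <= (1 - q)^-1.
Proof.
move=> /andP[q0 q1]; have d0 : 0 < 1 - q by lra.
rewrite -[leRHS]mul1r ler_pdivlMr //.
suff : (\sum_(1 <= s < m) q ^+ s) * (1 - q) <= 1 - q ^+ m.
  by have := exprn_ge0 m q0; lra.
elim: m => [|m IH]; first by rewrite big_geq // mul0r expr0 subrr.
case: m IH => [|m] IH; first by rewrite big_geq // mul0r expr1; lra.
rewrite big_nat_recr //= mulrDl [_ ^+ m.+2]exprSr.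
by move: IH; move: (\sum_(_ <= _ < _) _) (q ^+ m.+1) => a b; lra.
Qed.

(** In twelfth powers, the loss $\lambda^{36s}=(3/2)^s$ against the gain $2^{-s}$ leaves
    $(3/4)^s=q^{12s}$. The exponent [3 * s] collects one $\lambda^s$ from each of the two growth
    bounds and one from the ratio of the numbers of pairs. *)
Lemma root12_bound (lam q Q y N : R) (s : nat) :
  0 <= lam -> lam ^+ 36 = 3 / 2 -> 0 <= q -> q ^+ 12 = 3 / 4 ->
  0 < Q -> 0 < y -> y ^+ 12 = N -> Q ^+ 12 * (N * 2 ^+ s) <= 1 ->
  lam ^+ (3 * s) * Q <= q ^+ s / y.
Proof.
move=> lam0 lamE q0 qE Q0 y0 yE le; rewrite ler_pdivlMr //.
have l0 : 0 <= lam ^+ (3 * s) * Q * y.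
  by rewrite mulr_ge0 ?(ltW y0) // mulr_ge0 ?(ltW Q0) // exprn_ge0.
have r0 : 0 <= q ^+ s by rewrite exprn_ge0.
rewrite -(@ler_pXn2r _ 12) // exprMn exprMn -!exprM.
have -> : (3 * s * 12 = 36 * s)%N by lia.
rewrite [(s * 12)%N]mulnC !exprM lamE qE yE.
have -> : (3 / 4) ^+ s = (3 / 2) ^+ s * (2 ^+ s)^-1 :> R.
  by rewrite -exprVn -exprMn; congr (_ ^+ _); field.
have h0 : 0 < (3 / 2) ^+ s :> R by rewrite exprn_gt0 //; lra.
rewrite -mulrA ler_pM2l // -[leRHS]mul1r ler_pdivlMr ?exprn_gt0 //.
by rewrite -mulrA.
Qed.

(** Used with [a], [b], [c] the values of [root6_fact] at $s$, $n-s$, $n$. Numbers of pairs grow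
    like seventh powers of [root6_fact], the binomial coefficient is a quotient of sixth powers, and
    one factor [a * b / c], that is $\binom ns^{-1/6}$, survives. *)
Lemma split_term_bound (a b c C L1 L2 x y P : R) :
  0 < a -> 0 < b -> 0 < c -> 0 <= x -> 0 <= y ->
  x <= C * L2 * a ^+ 7 -> c ^+ 7 * y <= L1 * b ^+ 7 * P ->
  c ^+ 6 / (a ^+ 6 * b ^+ 6) * (x * y) <= C * P * (L2 * L1 * (a * b / c)).
Proof.
move=> a0 b0 c0 x0 y0 hx hy.
have c7 : 0 < c ^+ 7 by rewrite exprn_gt0.
have {}hy : y <= (c ^+ 7)^-1 * (L1 * b ^+ 7 * P) by rewrite ler_pdivlMl.
have k0 : 0 <= c ^+ 6 / (a ^+ 6 * b ^+ 6).
  by rewrite divr_ge0 ?mulr_ge0 ?exprn_ge0 ?(ltW a0) ?(ltW b0) ?(ltW c0).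
apply: le_trans (ler_wpM2l k0 (ler_pM x0 y0 hx hy)) _.
rewrite le_eqVlt; apply/orP; left; apply/eqP; field.
by rewrite !gt_eqF.
Qed.

Lemma natr_bin_root6 n s : (s <= n)%N ->
  'C(n, s)%:R = root6_fact n ^+ 6 / (root6_fact s ^+ 6 * root6_fact (n - s) ^+ 6).
Proof.
by move=> sn; rewrite !root6_fact_pow6 -(bin_fact sn) !natrM mulfK.
Qed.

Lemma intransitive_small : exists N, forall n, (N <= n)%N ->
  2 * (\sum_(1 <= s < (n./2).+1)
    'C(n, s) * (invn s * invn (n - s) * (bstn s * bstn (n - s))))%:R
  <= (invn n)%:R * (bstn n)%:R :> R.
Proof.
pose lam : R := (3 / 2) `^ (36%:R)^-1.
have lamE : lam ^+ 36 = 3 / 2.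
  rewrite /lam -powR_mulrn ?powR_ge0 // -powRrM mulVf ?pnatr_eq0 //.
  by rewrite powRr1 //; lra.
have lam0 : 0 <= lam by exact: powR_ge0.
have lam1 : 1 < lam.
  by rewrite -(@ltr_pXn2r _ 36) ?nnegrE // lamE expr1n; lra.
pose q : R := (3 / 4) `^ (12%:R)^-1.
have qE : q ^+ 12 = 3 / 4.
  rewrite /q -powR_mulrn ?powR_ge0 // -powRrM mulVf ?pnatr_eq0 //.
  by rewrite powRr1 //; lra.
have q0 : 0 <= q by exact: powR_ge0.
have q1 : q < 1.
  by rewrite -(@ltr_pXn2r _ 12) ?nnegrE // qE expr1n; lra.
have d0 : 0 < 1 - q by lra.
have [C1 C10 H1] := invn_growth lam1.
have [C2 C20 H2] := bstn_growth lam1.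
have [N1 HN1] := pairs_ratio lam1.
pose B := 2 * (C1 * C2 * (1 - q)^-1).
have B0 : 0 <= B by rewrite !mulr_ge0 ?invr_ge0 // ltW.
have [N2 HN2] := root6_large (B ^+ 2).
exists (N2 + 2 * N1).+1 => n Nn.
(* [y] is $n^{1/12}$, the gain left in front of the geometric series; the series and all constants
   are collected in [B], so that [B <= y] is the goal. *)
pose y := Num.sqrt (z n).
have y2 : y ^+ 2 = z n by rewrite sqr_sqrtr ?root6_ge0.
have yB : B <= y.
  rewrite -(@ler_pXn2r _ 2) ?nnegrE ?sqrtr_ge0 // y2; apply: HN2; clear -Nn; lia.
have y0 : 0 < y by rewrite sqrtr_gt0 root6_gt0 //; clear -Nn; lia.
have P0 : 0 <= (invn n)%:R * (bstn n)%:R :> R by rewrite mulr_ge0.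
rewrite natr_sum.
apply: (@le_trans _ _ (2 * \sum_(1 <= s < (n./2).+1)
    (C1 * C2 / y * ((invn n)%:R * (bstn n)%:R)) * q ^+ s)); last first.
  rewrite -mulr_sumr.
  apply: (@le_trans _ _ (B / y * ((invn n)%:R * (bstn n)%:R))).
    have := sum_geom_le (n./2).+1 (introT andP (conj q0 q1)).
    set S := \sum_(_ <= _ < _) _ => hS.
    have -> : B / y * ((invn n)%:R * (bstn n)%:R) =
      2 * (C1 * C2 / y * ((invn n)%:R * (bstn n)%:R) * (1 - q)^-1).
      by rewrite /B; ring.
    rewrite ler_pM2l // ler_wpM2l // !mulr_ge0 ?invr_ge0 //; exact: ltW.
  by rewrite ler_piMl // ler_pdivrMr // mul1r.
rewrite ler_pM2l // [leLHS]big_nat_cond [leRHS]big_nat_cond.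
apply: ler_sum => s /andP[/andP[s0 sn] _].
have s2n : (2 * s <= n)%N by clear -sn; lia.
have sln : (s <= n)%N by clear -s2n; lia.
have Nns : (N1 <= n - s)%N by clear -Nn s2n; lia.
have := HN1 (n - s)%N s Nns; rewrite subnK // => rat.
have zn := root6_fact_gt0 R n; have zs := root6_fact_gt0 R s; have zns := root6_fact_gt0 R (n - s).
pose Q := root6_fact s * root6_fact (n - s) / root6_fact n.
have Q0 : 0 < Q by rewrite /Q divr_gt0 // mulr_gt0.
have Qy : lam ^+ (3 * s) * Q <= q ^+ s / y.
  apply: (root12_bound (N := n%:R)) => //; last exact: root6_fact_ratio.
  by rewrite (exprM y 2 6) y2 root6_pow6.
have hs : (invn s)%:R * (bstn s)%:R <= C1 * C2 * lam ^+ (2 * s) * root6_fact s ^+ 7.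
  have -> : C1 * C2 * lam ^+ (2 * s) * root6_fact s ^+ 7 =
    (C1 * lam ^+ s * root6_fact s ^+ 3) * (C2 * lam ^+ s * root6_fact s ^+ 4).
    by rewrite mul2n -addnn exprD; ring.
  by apply: ler_pM; rewrite ?ler0n.
have := split_term_bound zs zns zn _ _ hs rat.
rewrite !mulr_ge0 ?ler0n // => /(_ isT isT) le.
rewrite !natrM (natr_bin_root6 sln).
rewrite [X in _ * X <= _]mulrACA.
have e3 : (2 * s + s = 3 * s)%N by rewrite [RHS]mulSnr.
apply: le_trans le _; rewrite -exprD e3.
have -> : C1 * C2 / y * ((invn n)%:R * (bstn n)%:R) * q ^+ s =
  (C1 * C2 * ((invn n)%:R * (bstn n)%:R)) * (q ^+ s / y).
  by rewrite [RHS]mulrA [RHS]mulrAC [X in X * _ = _]mulrAC.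
by apply: ler_wpM2l => //; rewrite !mulr_ge0 // ltW.
Qed.

End Connectivity.

Section Transitive.
Import mathcomp.boot.fintype mathcomp.boot.finset mathcomp.fingroup.fingroup mathcomp.fingroup.perm.
Variable R : realType.

Lemma card_transitive : exists N, forall n, (N <= n)%N ->
  invn n * bstn n <= 2 * #|[set x in setX (Invols [set: 'I_n]) (Bst [set: 'I_n]) |
      transitive_pair x.1 x.2.1]|.
Proof.
have [N HN] := intransitive_small R; exists N => n /HN.
rewrite -!natrM ler_nat => le.
have := card_intransitive_ord n.
set A := setX _ _.
have cA : #|A| = (invn n * bstn n)%N.
  by rewrite cardsX card_Invols card_Bst cardsT card_ord.
have := cardsID [set x | transitive_pair x.1 x.2.1] A.
rewrite cA => cE h.
have e1 : #|[set x in A | transitive_pair x.1 x.2.1]| =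
    #|A :&: [set x | transitive_pair x.1 x.2.1]|.
  by apply: eq_card => x; rewrite !inE.
have e2 : #|[set x in A | ~~ transitive_pair x.1 x.2.1]| =
    #|A :\: [set x | transitive_pair x.1 x.2.1]|.
  by apply: eq_card => x; rewrite !inE andbC.
rewrite e1; rewrite e2 in h; rewrite -cE in le *; move: le h; clear.
by move: #|_| #|_| (\sum_(_ <= _ < _) _) => a b c; lia.
Qed.

End Transitive.

(** * Decay of the peeling bound *)

Section PeelBound.
Local Open Scope ring_scope.
Variable R : realType.
Local Notation z := (root6 R).

(** Majorant of the proportion [peeln K n] over [invn n]; it decays like $(K/n)^b$. *)
Definition peelr (b : R) (K n : nat) : R :=
  \prod_(K.+1 <= i < n.+1) (1 - b / i%:R).

Lemma peelr_small b K n : (n <= K)%N -> peelr b K n = 1.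
Proof. by move=> nK; rewrite /peelr big_geq. Qed.

Lemma peelrS b K n : (K <= n)%N ->
  peelr b K n.+1 = peelr b K n * (1 - b / n.+1%:R).
Proof. by move=> Kn; rewrite /peelr big_nat_recr. Qed.

Lemma peelr_factor_gt0 (b : R) n : 0 < b < 1 -> 0 < 1 - b / n.+1%:R.
Proof.
move=> /andP[b0 b1]; rewrite subr_gt0 ltr_pdivrMr ?ltr0Sn // mul1r.
by apply: lt_le_trans b1 _; rewrite ler1n.
Qed.

Lemma peelr_gt0 b K n : 0 < b < 1 -> 0 < peelr b K n.
Proof.
by move=> b01; rewrite /peelr big_nat_cond prodr_gt0 // => -[|i] // _;
  apply: peelr_factor_gt0.
Qed.

(** Peeling keeps [m] of the [m.+1] two-point choices and loses nothing on the one-point choice. The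
    former dominate, since consecutive ratios of [invn] tend to infinity, so that a loss of about
    $1/m$ is spread over two points; [b < 1 / 2] leaves room for the remainder. *)
Lemma peeln_bound (b : R) : 0 < b < 1 / 2 -> exists m0 : nat, forall K n,
  (m0 <= K)%N -> (peeln K n)%:R <= peelr b K n * (invn n)%:R.
Proof.
move=> /andP[b0 b2]; have b01 : 0 < b < 1 by apply/andP; split; lra.
have d0 : 0 < 1 - 2 * b by lra.
(* Consecutive ratios of [invn] are at least [z]; from this threshold on, the one-point term,
   multiplied by [b], is at most [1 - 2 * b] times the two-point term. *)
have [N HN] := root6_large (1 + b / (1 - 2 * b)); exists N => K n NK.
elim/ltn_ind: n => n IH.
have [nK|Kn] := leqP n K; first by rewrite peeln_le // peelr_small // mul1r.
have zn := HN n (leq_trans NK (ltnW Kn)).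
case: n IH Kn zn => [|[|m]] // IH Km zm.
  move: zm; have -> : z 1 = 1 by rewrite /z powR1.
  have : 0 < b / (1 - 2 * b) by rewrite divr_gt0.
  lra.
rewrite peelnSS // natrD natrM.
have i1 := IH m.+1 (ltnSn _); have i2 := IH m (leqW (ltnSn _)).
rewrite (peelrS _ (Km : (K <= m.+1)%N)); set r := peelr b K m.+1 in i1 *.
have r0 : 0 < r by exact: peelr_gt0.
(* For [K = m.+1] both products are empty, so that only the inequality remains. *)
have rm : peelr b K m * (1 - b / m.+1%:R) <= r.
  have [Km'|mK] := leqP K m; first by rewrite -peelrS.
  rewrite /r !peelr_small //; last exact: ltnW.
  by rewrite mul1r lerBlDl lerDr divr_ge0 // ltW.
have f0 := peelr_factor_gt0 m b01.
have M0 : 0 < m.+1%:R :> R by [].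
have rm' : peelr b K m * (m.+1%:R - b) <= r * m.+1%:R.
  have -> : m.+1%:R - b = (1 - b / m.+1%:R) * m.+1%:R.
    by rewrite mulrBl mul1r divfK // gt_eqF.
  by rewrite mulrA ler_wpM2r // ltW.
have [rho _] := invn_ratio R m.+1.
have z3 : z m.+2 <= z m.+2 ^+ 3.
  by rewrite exprS ler_peMr ?root6_ge0 // exprn_ege1 // root6_ge1.
have A0 := invn_pos R m.+1; have B0 := invn_pos R m.
have rho' := le_trans (ler_wpM2r (ltW A0) (le_trans zm z3)) rho.
have IE : (invn m.+2)%:R = (invn m.+1)%:R + m.+1%:R * (invn m)%:R :> R.
  by rewrite invnSS natrD natrM.
rewrite IE in rho' *.
have mE : m%:R = m.+1%:R - 1 :> R by rewrite -natr1 addrK.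
have m2E : m.+2%:R = m.+1%:R + 1 :> R by rewrite -natr1.
rewrite mE m2E; have Mge1 : 1 <= m.+1%:R :> R by rewrite ler1n.
move: i1 i2 r0 rm' rho' A0 B0 M0 Mge1.
move: (m.+1%:R : R) ((invn m.+1)%:R : R) ((invn m)%:R : R) (peelr b K m).
move: ((peeln K m.+1)%:R : R) ((peeln K m)%:R : R).
move=> p1 p0 M A B0 s i1 i2 r0 rm' rho' A0 B00 M0 M1.
have Mb : 0 < M - b by lra.
have bA : b * A <= (1 - 2 * b) * (M * B0).
  have : b / (1 - 2 * b) * A <= M * B0 by lra.
  by rewrite mulrAC ler_pdivrMr // [X in _ <= X -> _]mulrC.
have key : (M - 1) * B0 * (M * (M + 1)) <=
    ((1 - b / (M + 1)) * (A + M * B0) - A) * (M + 1) * (M - b).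
  have -> : ((1 - b / (M + 1)) * (A + M * B0) - A) * (M + 1) =
     (M * B0) * (M + 1) - b * (A + M * B0) by field; rewrite gt_eqF //; lra.
  have h1 : b * (A + M * B0) <= (1 - b) * (M * B0) by lra.
  have h2 : b * (A + M * B0) * (M - b) <= (1 - b) * (M * B0) * (M - b).
    by rewrite ler_wpM2r // ltW.
  have MB : 0 < M * B0 by rewrite mulr_gt0.
  have h3 : (1 - b) * (M * B0) * (M - b) <= (1 - b) * (M * B0) * (M + 1).
    by rewrite ler_wpM2l ?mulr_ge0 //; lra.
  have -> : (M - 1) * B0 * (M * (M + 1)) =
    M * B0 * (M + 1) * (M - b) - (1 - b) * (M * B0) * (M + 1) by ring.
  rewrite mulrBl; lra.
have key2 : (M - 1) * B0 * M <= ((1 - b / (M + 1)) * (A + M * B0) - A) * (M - b).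
  have M10 : 0 < M + 1 by lra.
  rewrite -(ler_pM2r M10) [leRHS]mulrAC; apply: le_trans key.
  by rewrite le_eqVlt; apply/orP; left; apply/eqP; ring.
have i2' : (M - 1) * p0 * (M - b) <= (M - 1) * B0 * (r * M).
  apply: (@le_trans _ _ ((M - 1) * (s * B0) * (M - b))).
    by rewrite ler_wpM2r ?(ltW Mb) // ler_wpM2l //; lra.
  have -> : (M - 1) * (s * B0) * (M - b) = (M - 1) * B0 * (s * (M - b)) by ring.
  by rewrite ler_wpM2l // mulr_ge0 ?(ltW B00) //; lra.
have key3 := ler_wpM2l (ltW r0) key2.
have : (M - 1) * p0 * (M - b) <=
   (r * ((1 - b / (M + 1)) * (A + M * B0) - A)) * (M - b).
  apply: le_trans i2' _.
  have -> : (M - 1) * B0 * (r * M) = r * ((M - 1) * B0 * M) by ring.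
  by rewrite -[leRHS]mulrA.
rewrite ler_pM2r // => fin; lra.
Qed.

(** Each factor satisfies $1-b/i\le e^{-b\ln(1+1/i)}=(i/(i+1))^b$, and the right-hand sides
    telescope. *)
Lemma peelr_le_powR b K n : 0 < b < 1 -> (K <= n)%N ->
  peelr b K n <= (K.+1%:R / n.+1%:R) `^ b.
Proof.
move=> b01; elim: n => [|n IH].
  by rewrite leqn0 => /eqP ->; rewrite peelr_small // divr1 powR1.
rewrite leq_eqVlt => /orP[/eqP <-|Kn].
  by rewrite peelr_small // divff ?pnatr_eq0 // powR1.
rewrite peelrS //.
have -> : K.+1%:R / n.+2%:R = (K.+1%:R / n.+1%:R) * (n.+1%:R / n.+2%:R) :> R.
  by rewrite mulrA divfK ?pnatr_eq0.
rewrite powRM ?divr_ge0 //.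
apply: ler_pM; rewrite ?(ltW (peelr_gt0 _ _ b01)) ?(ltW (peelr_factor_gt0 _ b01)) ?IH //.
have n0 : 0 < n.+1%:R :> R by [].
have n1 : 0 < n.+2%:R :> R by [].
have -> : n.+1%:R / n.+2%:R = (1 + n.+1%:R^-1)^-1 :> R.
  rewrite -(natr1 n.+1); move: n0; move: (n.+1%:R : R) => M M0.
  by field; rewrite !gt_eqF //; lra.
have i0 : 0 < n.+1%:R^-1 :> R by rewrite invr_gt0.
rewrite /powR gt_eqF ?invr_gt0 ?addr_gt0 //.
rewrite lnV ?posrE ?addr_gt0 // mulrN.
apply: le_trans (expR_ge1Dx _); rewrite lerD2l lerN2 ler_wpM2l //.
  by case/andP: b01 => /ltW.
by apply: le_ln1Dx; apply: lt_trans i0; lra.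
Qed.

End PeelBound.

Section CardOrbitsMeet.
Import mathcomp.boot.fintype mathcomp.boot.finset mathcomp.fingroup.fingroup mathcomp.fingroup.perm.
Local Open Scope ring_scope.
Variable R : realType.
Local Notation z := (root6 R).

(** An affine bound for a fractional power: its average over the b-structures involves nothing but
    the mean of $|D|$. *)
Lemma powR_le_1D (x b : R) : 0 <= x -> 0 <= b <= 1 -> x `^ b <= 1 + x.
Proof.
move=> x0 /andP[b0 b1]; apply: (@le_trans _ _ ((1 + x) `^ b)).
  by apply: ge0_ler_powR; rewrite ?nnegrE //; lra.
by rewrite -[leRHS]powRr1 ?ler_powR //; lra.
Qed.

Lemma root6_pow4_div n : (0 < n)%N -> z n ^+ 4 / n%:R = n%:R `^ (- 3%:R^-1).
Proof.
move=> n0; have nn : n%:R != 0 :> R by rewrite pnatr_eq0 -lt0n.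
have -> : n%:R^-1 = n%:R `^ (- 1) :> R by rewrite powR_inv1.
rewrite /root6 -powR_mulrn ?powR_ge0 // -powRrM -powRD ?nn ?implybT //.
by congr (_ `^ _); field.
Qed.

(** $(u/n)^{3\alpha}$ splits into $(n^{2/3}/n)^{3\alpha}=n^{-\alpha}$ and a fractional power of
    $u/n^{2/3}$, which is then bounded by an affine function of [u]. *)
Lemma peelr_average (alpha : R) K n u : 0 < alpha < 1 / 6 ->
  (0 < n)%N -> (K <= n)%N -> (K < u)%N ->
  peelr (3 * alpha) K n <= n%:R `^ (- alpha) * (1 + u%:R / z n ^+ 4).
Proof.
move=> /andP[a0 a6] n0 Kn Ku.
have b01 : 0 < 3 * alpha < 1 by apply/andP; split; lra.
have nR : 0 < n%:R :> R by rewrite ltr0n.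
have M0 : 0 < z n ^+ 4 by rewrite exprn_gt0 // root6_gt0.
apply: le_trans (peelr_le_powR b01 Kn) _.
have b0 : 0 <= 3 * alpha by lra.
apply: (@le_trans _ _ ((z n ^+ 4 / n%:R * (u%:R / z n ^+ 4)) `^ (3 * alpha))).
  have -> : z n ^+ 4 / n%:R * (u%:R / z n ^+ 4) = u%:R / n%:R.
    by move: (z n ^+ 4) M0 => M M0; field; rewrite !gt_eqF.
  apply: ge0_ler_powR; rewrite ?nnegrE ?divr_ge0 //.
  apply: ler_pM; rewrite ?invr_ge0 // ?ler_nat //.
  by rewrite lef_pV2 ?posrE ?ltr0n // ler_nat.
rewrite powRM ?divr_ge0 // ?(ltW M0) //.
rewrite root6_pow4_div // -powRrM.
have -> : - 3%:R^-1 * (3 * alpha) = - alpha by field.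
rewrite ler_wpM2l ?powR_ge0 // powR_le_1D ?divr_ge0 ?(ltW M0) //.
by apply/andP; split; lra.
Qed.

Lemma card_orbits_meet (alpha : R) : 0 < alpha < 1 / 6 ->
  exists C N, forall n, (N <= n)%N ->
  #|[set x in setX (Invols [set: 'I_n]) (Bst [set: 'I_n]) |
      orbits_meet [set: 'I_n] x.2.2 (x.2.1 * x.1)%g]|%:R
  <= C * n%:R `^ (- alpha) * ((invn n)%:R * (bstn n)%:R).
Proof.
move=> a01; have [|m0 Hm0] := @peeln_bound R (3 * alpha).
  by case/andP: a01 => a0 a6; apply/andP; split; lra.
(* $m_0+11=1+(m_0+1)+9$: the constant of the affine bound, the offset between [u] and $|D|$, and the
   9 of [mean_ends]. *)
exists (m0%:R + 11), m0.+1 => n mn.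
have n0 : (0 < n)%N by exact: leq_ltn_trans mn.
pose M := z n ^+ 4.
have M1 : 1 <= M by rewrite exprn_ege1 // root6_ge1.
have M0 : 0 < M by lra.
have q0 : 0 <= n%:R `^ (- alpha) :> R by exact: powR_ge0.
pose F (p : {perm 'I_n} * {set 'I_n}) := [set a in Invols [set: 'I_n] |
  orbits_meet [set: 'I_n] p.2 (p.1 * a)%g].
have -> : #|[set x in setX (Invols [set: 'I_n]) (Bst [set: 'I_n]) |
      orbits_meet [set: 'I_n] x.2.2 (x.2.1 * x.1)%g]| = (\sum_(p in Bst [set: 'I_n]) #|F p|)%N.
  rewrite -sum1_card (partition_big snd (mem (Bst [set: 'I_n]))) /=; last first.
    by move=> [a p]; rewrite !inE => /andP[/andP[_ ->]].
  apply: eq_bigr => p pB; rewrite sum1dep_card.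
  rewrite -[RHS](@card_imset _ _ (fun a => (a, p))); last by move=> a a' [].
  apply: eq_card => -[a p']; apply/idP/imsetP => [|[a' + [-> ->]]].
    rewrite inE => /andP[+ /eqP/= e]; rewrite e !inE /= => /andP[/andP[h1 h2] h3].
    by exists a => //; rewrite !inE h1 h3.
  by move: pB; rewrite !inE /= => -> /andP[-> ->]; rewrite eqxx.
have Fle p : p \in Bst [set: 'I_n] ->
    (#|F p|)%:R <= (n%:R `^ (- alpha) * (invn n)%:R) * (1 + (m0.+1%:R + #|p.2|%:R) / M) :> R.
  (* The estimate for [peeln] requires a parameter of at least [m0], so [D] is treated as if it had
     that many points. *)
  case/BstP=> pX _; pose K := maxn #|p.2| m0.
  have h1 := @card_Invols_orbits_meet _ K _ p.2 p.1 pX (leq_maxl _ _).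
  rewrite cardsT card_ord in h1.
  have h2 := Hm0 K n (leq_maxr _ _).
  have Kn : (K <= n)%N.
    by rewrite geq_max (ltnW mn) andbT -[leqRHS]card_ord max_card.
  have Ku : (K < m0.+1 + #|p.2|)%N by rewrite /K; clear; lia.
  have h3 := peelr_average a01 n0 Kn Ku.
  apply: (le_trans (y := (peeln K n)%:R)); first by rewrite ler_nat.
  apply: le_trans h2 _; rewrite [leRHS]mulrAC ler_wpM2r //.
  by apply: le_trans h3 _; rewrite natrD.
rewrite natr_sum; apply: le_trans (ler_sum _ Fle) _.
rewrite -mulr_sumr.
have -> : (m0%:R + 11) * n%:R `^ (- alpha) * ((invn n)%:R * (bstn n)%:R) =
  n%:R `^ (- alpha) * (invn n)%:R * ((m0%:R + 11) * (bstn n)%:R) by ring.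
rewrite ler_wpM2l ?mulr_ge0 // big_split /= sumr_const.
rewrite -mulr_suml big_split /= sumr_const -natr_sum sum_card_Bst_ends.
rewrite card_Bst cardsT card_ord -[m0.+1%:R *+ _]mulr_natr -natr1.
have := mean_ends R n; rewrite -/M.
have := bstn_pos R n; have := ler0n R m0.
move: ((bstn n)%:R : R) ((_ * bstn (n - 2))%N%:R : R) (m0%:R : R) => J S m m_ge0 J0 hS.
rewrite mulrDl; have hm : (m + 1) * J / M <= (m + 1) * J.
  by rewrite ler_pdivrMr // ler_peMr // mulr_ge0 //; lra.
have hS' : S / M <= 9 * J by rewrite ler_pdivrMr // mulrAC.
lra.
Qed.

(** With $z=n^{1/6}$, a fixed point at the root has probability at most $z^{-3}$ for the involution
    and $3z^{-4}$ for the b-structure. These are at most $z^{-1}$ and $3z^{-1}$, whence the constant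
    4, and $z^{-1}\le n^{-\alpha}$. *)
Lemma card_rooted_loops (alpha : R) : 0 < alpha < 1 / 6 -> exists C, forall n,
  (0 < n)%N ->
  (invn n.-1 * bstn n + invn n * bstn n.-1)%:R
  <= C * n%:R `^ (- alpha) * ((invn n)%:R * (bstn n)%:R) :> R.
Proof.
move=> /andP[a0 a6]; exists 4 => -[|n] // _; rewrite succnK.
have [hI _] := invn_ratio R n; have := bstn_ratio R (ltn0Sn n); rewrite succnK.
rewrite -{1}(root6_pow6 R n.+1) => hJ; have z1 := root6_ge1 R (ltn0Sn n).
have zp : (z n.+1)^-1 <= n.+1%:R `^ (- alpha).
  by rewrite /root6 -powRN ler_powR ?ler1n // lerN2; lra.
rewrite natrD !natrM.
move: hI hJ z1 zp (invn_pos R n) (invn_pos R n.+1) (bstn_pos R n) (bstn_pos R n.+1).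
move: (z n.+1) (_ `^ _) ((invn n)%:R : R) ((invn n.+1)%:R : R).
move: ((bstn n)%:R : R) ((bstn n.+1)%:R : R) => b b' w q a a' hI hJ w1 wq a0' a1 b0 b1.
have w0 : 0 < w by lra.
have q0 : 0 < q by apply: lt_le_trans wq; rewrite invr_gt0.
have h1 : a <= q * a'.
  apply: (@le_trans _ _ (w^-1 * a')); last by rewrite ler_wpM2r // ltW.
  rewrite ler_pdivlMl //; apply: le_trans hI; rewrite ler_wpM2r ?(ltW a0') //.
  by rewrite exprS ler_peMr ?exprn_ege1 // ltW.
have w2 : 0 < w ^+ 2 by rewrite exprn_gt0.
have w21 : 1 <= w ^+ 2 by rewrite exprn_ege1.
have h2 : b <= 3 * q * b'.
  apply: (@le_trans _ _ (w^-1 * (3 * b'))); last first.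
    by rewrite mulrCA mulrA ler_wpM2r ?(ltW b1) // ler_pM2l.
  rewrite ler_pdivlMl // -(ler_pM2l w2).
  apply: (@le_trans _ _ (w ^+ 6 * b)).
    rewrite mulrA -exprSr ler_wpM2r ?(ltW b0) //.
    by rewrite (_ : w ^+ 6 = w ^+ 3 * w ^+ 3) ?ler_peMr ?exprn_ege1 ?exprn_ge0 ?(ltW w0) //; ring.
  apply: le_trans hJ _; rewrite mulrA ler_wpM2r ?(ltW b1) //; lra.
have := ler_wpM2r (ltW b1) h1; have := ler_wpM2l (ltW a1) h2.
have -> : a' * (3 * q * b') = 3 * (q * a' * b') by ring.
have -> : 4 * q * (a' * b') = 4 * (q * a' * b') by ring.
lra.
Qed.

End CardOrbitsMeet.

(** * Stallings graphs of subgroups *)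

Section Subgroups.
Local Open Scope classical_set_scope.
Local Open Scope group_scope.
Implicit Types (H : set PSL2Z) (g x y : PSL2Z) (w : word).

Lemma is_subgroupP H : is_subgroup H <->
  [/\ H 1, forall x y, H x -> H y -> H (x * y) & forall x, H x -> H x^-1].
Proof.
split=> [[/set_mem H1 HV]|[H1 HM HV]]; last first.
  split=> [|x y /set_mem Hx /set_mem Hy]; first exact: mem_set.
  by apply: mem_set; apply: HM => //; apply: HV.
have V x : H x -> H x^-1.
  by move=> /mem_set Hx; have /set_mem := HV _ _ (mem_set H1) Hx; rewrite mul1g.
split=> // x y Hx /V/mem_set Hy.
by have /set_mem := HV _ _ (mem_set Hx) Hy; rewrite invgK.
Qed.

Lemma eltV w : elt (word_inv w) = (elt w)^-1.
Proof.
apply: (mulIg (elt w)); rewrite -eltM mulVg.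
exact/eltP/psl_mulVw.
Qed.

Lemma nf_eq w w' : elt w = elt w' -> nf w = nf w'.
Proof. by move=> /eltP/nf_onto_eqv; apply. Qed.

Lemma geodesic_nf w : geodesic (nf w).
Proof. exact: nf_onto_geodesic. Qed.

Lemma rcoset_ofE H g x : rcoset_of H g x <-> H (x * g^-1).
Proof.
by split=> [[h Hh <-]|Hx]; [rewrite mulgK|exists (x * g^-1); rewrite ?mulgVK].
Qed.

Lemma rcoset_ofM H g g' : rcoset_of (rcoset_of H g) g' = rcoset_of H (g * g').
Proof.
by apply/seteqP; split=> x; rewrite !rcoset_ofE invgM mulgA.
Qed.

Lemma rcoset_of1 H : rcoset_of H 1 = H.
Proof. by apply/seteqP; split=> x; rewrite rcoset_ofE invg1 mulg1. Qed.

Lemma rcoset_of_id H g : is_subgroup H -> rcoset_of H g = H <-> H g.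
Proof.
case/is_subgroupP=> H1 HM HV; split=> [<-|Hg].
  by rewrite rcoset_ofE mulgV.
apply/seteqP; split=> x; rewrite rcoset_ofE => Hx.
  by rewrite -[x](mulgVK g); apply: HM.
by apply: HM => //; apply: HV.
Qed.

Lemma rcoset_of_eq H g g' : is_subgroup H ->
  rcoset_of H g = rcoset_of H g' <-> H (g * g'^-1).
Proof.
move=> sH; rewrite -rcoset_of_id // -rcoset_ofM; split=> [->|e].
  by rewrite rcoset_ofM mulgV rcoset_of1.
by rewrite -[in RHS]e !rcoset_ofM mulVg mulg1.
Qed.

Lemma elt_cons l w : elt (l :: w) = elt [:: l] * elt w.
Proof. by rewrite -eltM. Qed.

Lemma gaK : ga * ga = 1. Proof. exact: ga2. Qed.

Lemma elt_Lb' : elt [:: Lb'] = gb^-1.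
Proof. by rewrite -[[:: Lb']]/(word_inv [:: Lb]) eltV. Qed.

Lemma reads_schreier H l v v' : reads (schreier H) l v v' <->
  range (rcoset_of H) v /\ v' = rcoset_of v (elt [:: l]).
Proof.
case: l => /=; split.
- case=> -[g -> ->]; first by rewrite rcoset_ofM; split=> //; exists g.
  split; first by exists (g * ga).
  by rewrite rcoset_ofM -mulgA gaK mulg1.
- by case=> -[g _ <-] ->; left; exists g; rewrite ?rcoset_ofM.
- by case=> g -> ->; rewrite rcoset_ofM; split=> //; exists g.
- by case=> -[g _ <-] ->; exists g; rewrite ?rcoset_ofM.
- case=> g -> ->; split; first by exists (g * gb).
  by rewrite rcoset_ofM elt_Lb' mulgK.
case=> -[g _ <-] ->; rewrite rcoset_ofM elt_Lb'.
by exists (g * gb^-1); rewrite ?mulgVK.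
Qed.

Lemma walk_schreier H v w v' : range (rcoset_of H) v ->
  walk (schreier H) v w v' <-> v' = rcoset_of v (elt w).
Proof.
elim: w v => [|l w IH] v rv /=; first by rewrite rcoset_of1; split.
have rv' : range (rcoset_of H) (rcoset_of v (elt [:: l])).
  by case: rv => g _ <-; rewrite rcoset_ofM; exists (g * elt [:: l]).
rewrite elt_cons -rcoset_ofM; split=> [[u /reads_schreier[_ ->] /(IH _ rv')]|e] //.
by exists (rcoset_of v (elt [:: l])); [apply/reads_schreier|apply/(IH _ rv')].
Qed.

(** Vertices and edges of the Stallings graph in terms of words alone: a walk in the Schreier graph
    is determined by its origin and its label. *)
Definition stallings_vertex H v := exists w1 w2,
  [/\ geodesic (w1 ++ w2), H (elt (w1 ++ w2)) & v = rcoset_of H (elt w1)].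

Definition stallings_edge H l v := exists w1 w2,
  [/\ geodesic (w1 ++ l :: w2), H (elt (w1 ++ l :: w2)) & v = rcoset_of H (elt w1)].

Lemma root_range H : range (rcoset_of H) H.
Proof. by exists 1; rewrite ?rcoset_of1. Qed.

Lemma walk_root H w v : walk (schreier H) H w v <-> v = rcoset_of H (elt w).
Proof. exact/walk_schreier/root_range. Qed.

Lemma stallings_vertexP H v : is_subgroup H ->
  lg_vert (stallings H) v <-> stallings_vertex H v.
Proof.
move=> sH; split=> [[_ [w1 [w2 [[gw Hw] /walk_root -> _]]]]|].
  by exists w1, w2.
case=> w1 [w2 [gw Hw ->]].
have rv : range (rcoset_of H) (rcoset_of H (elt w1)) by exists (elt w1).
split=> //; exists w1, w2; split=> //; first exact/walk_root.
apply/(walk_schreier _ _ rv); rewrite rcoset_ofM -eltM.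
by symmetry; apply/rcoset_of_id.
Qed.

Lemma traversed_stallings H l v v' : is_subgroup H ->
  traversed (schreier H) [set w | geodesic w /\ H (elt w)] l v v' <->
  stallings_edge H l v /\ v' = rcoset_of v (elt [:: l]).
Proof.
move=> sH; split=> [[w1 [w2 [[gw Hw] /walk_root -> /reads_schreier[_ ->] _]]]|].
  by split=> //; exists w1, w2.
case=> -[w1 [w2 [gw Hw ->]]] ->.
have rv : range (rcoset_of H) (rcoset_of H (elt w1)) by exists (elt w1).
exists w1, w2; split=> //; [exact/walk_root|exact/reads_schreier|].
apply/walk_schreier; first by rewrite rcoset_ofM; exists (elt w1 * elt [:: l]).
rewrite !rcoset_ofM -!eltM.
by symmetry; apply/rcoset_of_id.
Qed.

End Subgroups.

(** * Walks in partial labelled graphs *)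

Section Walks.
Variables (V : eqType) (s : letter -> V -> option V).

Fixpoint gwalk (v : V) (w : word) : option V :=
  if w is l :: w' then obind (gwalk^~ w') (s l v) else Some v.

Lemma gwalk_cat v w1 w2 : gwalk v (w1 ++ w2) = obind (gwalk^~ w2) (gwalk v w1).
Proof. by elim: w1 v => //= l w1 IH v; case: (s l v) => //= u. Qed.

Lemma gwalk_catS v u w1 w2 : gwalk v w1 = Some u ->
  gwalk v (w1 ++ w2) = gwalk u w2.
Proof. by rewrite gwalk_cat => ->. Qed.

Lemma is_a_inv l : is_a (letter_inv l) = is_a l. Proof. by case: l. Qed.

Lemma word_inv_cons l w : word_inv (l :: w) = word_inv w ++ [:: letter_inv l].
Proof. by rewrite -cat1s word_inv_cat. Qed.

Hypothesis sI : forall l u v, s l u = Some v -> s (letter_inv l) v = Some u.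

Lemma gwalk_inv u v w : gwalk u w = Some v -> gwalk v (word_inv w) = Some u.
Proof.
elim: w u => [|l w IH] u /=; first by case=> ->.
case su: (s l u) => [u'|] //= /IH e; rewrite word_inv_cons.
by rewrite (gwalk_catS _ e) /= (sI su).
Qed.

Hypothesis sb : forall u v w, s Lb u = Some v -> s Lb v = Some w -> s Lb' u = Some w.

(** A cancellation goes back along an edge, by [sI]. Merging two equal letters [Lb] or [Lb'] into
    the opposite one calls for the third side of a triangle, provided by [sb]. Partial walks
    therefore survive normalization. *)
Lemma gwalk_nf_cons u l w v : gwalk u (l :: w) = Some v ->
  gwalk u (nf_cons l w) = Some v.
Proof.
case: l; case: w => [|[] w] //=; case su: (s _ u) => [u1|] //=;
  case su1: (s _ u1) => [u2|] //=.
- by have /= := sI su; rewrite su1 => -[->].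
- by rewrite (sb su su1).
- by have /= := sI su; rewrite su1 => -[->].
- by have /= := sI su; rewrite su1 => -[->].
by have /= /sI/= -> := sb (sI su1) (sI su).
Qed.

Lemma gwalk_nf u w v : gwalk u w = Some v -> gwalk u (nf w) = Some v.
Proof.
elim: w u => [|l w IH] u //=; case su: (s l u) => [u'|] //= /IH e.
by apply: gwalk_nf_cons; rewrite /= su.
Qed.

Lemma gwalk_elt u w w' v v' : elt w = elt w' ->
  gwalk u w = Some v -> gwalk u w' = Some v' -> v = v'.
Proof. by move=> /nf_eq e /gwalk_nf + /gwalk_nf; rewrite e => -> []. Qed.

Lemma gwalk_geodesic u w w' v : elt w = elt w' -> geodesic w ->
  gwalk u w' = Some v -> gwalk u w = Some v.
Proof. by move=> e gw /gwalk_nf; rewrite -(nf_eq e) nf_id. Qed.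

End Walks.

(** Geodesic words with the type of their first letter: [t] tells whether it is [La]. Concatenation
    then becomes a parity condition. *)
Fixpoint alternates (t : bool) (w : word) : bool :=
  if w is l :: w' then (is_a l == t) && alternates (~~ t) w' else true.

Lemma alternates_cat t w1 w2 :
  alternates t (w1 ++ w2) = alternates t w1 && alternates (t (+) odd (size w1)) w2.
Proof.
elim: w1 t => [|l w IH] t /=; first by rewrite addbF.
by rewrite IH andbA addbN -addNb.
Qed.

Lemma alternates_geodesic t w : alternates t w -> geodesic w.
Proof.
elim: w t => // l [|m w] IH t //= /andP[/eqP lt mw].
rewrite /geodesic /= in IH *; rewrite (IH _ mw) andbT.
by case/andP: mw => /eqP -> _; rewrite lt; case: t {lt}.
Qed.

Lemma geodesic_alternates w : geodesic w -> exists t, alternates t w.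
Proof.
elim: w => [|l w IH] gw; first by exists true.
have [t tw] := IH (path_sorted gw); exists (is_a l); rewrite /= eqxx /=.
case: w gw tw {IH} => // m w /= /andP[lm _] /andP[/eqP mt mw].
by rewrite mt in lm *; move: lm mw; case: (is_a l); case: t {mt}.
Qed.

Lemma alternates_inv t w : alternates t w ->
  alternates (~~ (t (+) odd (size w))) (word_inv w).
Proof.
elim: w t => // l w IH t /= /andP[/eqP lt /IH].
rewrite word_inv_cons alternates_cat addNb addbN negbK => -> /=.
by rewrite size_rev size_map is_a_inv lt -addbA addbb addbF eqxx.
Qed.

Section GraphSubgroup.
Local Open Scope classical_set_scope.
Variables (n : nat) (s : letter -> 'I_n -> option 'I_n) (r : 'I_n).
Hypothesis sI : forall l u v, s l u = Some v -> s (letter_inv l) v = Some u.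
Hypothesis sb : forall u v w, s Lb u = Some v -> s Lb v = Some w -> s Lb' u = Some w.
Hypothesis sa : forall u, exists v, s La u = Some v.
Hypothesis sb_dom : forall u, exists v, s Lb u = Some v \/ s Lb' u = Some v.
Hypothesis loop_through : forall l u v, s l u = Some v -> exists w1 w2,
  [/\ geodesic (w1 ++ l :: w2), gwalk s r w1 = Some u & gwalk s v w2 = Some r].

(** The elements read from the root to [u], which form a coset of those read along loops. The
    hypothesis [loop_through] ensures that the whole graph, and not just a part of it, is the
    Stallings graph of the latter. *)
Definition gcoset (u : 'I_n) : set PSL2Z :=
  [set x | exists2 w, gwalk s r w = Some u & elt w = x].

Lemma gcoset_inj : injective gcoset.
Proof.
move=> u v e; have [u' /loop_through[w [_ [_ wu _]]]] := sa u.
have : gcoset v (elt w) by rewrite -e; exists w.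
by case=> w' wv /esym e'; apply: (gwalk_elt sI sb e' wu wv).
Qed.

Lemma gcoset_subgroup : is_subgroup (gcoset r).
Proof.
apply/is_subgroupP; split=> [|x y [w wr <-] [w' w'r <-]|x [w wr <-]].
- by exists [::].
- by exists (w ++ w'); rewrite ?eltM // (gwalk_catS _ wr).
- by exists (word_inv w); rewrite ?eltV //; apply: (gwalk_inv sI wr).
Qed.

Lemma gcosetE u w : gwalk s r w = Some u -> gcoset u = rcoset_of (gcoset r) (elt w).
Proof.
move=> wu; apply/seteqP; split=> x.
  case=> w' w'u <-; apply/rcoset_ofE; rewrite -eltV -eltM.
  by exists (w' ++ word_inv w); rewrite // (gwalk_catS _ w'u); apply: (gwalk_inv sI wu).
case=> _ [w' w'r <-] <-; rewrite -eltM; exists (w' ++ w) => //.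
by rewrite (gwalk_catS _ w'r).
Qed.

Lemma gcoset_root w : geodesic w -> gcoset r (elt w) <-> gwalk s r w = Some r.
Proof.
by move=> gw; split=> [[w' w'r /esym e]|wr]; [apply: (gwalk_geodesic sI sb e gw w'r)|exists w].
Qed.

Lemma gcoset_edge l u v : s l u = Some v -> stallings_edge (gcoset r) l (gcoset u).
Proof.
move=> suv; have [w1 [w2 [gw wu vw]]] := loop_through suv; exists w1, w2.
split=> //; last exact: gcosetE.
by apply/gcoset_root; rewrite // (gwalk_catS _ wu) /= suv.
Qed.

Lemma stallings_gcoset : lg_vert (stallings (gcoset r)) = range gcoset.
Proof.
apply/seteqP; split=> [v /(stallings_vertexP _ gcoset_subgroup)|_ [u _ <-]].
  case=> w1 [w2 [gw /(gcoset_root gw) + ->]].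
  rewrite gwalk_cat; case e: (gwalk s r w1) => [u|] // _.
  by exists u; rewrite // (gcosetE e).
apply/(stallings_vertexP _ gcoset_subgroup).
have [v suv] := sa u; have [w1 [w2 [gw Hw ->]]] := gcoset_edge suv.
by exists w1, (La :: w2).
Qed.

Lemma gcoset_has_size : has_size n (gcoset r).
Proof.
rewrite /has_size stallings_gcoset card_eq_sym.
have -> : range gcoset = (fun k : nat => gcoset (insubd r k)) @` `I_n.
  apply/seteqP; split=> [_ [u _ <-]|_ [k kn <-]]; last by exists (insubd r k).
  by exists u; [apply: ltn_ord|rewrite valKd].
rewrite card_eq_sym; apply: inj_card_eq => i j /set_mem/= i_n /set_mem/= j_n.
by move=> /gcoset_inj/(congr1 val); rewrite !val_insubd i_n j_n.
Qed.

Lemma gcoset_cyclically_reduced : cyclically_reduced (gcoset r).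
Proof.
have sG := gcoset_subgroup.
move=> v; rewrite stallings_gcoset => -[u _ <-]; split.
  have [u' su] := sa u; exists (rcoset_of (gcoset u) (elt [:: La])); left; left.
  by apply/traversed_stallings => //; split=> //; apply: gcoset_edge su.
have [u' [su|su]] := sb_dom u.
  exists (rcoset_of (gcoset u) (elt [:: Lb])); left; left.
  by apply/traversed_stallings => //; split=> //; apply: gcoset_edge su.
exists (rcoset_of (gcoset u) (elt [:: Lb'])); right; right.
by apply/traversed_stallings => //; split=> //; apply: gcoset_edge su.
Qed.

(** Schreier generators: a path to the tail of an edge, the edge, and a path back from its head. A
    loop at the root is the product of the generators of its edges, up to [p r]. *)
Lemma gcoset_finitely_generated : finitely_generated (gcoset r).
Proof.
have /choice[p pP] : forall u, exists w, gwalk s r w = Some u.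
  move=> u; by have [v /loop_through[w [_ [_ wu _]]]] := sa u; exists w.
(* The chosen path [p r] from the root to itself need not be empty, so its element is a generator as
   well; it also serves as default value for undefined edges. *)
pose gen (ul : 'I_n * letter) :=
  if s ul.2 ul.1 is Some v then elt (p ul.1 ++ ul.2 :: word_inv (p v)) else elt (p r).
exists (range gen `|` [set elt (p r)]).
  rewrite finite_setU; split; last exact: finite_set1.
  by apply: finite_image; apply: finite_finset.
apply/seteqP; split=> [x [w wr <-] H /= [/is_subgroupP[H1 HM HV] genH]|]; last first.
  apply: smallest_sub; first exact: gcoset_subgroup.
  move=> x [[[u l] _ <-]|->]; last by exists (p r).
  rewrite /gen /=; case su: (s l u) => [v|]; last by exists (p r).
  exists (p u ++ l :: word_inv (p v)) => //.
  rewrite (gwalk_catS _ (pP u)) /= su /=; exact: (gwalk_inv sI (pP v)).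
have Hpr : H (elt (p r)) by apply: genH; right.
suff Hpw u w' : gwalk s u w' = Some r -> H (elt (p u ++ w')).
  have := HM _ _ (HV _ Hpr) (Hpw _ _ wr).
  by rewrite eltM mulgA mulVg mul1g.
elim: w' u => [|l w' IH] u /=; first by case=> ->; rewrite cats0.
case su: (s l u) => [v|] //= /IH Hv.
have Hg : H (elt (p u ++ l :: word_inv (p v))).
  by apply: genH; left; exists (u, l); rewrite // /gen /= su.
have := HM _ _ Hg Hv.
rewrite -[l :: w']cat1s -[l :: word_inv _]cat1s !eltM eltV !mulgA.
by rewrite mulgVK.
Qed.

Lemma gcoset_fg : cr_fg_subgroups n (gcoset r).
Proof.
split; last exact: gcoset_cyclically_reduced.
split; [exact: gcoset_subgroup|exact: gcoset_finitely_generated|].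
exact: gcoset_has_size.
Qed.

End GraphSubgroup.

(** * From transitive structures to subgroups *)

Section LabelledStructure.
Import mathcomp.boot.fintype mathcomp.boot.finset mathcomp.fingroup.fingroup mathcomp.fingroup.perm.
Local Open Scope group_scope.
Variable n : nat.

Definition lstruct : Type := {perm 'I_n} * ({perm 'I_n} * {set 'I_n}).

Definition step (x : lstruct) (l : letter) (v : 'I_n) : option 'I_n :=
  match l with
  | La => Some (x.1 v)
  | Lb => if v \in x.2.2 then None else Some (x.2.1 v)
  | Lb' => if x.2.1^-1 v \in x.2.2 then None else Some (x.2.1^-1 v)
  end.

Variable x : lstruct.
Hypothesis aP : x.1 \in Invols [set: 'I_n].
Hypothesis bP : x.2 \in Bst [set: 'I_n].

Lemma stepI l u v : step x l u = Some v -> step x (letter_inv l) v = Some u.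
Proof.
case: l => /=.
- by case=> <-; case/InvolsP: aP => _ ->.
- by case: ifPn => // uD [<-]; rewrite permK (negbTE uD).
by case: ifPn => // uD [<-]; rewrite (negbTE uD) permKV.
Qed.

Lemma step_end u : u \in x.2.2 -> x.2.1^-1 u = x.2.1 u /\ x.2.1 u \notin x.2.2.
Proof.
case/BstP: bP => _ /(_ u); rewrite /block_ok => + uD; rewrite uD andbF /=.
by case/andP=> /eqP bbu; split=> //; rewrite -{1}bbu permK.
Qed.

(** A 2-cycle has a point in [D] and cannot carry two consecutive steps, so the cycle has length 1
    or 3 and avoids [D]. *)
Lemma step_b u v w : step x Lb u = Some v -> step x Lb v = Some w ->
  step x Lb' u = Some w.
Proof.
rewrite /=; case: ifPn => // uD [<-]; case: ifPn => // vD [<-].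
case/BstP: bP => _ ok; have := ok u.
rewrite /block_ok (negbTE uD) (negbTE vD) andbT andbF orbF => /eqP b3.
have -> : x.2.1^-1 u = x.2.1 (x.2.1 u) by rewrite -{1}b3 permK.
case: ifP => // wD; have [] := step_end wD.
by rewrite permK b3 => e _; rewrite !e (negbTE uD) in wD.
Qed.

Lemma step_a u : exists v, step x La u = Some v.
Proof. by exists (x.1 u). Qed.

(** At a point of [D] the permutation is followed by reading [Lb']: on a 2-cycle it agrees with its
    inverse. *)
Lemma step_b_to u : exists2 l, ~~ is_a l & step x l u = Some (x.2.1 u).
Proof.
have [uD|uD] := boolP (u \in x.2.2); last by exists Lb; rewrite //= (negbTE uD).
by have [e vD] := step_end uD; exists Lb'; rewrite //= e (negbTE vD).
Qed.

Lemma step_b_from u : exists2 l, ~~ is_a l & step x l u = Some (x.2.1^-1 u).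
Proof.
have [l la /stepI] := step_b_to (x.2.1^-1 u); rewrite permKV => e.
by exists (letter_inv l); rewrite ?is_a_inv.
Qed.

Lemma step_b_dom u : exists v, step x Lb u = Some v \/ step x Lb' u = Some v.
Proof.
have [l la e] := step_b_to u; exists (x.2.1 u).
by case: l la e => //; [left|right].
Qed.

(* States record a position together with the type of the next letter, so that
   paths of states are alternating words. Every transition belongs to one of two
   permutations of the states, and reversing it amounts to going around a cycle. *)
Definition state_step (p q : 'I_n * bool) : bool :=
  [exists l, [&& is_a l == p.2, step x l p.1 == Some q.1 & q.2 == ~~ p.2]].

Definition turn (b : {perm 'I_n}) (p : 'I_n * bool) : 'I_n * bool :=
  if p.2 then (x.1 p.1, false) else (b p.1, true).

Lemma turn_inj b : injective (turn b).
Proof.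
by move=> [u [|]] [v [|]] //= [] /perm_inj ->.
Qed.

Lemma turn_step p : state_step p (turn x.2.1 p) /\ state_step p (turn x.2.1^-1 p).
Proof.
case: p => u [|]; split; apply/existsP.
- by exists La; rewrite /= eqxx.
- by exists La; rewrite /= eqxx.
- by have [l /negbTE la e] := step_b_to u; exists l; rewrite /= la e !eqxx.
by have [l /negbTE la e] := step_b_from u; exists l; rewrite /= la e !eqxx.
Qed.

Lemma state_step_turn p q : state_step p q ->
  q = turn x.2.1 p \/ q = turn x.2.1^-1 p.
Proof.
case: p q => u t [v t'] /existsP[l /and3P[/= /eqP <- /eqP su /eqP ->]].
case: l su => /=.
- by case=> <-; left.
- by case: ifP => // _ [<-]; left.
by case: ifP => // _ [<-]; right.
Qed.

Lemma connect_state_sym p q :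
  connect state_step p q -> connect state_step q p.
Proof.
have step_sym p1 q1 : state_step p1 q1 -> connect state_step q1 p1.
  have turn_sym b : (forall p, state_step p (turn b p)) ->
      forall p, connect state_step (turn b p) p.
    move=> sub p2; have : connect (frel (turn b)) p2 (turn b p2).
      by apply: connect1; rewrite /= eqxx.
    rewrite (fconnect_sym (@turn_inj b)); apply: connect_sub => p3 q3 /eqP <-.
    exact: connect1.
  by case/state_step_turn=> ->; apply: turn_sym => p2; have [] := turn_step p2.
case/connectP=> c; elim: c p => [|p1 c IH] p /=; first by move=> _ ->.
by case/andP=> /step_sym pp1 /IH h /h qp1; apply: connect_trans qp1 pp1.
Qed.

Lemma connect_stateP p q : connect state_step p q <->
  exists w, [/\ alternates p.2 w, gwalk (step x) p.1 w = Some q.1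
    & q.2 = p.2 (+) odd (size w)].
Proof.
split.
  case/connectP=> c; elim: c p => [|p1 c IH] p /=.
    by move=> _ ->; exists [::]; rewrite addbF.
  case/andP=> /existsP[l /and3P[/eqP la /eqP su /eqP e]] /IH h /h[w [aw ww qw]].
  exists (l :: w); rewrite /= la eqxx su -e aw /=; split=> //.
  by rewrite qw e addNb addbN.
case=> w; elim: w p => [|l w IH] p /=.
  by rewrite addbF; case: p q => u t [v t'] [_ /= [->] ->]; apply: connect0.
case su: (step x l p.1) => [v|] /= [/andP[lp aw] // wv qt].
apply: (@connect_trans _ _ (v, ~~ p.2)).
  by apply/connect1/existsP; exists l; rewrite lp su !eqxx.
by apply: IH; split=> //; rewrite qt addNb addbN.
Qed.

Variable r : 'I_n.
Hypothesis conn : transitive_pair x.1 x.2.1.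

Lemma walk_from_root u : exists w, gwalk (step x) r w = Some u.
Proof.
pose S := [set u | `[< exists w, gwalk (step x) r w = Some u >]].
suff /setP/(_ u) : S = setT by rewrite !inE => /asboolP.
apply/eqP; move/forallP: conn => /(_ S)/implyP; apply.
have stable (c : {perm 'I_n}) : (forall v, exists l, step x l v = Some (c v)) ->
    c @: S == S.
  move=> cl; rewrite eqEcard card_imset ?leqnn ?andbT; last exact: perm_inj.
  apply/subsetP=> _ /imsetP[v + ->]; rewrite !inE => /asboolP[w wv].
  have [l lv] := cl v; apply/asboolP; exists (w ++ [:: l]).
  by rewrite (gwalk_catS _ wv) /= lv.
rewrite !stable ?andbT.
- by apply/set0Pn; exists r; rewrite inE; apply/asboolP; exists [::].
- by move=> v; have [l _ e] := step_b_to v; exists l.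
- by move=> v; exists La.
Qed.

(** A walk from the root may arrive at [u] with the wrong type. The inverse walk then leaves [u]
    with type [t], and symmetry of reachability turns it around. *)
Lemma state_from_root u t : exists t', connect state_step (r, t') (u, t).
Proof.
have [w /(gwalk_nf stepI step_b) wu] := walk_from_root u.
have [t0 tw] := geodesic_alternates (geodesic_nf w).
have [e|ne] := eqVneq t (t0 (+) odd (size (nf w))).
  by exists t0; apply/connect_stateP; exists (nf w).
exists (~~ t0); apply: connect_state_sym; apply/connect_stateP.
have et : t = ~~ (t0 (+) odd (size (nf w))).
  by move: ne; case: t; case: (_ (+) _).
exists (word_inv (nf w)); split; rewrite /=.
- by rewrite et; apply: alternates_inv.
- exact: (gwalk_inv stepI wu).
by rewrite et size_rev size_map addNb -addbA addbb addbF.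
Qed.

(** By symmetry, the state reached after the edge leads back to the initial state at the root. Paths
    of states read alternating words, so the resulting loop is geodesic. *)
Lemma step_loop_through l u v : step x l u = Some v -> exists w1 w2,
  [/\ geodesic (w1 ++ l :: w2), gwalk (step x) r w1 = Some u
    & gwalk (step x) v w2 = Some r].
Proof.
move=> su; have [t ru] := state_from_root u (is_a l).
have uv : connect state_step (u, is_a l) (v, ~~ is_a l).
  by apply/connect1/existsP; exists l; rewrite su !eqxx.
have vr := connect_state_sym (connect_trans ru uv).
have [w1 [/= a1 r1 e1]] := (connect_stateP _ _).1 ru.
have [w2 [/= a2 r2 e2]] := (connect_stateP _ _).1 vr.
exists w1, w2; split=> //; apply: (@alternates_geodesic t).
by rewrite alternates_cat a1 -e1 /= eqxx.
Qed.

Lemma lstruct_subgroup : cr_fg_subgroups n (gcoset (step x) r r).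
Proof.
apply: gcoset_fg; [exact: stepI|exact: step_b|exact: step_a|exact: step_b_dom|].
exact: step_loop_through.
Qed.

End LabelledStructure.

(** * Labelled structures and subgroups *)

Section RootedStructure.
Import mathcomp.boot.fintype mathcomp.boot.finset mathcomp.fingroup.fingroup mathcomp.fingroup.perm.
Local Open Scope group_scope.
Variable n : nat.

(* The flags mark the generators that are undefined at the root, although the
   structure has a loop there. *)
Definition rstep (x : lstruct n) (r : 'I_n) (f : bool * bool) l v :=
  if (v == r) && (if is_a l then f.1 else f.2) then None else step x l v.

(** [E l i] tells where the letter [l] is defined and [nb l i] where it leads; the hypotheses are
    those satisfied by a Stallings graph. The completion adds a fixed point where [a] is undefined
    or where there is no [b]-edge, and closes a lone [b]-edge into a 2-cycle whose point in [D] is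
    its head. By the second hypothesis, fixed points are added at the root only, and the flags
    record them. *)
Lemma rstep_exists (E : letter -> 'I_n -> bool) (nb : letter -> 'I_n -> 'I_n)
    (r : 'I_n) :
  (forall l i, E l i -> E (letter_inv l) (nb l i) /\ nb (letter_inv l) (nb l i) = i) ->
  (forall i, i != r -> E La i && (E Lb i || E Lb' i)) ->
  (forall i, E Lb i -> E Lb (nb Lb i) -> E Lb' i /\ nb Lb' i = nb Lb (nb Lb i)) ->
  exists (x : lstruct n) f,
    [/\ (x.1 \in Invols [set: 'I_n]) && (x.2 \in Bst [set: 'I_n]),
        f.1 ==> (x.1 r == r), f.2 ==> (x.2.1 r == r)
      & forall l i, rstep x r f l i = if E l i then Some (nb l i) else None].
Proof.
move=> A1 A2 A3.
pose a i := if E La i then nb La i else i.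
have aK : involutive a.
  move=> i; rewrite /a; have [/A1/= [-> ->] //|/negbTE Ei] := boolP (E La i).
  by rewrite Ei.
pose b i := if E Lb i then nb Lb i else if E Lb' i then nb Lb' i else i.
have A3' i : E Lb i -> E Lb' i -> E Lb (nb Lb i).
  move=> Ei /[dup] Ei' /A1/= [Ey ey].
  have [] := A3 _ Ey; rewrite ey // => Ey' e.
  by have [] := A1 _ _ Ey'; rewrite e.
have b_inj : injective b.
  move=> i j; rewrite /b.
  have [Ei|/negbTE Ei] := boolP (E Lb i); have [Ej|/negbTE Ej] := boolP (E Lb j).
  - by move=> e; have [_ <-] := A1 _ _ Ei; have [_ <-] := A1 _ _ Ej; rewrite e.
  - have [Ei1 Ei2] := A1 _ _ Ei; have [Ej'|/negbTE Ej'] := boolP (E Lb' j) => e.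
      have [Ey ey] := A1 _ _ Ej'; rewrite /= in Ei1 Ey ey.
      by have := A3' _ Ey; rewrite -{1}e Ei1 ey Ej => /(_ isT).
    by rewrite /= e Ej' in Ei1.
  - have [Ej1 Ej2] := A1 _ _ Ej; have [Ei'|/negbTE Ei'] := boolP (E Lb' i) => e.
      have [Ey ey] := A1 _ _ Ei'; rewrite /= in Ej1 Ey ey.
      by have := A3' _ Ey; rewrite {1}e Ej1 ey Ei => /(_ isT).
    by rewrite /= -e Ei' in Ej1.
  - have [Ei'|/negbTE Ei'] := boolP (E Lb' i); have [Ej'|/negbTE Ej'] := boolP (E Lb' j) => // e.
    + by have [_ <-] := A1 _ _ Ei'; have [_ <-] := A1 _ _ Ej'; rewrite e.
    + by have [] := A1 _ _ Ei'; rewrite e /= Ej.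
    by have [] := A1 _ _ Ej'; rewrite -e /= Ei.
pose D := [set i | ~~ E Lb i && E Lb' i].
pose x : lstruct n := (perm (inv_inj aK), (perm b_inj, D)).
pose f := (~~ E La r, ~~ (E Lb r || E Lb' r)).
have bE i : perm b_inj i = b i by rewrite permE.
have bV i : E Lb i || E Lb' i -> (perm b_inj)^-1 i =
    if E Lb' i then nb Lb' i else nb Lb i.
  move=> h; apply: (@perm_inj _ (perm b_inj)); rewrite permKV bE.
  case: ifPn h => [/A1/= [Ey ey] _|/negbTE Ei' /orP[|//] Ei]; first by rewrite /b Ey ey.
  rewrite /b; have [Ey ey] := A1 _ _ Ei; rewrite /= in Ey ey.
  have [Eb|_] := boolP (E Lb (nb Lb i)); last by rewrite Ey ey.
  by have [] := A3 _ Ei Eb; rewrite Ei'.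
have inD i : i \in D = ~~ E Lb i && E Lb' i by rewrite inE.
have onT (c : {perm 'I_n}) : perm_on [set: 'I_n] c.
  by apply/subsetP=> i; rewrite !inE.
exists x, f; split.
- apply/andP; split; first by apply/InvolsP; split=> [|i]; rewrite ?onT //= !permE.
  apply/BstP; split=> [|i] /=; first exact: onT.
  rewrite /block_ok !inD !bE.
  have [Ei|/negbTE Ei] := boolP (E Lb i).
    have -> : b i = nb Lb i by rewrite /b Ei.
    have [Ey ey] := A1 _ _ Ei; rewrite /= in Ey ey.
    have [Eb|/negbTE Eb] := boolP (E Lb (nb Lb i)).
      have [Ei' e] := A3 _ Ei Eb.
      have -> : b (nb Lb i) = nb Lb' i by rewrite /b Eb.
      have [Ez ez] := A1 _ _ Ei'; rewrite /= in Ez ez.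
      by rewrite /b Ez ez eqxx.
    have -> : b (nb Lb i) = i by rewrite /b Eb Ey ey.
    by rewrite eqxx Ey orbT.
  have [Ei'|/negbTE Ei'] := boolP (E Lb' i).
    have -> : b i = nb Lb' i by rewrite /b Ei Ei'.
    have [Ey ey] := A1 _ _ Ei'; rewrite /= in Ey ey.
    have -> : b (nb Lb' i) = i by rewrite /b Ey ey.
    by rewrite Ey eqxx orbT.
  have bi : b i = i by rewrite /b Ei Ei'.
  by rewrite !bi eqxx.
- by apply/implyP => /= /negbTE Er; rewrite permE /a Er.
- by apply/implyP => /=; rewrite negb_or => /andP[/negbTE Er /negbTE Er']; rewrite bE /b Er Er'.
have root_flag i : ~~ (E Lb i || E Lb' i) -> i = r.
  by apply: contraNeq => /A2/andP[].
move=> l i; rewrite /rstep; case: l => /=.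
- rewrite permE /a; have [->|ir] := eqVneq i r; first by case: (E La r).
  by have /andP[-> _] := A2 _ ir.
- rewrite inD bE /b; have [Ei|/negbTE Ei] := boolP (E Lb i).
    by case: eqVneq => //= <-; rewrite Ei.
  have [Ei'|/negbTE Ei'] := boolP (E Lb' i); first by case: ifP.
  by have ir := root_flag i; rewrite Ei Ei' in ir; rewrite -ir // Ei Ei' eqxx.
have [/[dup] h /bV ->|h] := boolP (E Lb i || E Lb' i); last first.
  have ir := root_flag _ h; move: h; rewrite negb_or => /andP[/negbTE Ei /negbTE Ei'].
  by rewrite -ir Ei Ei' eqxx.
rewrite inD; case: eqVneq => [e|_] /=; rewrite -?e ?h /=.
  have [/A1/= [-> _] //|/negbTE Ei'] := boolP (E Lb' i).
  move: h; rewrite Ei' orbF => Ei; have [/= -> _] := A1 _ _ Ei.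
  by have [Eb|] := boolP (E Lb (nb Lb i)) => //; have [] := A3 _ Ei Eb; rewrite Ei'.
have [/A1/= [-> _] //|/negbTE Ei'] := boolP (E Lb' i).
move: h; rewrite Ei' orbF => Ei; have [/= -> _] := A1 _ _ Ei.
by have [Eb|] := boolP (E Lb (nb Lb i)) => //; have [] := A3 _ Ei Eb; rewrite Ei'.
Qed.

End RootedStructure.

(** * Local structure of Stallings graphs *)

Section StallingsEdges.
Local Open Scope classical_set_scope.
Local Open Scope group_scope.
Variable H : set PSL2Z.
Hypothesis sH : is_subgroup H.
Implicit Types (v : set PSL2Z) (l : letter) (w : word).

Let nbr l v := rcoset_of v (elt [:: l]).

Lemma nbrK l v : nbr (letter_inv l) (nbr l v) = v.
Proof.
by rewrite /nbr rcoset_ofM -[[:: letter_inv l]]/(word_inv [:: l]) eltV mulgV rcoset_of1.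
Qed.

Lemma geodesic_inv w : geodesic w -> geodesic (word_inv w).
Proof.
by move=> /geodesic_alternates[t /alternates_inv]; apply: alternates_geodesic.
Qed.

Lemma stallings_edge_vertex l v : stallings_edge H l v -> stallings_vertex H v.
Proof. by case=> w1 [w2 [gw Hw ->]]; exists w1, (l :: w2). Qed.

Lemma stallings_edge_inv l v : stallings_edge H l v ->
  stallings_edge H (letter_inv l) (nbr l v).
Proof.
case/is_subgroupP: (sH) => H1 HM HV.
case=> w1 [w2 [gw Hw ->]]; exists (word_inv w2), (word_inv w1).
have e : word_inv w2 ++ letter_inv l :: word_inv w1 = word_inv (w1 ++ l :: w2).
  by rewrite word_inv_cat word_inv_cons -catA.
split; rewrite ?e ?eltV; [exact: geodesic_inv|exact: HV|].
rewrite /nbr rcoset_ofM; apply/rcoset_of_eq => //.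
by rewrite invgK -!eltM -catA.
Qed.

Lemma stallings_root_vertex : stallings_vertex H H.
Proof.
case/is_subgroupP: (sH) => H1 _ _.
by exists [::], [::]; split=> //; rewrite rcoset_of1.
Qed.

Lemma stallings_edge_target l v : stallings_edge H l v ->
  stallings_vertex H (nbr l v).
Proof. by move=> /stallings_edge_inv/stallings_edge_vertex. Qed.

(** A vertex other than the root is interior to a geodesic loop, and the letters before and after it
    have different types. *)
Lemma stallings_edges_nonroot v : stallings_vertex H v -> v <> H ->
  stallings_edge H La v /\ (stallings_edge H Lb v \/ stallings_edge H Lb' v).
Proof.
case=> w1 [w2 [gw Hw ->]] ne.
case/lastP: w1 => [|w1 l1] in gw Hw ne *; first by rewrite rcoset_of1 in ne.
case: w2 => [|l2 w2] in gw Hw ne *.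
  by rewrite cats0 in Hw; case: ne; apply/rcoset_of_id.
have e2 : stallings_edge H l2 (rcoset_of H (elt (rcons w1 l1))).
  by exists (rcons w1 l1), w2.
have e1 : stallings_edge H (letter_inv l1) (rcoset_of H (elt (rcons w1 l1))).
  rewrite -cats1 eltM -rcoset_ofM; apply: stallings_edge_inv.
  by exists w1, (l2 :: w2); rewrite cat_rcons in gw Hw; split.
have {gw} : is_a l2 = ~~ is_a l1.
  have [t] := geodesic_alternates gw; rewrite alternates_cat -cats1 alternates_cat /=.
  move=> /andP[/andP[_ /andP[/eqP a1 _]] /andP[/eqP a2 _]].
  by rewrite a1 a2 size_cat /= oddD addbA addbT.
case: l1 l2 e1 e2 {Hw ne} => -[] /= e1 e2 // _; split=> //; by [left|right].
Qed.

(** The beginning of the loop through the first edge and the end of the loop through the second are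
    joined by [Lb']. The word still alternates, and it represents an element of [H] since
    $b^2=b^{-1}$. *)
Lemma stallings_triangle v : stallings_edge H Lb v ->
  stallings_edge H Lb (nbr Lb v) -> stallings_edge H Lb' v.
Proof.
case/is_subgroupP: (sH) => H1 HM HV.
case=> w1 [w2 [gw Hw ->]] [w3 [w4 [gw' Hw' e]]].
exists w1, w4; split=> //.
  have [t] := geodesic_alternates gw; have [t'] := geodesic_alternates gw'.
  rewrite !alternates_cat /= => /andP[_ /andP[/eqP a3 a4]] /andP[a1 /andP[/eqP a2 _]].
  by apply: (@alternates_geodesic t); rewrite alternates_cat a1 /= -a2 /= -a3 in a4 *.
have b2 : elt [:: Lb'] = gb * gb.
  by apply: (mulIg gb); rewrite elt_Lb' mulVg -mulgA; symmetry; apply: gb3.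
have : H (elt w1 * gb * (elt w3)^-1).
  by apply/rcoset_of_eq => //; rewrite -e /nbr rcoset_ofM.
move=> /HM/(_ Hw'); rewrite !eltM (elt_cons Lb) (elt_cons Lb') b2.
by rewrite !mulgA mulgVK.
Qed.

Lemma nbr_triangle v : nbr Lb' v = nbr Lb (nbr Lb v).
Proof.
rewrite /nbr rcoset_ofM; congr rcoset_of.
apply: (mulIg gb); rewrite elt_Lb' mulVg -mulgA; symmetry; exact: gb3.
Qed.

End StallingsEdges.

Section Encoding.
Import mathcomp.boot.fintype mathcomp.boot.finset mathcomp.fingroup.fingroup mathcomp.fingroup.perm.
Local Open Scope group_scope.
Variable n : nat.
Implicit Types (H : set PSL2Z) (lab : set PSL2Z -> 'I_n) (x : lstruct n).
Implicit Types (r : 'I_n) (f : bool * bool).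

Definition labelling H lab :=
  (forall v v', stallings_vertex H v -> stallings_vertex H v' ->
     lab v = lab v' -> v = v') /\
  (forall i, exists2 v, stallings_vertex H v & lab v = i).

Definition encodes H lab x r f :=
  [/\ is_subgroup H, labelling H lab, r = lab H
    & forall v l, stallings_vertex H v -> rstep x r f l (lab v) =
        if `[< stallings_edge H l v >] then Some (lab (rcoset_of v (elt [:: l])))
        else None].

Lemma encodes_exists H lab : is_subgroup H -> labelling H lab ->
  exists x r f, [/\ encodes H lab x r f,
    (x.1 \in Invols [set: 'I_n]) && (x.2 \in Bst [set: 'I_n]),
    f.1 ==> (x.1 r == r) & f.2 ==> (x.2.1 r == r)].
Proof.
move=> sH [linj lsurj].
have /choice[k kP] : forall i, exists v, stallings_vertex H v /\ lab v = i.
  by move=> i; have [v ? ?] := lsurj i; exists v.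
have kV i : stallings_vertex H (k i) by case: (kP i).
have kl i : lab (k i) = i by case: (kP i).
have lk v : stallings_vertex H v -> k (lab v) = v by move=> Vv; apply: linj.
pose E l i := `[< stallings_edge H l (k i) >].
pose nb l i := lab (rcoset_of (k i) (elt [:: l])).
have Enb l i : E l i -> k (nb l i) = rcoset_of (k i) (elt [:: l]).
  by move=> /asboolP e; apply: lk; apply: stallings_edge_target.
have [|||x [f [xP f1 f2 xE]]] := @rstep_exists n E nb (lab H).
- move=> l i Ei; rewrite /E /nb (Enb _ _ Ei) nbrK kl; split=> //.
  by apply/asboolP/stallings_edge_inv => //; apply/asboolP.
- move=> i ir; have [|e1 e2] := stallings_edges_nonroot sH (kV i).
    by move=> e; rewrite -e kl eqxx in ir.
  by apply/andP; split; first exact/asboolP; apply/orP; case: e2 => ?; [left|right]; apply/asboolP.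
- move=> i Ei; rewrite {1}/E (Enb _ _ Ei) => /asboolP Eb.
  split; last by rewrite [LHS]/nb [RHS]/nb (Enb _ _ Ei) nbr_triangle.
  by apply/asboolP; apply: stallings_triangle Eb => //; apply/asboolP.
exists x, (lab H), f; split=> //; split=> // v l Vv.
by rewrite xE /E /nb lk.
Qed.

Section Decode.
Variables (H : set PSL2Z) (lab : set PSL2Z -> 'I_n) (x : lstruct n).
Variables (r : 'I_n) (f : bool * bool).
Hypothesis enc : encodes H lab x r f.

Lemma encodes_walk w1 w2 : geodesic (w1 ++ w2) -> H (elt (w1 ++ w2)) ->
  gwalk (rstep x r f) r w1 = Some (lab (rcoset_of H (elt w1))).
Proof.
case: enc => sH lP rE eE; elim/last_ind: w1 w2 => [|w1 l IH] w2 gw Hw.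
  by rewrite /= rE rcoset_of1.
rewrite cat_rcons in gw Hw.
rewrite -cats1 (gwalk_catS _ (IH _ gw Hw)) /= eE; last by exists w1, (l :: w2).
rewrite asboolT /=; last by exists w1, w2.
by rewrite rcoset_ofM -eltM.
Qed.

Lemma encodes_walk_target v w u : stallings_vertex H v ->
  gwalk (rstep x r f) (lab v) w = Some u ->
  stallings_vertex H (rcoset_of v (elt w)) /\ u = lab (rcoset_of v (elt w)).
Proof.
case: enc => sH lP rE eE; elim: w v => [|l w IH] v Vv /=.
  by case=> <-; rewrite rcoset_of1.
rewrite eE //; case: asboolP => // Ev; rewrite (elt_cons l w) -rcoset_ofM.
by apply: IH; apply: stallings_edge_target.
Qed.

Lemma encodes_loop w : geodesic w ->
  H (elt w) <-> gwalk (rstep x r f) r w = Some r.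
Proof.
move=> gw; case: (enc) => sH [linj _] rE _; split=> [Hw|].
  have := @encodes_walk w [::]; rewrite cats0 => /(_ gw Hw) ->.
  by rewrite rE; congr (Some (lab _)); apply/rcoset_of_id.
rewrite {2}rE => /encodes_walk_target[|Vw e]; first exact: stallings_root_vertex.
apply/rcoset_of_id => //; apply: linj => //; last by rewrite -e.
exact: stallings_root_vertex.
Qed.

Definition decoded : set PSL2Z :=
  [set y | exists w, [/\ geodesic w, elt w = y & gwalk (rstep x r f) r w = Some r]]%classic.

(** The subgroup is recovered from finite data, whence both the finiteness of [fg_subgroups n] and
    the injectivity of the encoding. *)
Lemma encodes_decode : H = decoded.
Proof.
apply/seteqP; split=> y; have [w gw <-] := geodesic_exists y.
  by move=> /(encodes_loop gw) wr; exists w.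
by case=> w' [gw' /(geodesic_inj gw' gw) <- /encodes_loop]; apply.
Qed.

(** With no flag set, reading [Lb] and [La] in turn along a cycle that avoids [D] closes a walk
    labelled $(ba)^k$ at some vertex, and [H] contains a conjugate of $(ba)^k$. *)
Lemma encodes_parabolic u : (forall i, iter i (x.2.1 * x.1) u \notin x.2.2) ->
  f = (false, false) -> ~ non_parabolic H.
Proof.
move=> uD f0 np; case: (enc) => sH [linj lsurj] rE _.
pose q := x.2.1 * x.1.
have walk_iter k v : (forall i, iter i q v \notin x.2.2) ->
    gwalk (rstep x r f) v (flatten (nseq k [:: Lb; La])) = Some (iter k q v).
  have rs l u1 : rstep x r f l u1 = step x l u1.
    by rewrite /rstep f0; case: (is_a l); rewrite /= andbF.
  elim: k v => //= k IH v vD; rewrite rs /= (negbTE (vD 0)) /= rs /=.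
  rewrite (_ : x.1 (x.2.1 v) = q v); last by rewrite permM.
  by rewrite IH => [|i]; [rewrite -iterSr|rewrite -iterSr; apply: vD i.+1].
pose k := #|porbit q u|.
have k0 : (0 < k)%N by rewrite lt0n card_porbit_neq0.
have := walk_iter k u uD; rewrite iter_porbit.
have [v Vv <-] := lsurj u => /(encodes_walk_target Vv)[Vv' /(linj _ _ Vv Vv')].
have eltk : elt (flatten (nseq k [:: Lb; La])) = (gb * ga) ^+ k.
  by elim: (k) => //= j IH; rewrite (elt_cons Lb) (elt_cons La) IH expgS mulgA.
case: Vv => w1 [w2 [_ _ ->]]; rewrite rcoset_ofM => /esym /rcoset_of_eq -/(_ sH).
rewrite eltk => Hx; apply: (np _ Hx).
(* The factor [gb] comes from $ba=b(ab)b^{-1}$. *)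
exists (elt w1 * gb)^-1, (Posz k); split; first by case: (k) k0.
have -> : elt w1 * (gb * ga) ^+ k / elt w1 = (gb * ga) ^+ k ^ (elt w1)^-1.
  by rewrite /conjg invgK mulgA.
rewrite /= !conjXg; congr (_ ^+ k).
by rewrite /conjg !invgK invMg !mulgA mulgK.
Qed.

End Decode.

End Encoding.

Section SeqCounting.
Import mathcomp.boot.fintype mathcomp.boot.finset.
Variables (K : choiceType) (B W : finType).

Lemma leq_card_prod_inj (A : {fset K}) (S : {set W}) (g : K -> B -> W) :
  (forall k b, k \in A -> g k b \in S) ->
  (forall k k' b b', k \in A -> k' \in A -> g k b = g k' b' -> k = k' /\ b = b') ->
  #|` A| * #|B| <= #|S|.
Proof.
move=> gS g_inj; rewrite [#|B|]cardE [leqRHS]cardE -(size_allpairs g).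
apply: uniq_leq_size.
  apply: allpairs_uniq; rewrite ?fset_uniq ?enum_uniq // => -[k b] [k' b'].
  move=> /allpairsP[[k1 b1] /= [k1A _ [-> ->]]] /allpairsP[[k2 b2] /= [k2A _ [-> ->]]].
  by move=> /(g_inj _ _ _ _ k1A k2A)[-> ->].
by move=> _ /allpairsP[[k b] /= [kA _ ->]]; rewrite mem_enum gS.
Qed.

Lemma leq_card_inj_prod (A : {fset K}) (S : {set W}) (h : W -> K * B) :
  {in S &, injective h} -> (forall w, w \in S -> (h w).1 \in A) ->
  #|S| <= #|` A| * #|B|.
Proof.
move=> h_inj hA; rewrite [leqLHS]cardE [#|B|]cardE -(size_allpairs (fun k b => (k, b))).
rewrite -(size_map h); apply: uniq_leq_size.
  rewrite map_inj_in_uniq ?enum_uniq // => w w'.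
  by rewrite !mem_enum; apply: h_inj.
move=> _ /mapP[w + ->]; rewrite mem_enum => /hA.
case: (h w) => k b kA; apply/allpairsP; exists (k, b).
by rewrite mem_enum.
Qed.

End SeqCounting.

(** * Counting subgroups through labelled structures *)

Section Correspondence.
Import mathcomp.boot.fintype mathcomp.boot.finset mathcomp.fingroup.fingroup mathcomp.fingroup.perm.
Local Open Scope group_scope.
Variable n : nat.
Hypothesis n_gt0 : 0 < n.

Lemma labelling_exists H : is_subgroup H -> has_size n H ->
  exists lab : set PSL2Z -> 'I_n, labelling H lab.
Proof.
move=> sH /card_set_bijP[f [fV f_inj f_surj]].
exists (fun v => insubd (Ordinal n_gt0) (f v)).
have VP v : stallings_vertex H v -> lg_vert (stallings H) v.
  by move/(stallings_vertexP _ sH).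
have fn v : stallings_vertex H v -> f v < n by move=> /VP/fV.
split=> [v v' Vv Vv' /(congr1 val)|i].
  rewrite !val_insubd !fn //; apply: f_inj; apply: mem_set; exact: VP.
have [v Vv fv] := f_surj i (ltn_ord i); exists v; first exact/(stallings_vertexP _ sH).
by apply: val_inj; rewrite val_insubd fv ltn_ord.
Qed.

(** One numbering is fixed for each subgroup; composing it with permutations produces the others, so
    that both counts become injections between structures and products with [{perm 'I_n}]. *)
Lemma canonical_labelling : exists lab : set PSL2Z -> set PSL2Z -> 'I_n,
  forall H, fg_subgroups n H -> labelling H (lab H).
Proof.
have /choice[lab labP] : forall H, exists lab : set PSL2Z -> 'I_n,
    fg_subgroups n H -> labelling H lab.
  move=> H; have [[sH _ szH]|nH] := pselect (fg_subgroups n H).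
    by have [lab labP] := labelling_exists sH szH; exists lab.
  by exists (fun=> Ordinal n_gt0).
by exists lab.
Qed.

Lemma labelling_perm H lab (s : {perm 'I_n}) : labelling H lab ->
  labelling H (fun v => s (lab v)).
Proof.
case=> linj lsurj; split=> [v v' Vv Vv' /perm_inj|i]; first exact: linj.
have [v Vv vi] := lsurj (s^-1 i); exists v => //.
by rewrite vi permKV.
Qed.

Definition valid_structures : {set lstruct n} :=
  setX (Invols [set: 'I_n]) (Bst [set: 'I_n]).

Lemma mem_valid x : (x \in valid_structures) =
  (x.1 \in Invols [set: 'I_n]) && (x.2 \in Bst [set: 'I_n]).
Proof. by case: x => a b; rewrite in_setX. Qed.

(** Contains the encodings of all non-parabolic subgroups. The condition on cycles is imposed only
    when no edge is missing at the root; when one is, the loop put in its place is already rare. *)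
Definition codes : {set lstruct n * 'I_n * (bool * bool)} :=
  [set g | [&& g.1.1 \in valid_structures,
    g.2.1 ==> (g.1.1.1 g.1.2 == g.1.2), g.2.2 ==> (g.1.1.2.1 g.1.2 == g.1.2)
    & (g.2 == (false, false)) ==>
        orbits_meet [set: 'I_n] g.1.1.2.2 (g.1.1.2.1 * g.1.1.1)]].

Lemma encodes_inj H H' lab lab' (x : lstruct n) (r : 'I_n) (f : bool * bool) :
  encodes H lab x r f -> encodes H' lab' x r f ->
  H = H' /\ forall v, stallings_vertex H v -> lab v = lab' v.
Proof.
move=> e e'; have eH : H = H' by rewrite (encodes_decode e) (encodes_decode e').
split=> // v [w1 [w2 [gw Hw ->]]]; move: Hw (encodes_walk e gw Hw) => Hw.
by rewrite eH in Hw *; rewrite (encodes_walk e' gw Hw) => -[].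
Qed.

Lemma fg_subgroups_finite : finite_set (fg_subgroups n).
Proof.
have [lab labP] := canonical_labelling.
pose dec (g : lstruct n * 'I_n * (bool * bool)) := decoded g.1.1 g.1.2 g.2.
apply: (@sub_finite_set _ _ [set dec g | g in [set: _]]%classic); last first.
  by apply: finite_image; apply: finite_finset.
move=> H fgH; have [sH _ _] := fgH.
have [x [r [f [e _ _ _]]]] := encodes_exists sH (labP H fgH).
by exists (x, r, f); rewrite // /dec /= -(encodes_decode e).
Qed.

Lemma card_non_parabolic :
  #|` fset_set (fg_subgroups n `&` [set H | non_parabolic H])%classic| * n`!
  <= #|codes|.
Proof.
have [lab labP] := canonical_labelling.
have /choice[code codeP] : forall Hs : set PSL2Z * {perm 'I_n},
    exists g : lstruct n * 'I_n * (bool * bool), fg_subgroups n Hs.1 ->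
    [/\ encodes Hs.1 (fun v => Hs.2 (lab Hs.1 v)) g.1.1 g.1.2 g.2,
      g.1.1 \in valid_structures,
      g.2.1 ==> (g.1.1.1 g.1.2 == g.1.2) & g.2.2 ==> (g.1.1.2.1 g.1.2 == g.1.2)].
  move=> [H s] /=; have [fgH|nfgH] := pselect (fg_subgroups n H); last first.
    by exists ((1, (1, set0)), Ordinal n_gt0, (true, true)).
  have [sH _ _] := fgH.
  have [x [r [f [e xv f1 f2]]]] := encodes_exists sH (labelling_perm s (labP H fgH)).
  by exists (x, r, f) => _; split; rewrite // inE.
have EP H : H \in fset_set (fg_subgroups n `&` [set H | non_parabolic H])%classic ->
    fg_subgroups n H /\ non_parabolic H.
  rewrite in_fset_set; first by move/set_mem.
  by apply: finite_setIl; apply: fg_subgroups_finite.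
have -> : n`! = #|{perm 'I_n}|.
  by rewrite -card_Sn; apply: eq_card => s; rewrite !inE.
apply: (leq_card_prod_inj (g := fun H s => code (H, s))).
  move=> H s /EP[fgH npH]; have [e xv f1 f2] := codeP (H, s) fgH.
  rewrite inE xv f1 f2 /=; apply/implyP => /eqP f0; apply/forall_inP => u _.
  apply/negP => /pred0P d; apply: (encodes_parabolic e (u := u)) f0 npH => i.
  have := d (iter i ((code (H, s)).1.1.2.1 * (code (H, s)).1.1.1) u).
  by rewrite /= -permX mem_porbit /= => ->.
move=> H H' s s' /EP[fgH _] /EP[fgH' _] e.
have [e1 _ _ _] := codeP (H, s) fgH; have [e2 _ _ _] := codeP (H', s') fgH'.
rewrite e in e1; have [/= eH lE] := encodes_inj e1 e2; split=> //.
apply/permP=> i; have [_ lsurj] := labP H fgH.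
by have [v Vv <-] := lsurj i; have := lE v Vv; rewrite /= -eH.
Qed.

Lemma gcoset_step_inj (x : lstruct n) r : x \in valid_structures ->
  transitive_pair x.1 x.2.1 -> injective (gcoset (step x) r).
Proof.
rewrite mem_valid => /andP[aI bI] tx; apply: gcoset_inj.
- exact: stepI.
- exact: step_b.
- exact: step_a.
- exact: step_loop_through.
Qed.

Lemma gcoset_step_vertex (x : lstruct n) r u : x \in valid_structures ->
  transitive_pair x.1 x.2.1 ->
  stallings_vertex (gcoset (step x) r r) (gcoset (step x) r u).
Proof.
rewrite mem_valid => /andP[aI bI] tx; have sI := stepI aI.
apply/stallings_vertexP; first exact: gcoset_subgroup.
have r_loop := step_loop_through aI bI r tx.
by rewrite (stallings_gcoset sI (step_b bI) (@step_a _ x) r_loop); exists u.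
Qed.

(** Every edge lies on a geodesic loop at the root, whose label is also read in the other structure.
    The points before and after the edge agree there, because their cosets do. *)
Lemma lstruct_determined (x x' : lstruct n) (r r' : 'I_n) :
  x \in valid_structures -> x' \in valid_structures ->
  transitive_pair x.1 x.2.1 -> transitive_pair x'.1 x'.2.1 ->
  (forall u, gcoset (step x) r u = gcoset (step x') r' u) ->
  gcoset (step x) r r = gcoset (step x') r' r' ->
  r = r' /\ forall l u v, step x l u = Some v -> step x' l u = Some v.
Proof.
rewrite !mem_valid => /andP[aI bI] /andP[aI' bI'] tx tx' eu er.
have inj' : injective (gcoset (step x') r').
  by apply: gcoset_step_inj; rewrite // mem_valid aI' bI'.
split=> [|l u v suv]; first by apply: inj'; rewrite -eu.
have [w1 [w2 [gw w1u w2r]]] := step_loop_through aI bI r tx suv.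
have Hw : gcoset (step x) r r (elt (w1 ++ l :: w2)).
  by exists (w1 ++ l :: w2); rewrite // (gwalk_catS _ w1u) /= suv.
rewrite er in Hw.
have := (gcoset_root r' (stepI aI') (step_b bI') gw).1 Hw.
rewrite gwalk_cat; case w1u': (gwalk _ _ w1) => [u'|] //=.
case suv': (step x' l u') => [v'|] //= _.
have uu : u' = u.
  apply: inj'; rewrite -(eu u) (gcosetE (stepI aI) w1u) er.
  by rewrite (gcosetE (stepI aI') w1u').
rewrite uu in suv' *; rewrite suv'; congr Some; apply: inj'; rewrite -(eu v).
have w1v : gwalk (step x) r (w1 ++ [:: l]) = Some v.
  by rewrite (gwalk_catS _ w1u) /= suv.
have w1v' : gwalk (step x') r' (w1 ++ [:: l]) = Some v'.
  by rewrite (gwalk_catS _ w1u') /= uu suv'.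
by rewrite (gcosetE (stepI aI) w1v) er (gcosetE (stepI aI') w1v').
Qed.

(** [D] is where [Lb] is undefined, and on [D] the permutation is recovered through [Lb']. *)
Lemma step_inj (x x' : lstruct n) :
  x \in valid_structures -> x' \in valid_structures ->
  (forall l u, step x l u = step x' l u) -> x = x'.
Proof.
case: x x' => [a [b D]] [a' [b' D']]; rewrite !mem_valid /= => /andP[_ bI] /andP[_ bI'] e.
have ea : a = a' by apply/permP=> u; case: (e La u).
have eD : D = D'.
  by apply/setP=> u; have /= := e Lb u; case: (u \in D); case: (u \in D').
suff eb : b = b' by rewrite ea eb eD.
apply/permP=> u; have /= := e Lb u; rewrite -eD.
have [uD _|uD [//]] := boolP (u \in D).
have /= [bV bu] := step_end (x := (a, (b, D))) bI uD.
have uD' : u \in D' by rewrite -eD.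
have /= [bV' _] := step_end (x := (a', (b', D'))) bI' uD'.
by have /= := e Lb' u; rewrite bV bV' (negbTE bu); case: ifP => // _ [].
Qed.

(** A structure with a root is sent to its subgroup and to the permutation that compares its
    numbering with the canonical one. These determine the coset attached to each point, hence the
    structure and the root. *)
Lemma card_cr_subgroups :
  n * #|[set x in valid_structures | transitive_pair x.1 x.2.1]| <=
  #|` fset_set (cr_fg_subgroups n)| * n`!.
Proof.
have [lab labP] := canonical_labelling.
pose G := [set x in valid_structures | transitive_pair x.1 x.2.1].
have /choice[s sP] : forall xr : lstruct n * 'I_n, exists s : {perm 'I_n},
    xr.1 \in G -> forall u, s u =
      lab (gcoset (step xr.1) xr.2 xr.2) (gcoset (step xr.1) xr.2 u).
  move=> [x r] /=; have [xG|xG] := boolP (x \in G); last by exists 1.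
  move: xG; rewrite inE => /andP[xv tx].
  have := xv; rewrite mem_valid => /andP[aI bI].
  have [fgH _] := lstruct_subgroup aI bI r tx.
  have [linj _] := labP _ fgH.
  have inj : injective (fun u => lab (gcoset (step x) r r) (gcoset (step x) r u)).
    move=> u v /(linj _ _ (gcoset_step_vertex r u xv tx) (gcoset_step_vertex r v xv tx)).
    exact: gcoset_step_inj.
  by exists (perm inj) => _ u; rewrite permE.
have finE : finite_set (cr_fg_subgroups n).
  by apply: finite_setIl; apply: fg_subgroups_finite.
rewrite -/G; have -> : (n * #|G| = #|setX G [set: 'I_n]|)%N.
  by rewrite cardsX cardsT card_ord mulnC.
have -> : n`! = #|{perm 'I_n}|.
  by rewrite -card_Sn; apply: eq_card => c; rewrite !inE.
apply: (leq_card_inj_prod (h := fun xr => (gcoset (step xr.1) xr.2 xr.2, s xr))).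
  move=> [x r] [x' r']; rewrite !in_setX !in_setT !andbT => xG xG' [eH es].
  have [xv tx] : x \in valid_structures /\ transitive_pair x.1 x.2.1.
    by move: xG; rewrite inE => /andP[].
  have [xv' tx'] : x' \in valid_structures /\ transitive_pair x'.1 x'.2.1.
    by move: xG'; rewrite inE => /andP[].
  have [fgH _] : cr_fg_subgroups n (gcoset (step x) r r).
    by move: xv; rewrite mem_valid => /andP[aI bI]; apply: lstruct_subgroup.
  have [linj _] := labP _ fgH.
  have eu u : gcoset (step x) r u = gcoset (step x') r' u.
    apply: linj; first exact: gcoset_step_vertex.
      by rewrite eH; apply: gcoset_step_vertex.
    by rewrite -(sP (x, r)) // es (sP (x', r')) // eH.
  have [rr st] := lstruct_determined xv xv' tx tx' eu eH.
  have [_ st'] := lstruct_determined xv' xv tx' tx (fun u => esym (eu u)) (esym eH).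
  rewrite rr; congr (_, _); apply: step_inj => // l u.
  case e: (step x l u) => [v|]; first by rewrite (st _ _ _ e).
  by case e': (step x' l u) => [v|] //; rewrite (st' _ _ _ e') in e.
move=> [x r]; rewrite in_setX in_setT andbT inE => /andP[xv tx] /=.
rewrite in_fset_set //; apply: mem_set.
by move: xv; rewrite mem_valid => /andP[aI bI]; apply: lstruct_subgroup.
Qed.

End Correspondence.

(** * The theorem *)

Section CountingCodes.
Import mathcomp.boot.fintype mathcomp.boot.finset mathcomp.fingroup.fingroup mathcomp.fingroup.perm.
Variable n : nat.

(** For each of the [n] roots, the flags [(false, false)] leave the structures whose cycles all meet
    [D]; each of the three other values forces the root to be fixed by one of the two
    permutations. *)
Lemma card_codes :
  #|codes n| <= n * (#|[set x in setX (Invols [set: 'I_n]) (Bst [set: 'I_n]) |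
      orbits_meet [set: 'I_n] x.2.2 (x.2.1 * x.1)%g]| +
    3 * (invn n.-1 * bstn n + invn n * bstn n.-1)).
Proof.
set good := [set x in _ | _]; set L := (_ * bstn n + _).
pose c (f : bool * bool) := if f == (false, false) then #|good| else L.
rewrite -sum1_card (partition_big (fun g => (g.1.2, g.2)) xpredT) //=.
apply: (@leq_trans (\sum_(p : 'I_n * (bool * bool)) c p.2)); last first.
  rewrite -(pair_bigA _ (fun=> c)) /= sum_nat_const card_ord leq_mul2l.
  apply/orP; right; rewrite -(pair_bigA _ (fun b1 b2 => c (b1, b2))) /=.
  rewrite !big_bool /c !xpair_eqE /=; clearbody L; lia.
apply: leq_sum => -[r f] _ /=; rewrite sum1dep_card.
rewrite -(@card_in_imset _ _ (fun g => g.1.1)); last first.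
  move=> [[x1 r1] f1] [[x2 r2] f2]; rewrite !inE /=.
  by move=> /andP[_ /eqP[-> ->]] /andP[_ /eqP[-> ->]] ->.
have cT : #|[set: 'I_n] :\ r| = n.-1.
  have : #|[set: 'I_n]| = n by rewrite cardsT card_ord.
  by rewrite (cardsD1 r) inE add1n => e; apply: (congr1 predn e).
have cI : #|[set a in Invols [set: 'I_n] | a r == r]| = invn n.-1.
  by rewrite Invols_fix ?inE // card_Invols cT.
have cB : #|[set p in Bst [set: 'I_n] | p.1 r == r]| = bstn n.-1.
  by rewrite Bst_fix ?inE // card_Bst cT.
have cI' : #|Invols [set: 'I_n]| = invn n by rewrite card_Invols cardsT card_ord.
have cB' : #|Bst [set: 'I_n]| = bstn n by rewrite card_Bst cardsT card_ord.
have sub (S : {set lstruct n}) : (forall x, (x, r, f) \in codes n -> x \in S) ->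
    #|[set g.1.1 | g in [set g in codes n | (g.1.2, g.2) == (r, f)]]| <= #|S|.
  move=> cS; apply: subset_leq_card; apply/subsetP=> _ /imsetP[[[x r1] f1] + ->].
  by rewrite in_set => /andP[h /eqP[e1 e2]]; apply: cS; rewrite -e1 -e2.
rewrite /c; case: ifPn => [/eqP f0|f0].
  apply: sub => x; rewrite f0 !in_set /= => /andP[xv xm].
  by apply/andP.
case: f f0 sub => [[|] f2] // f0 sub.
  apply: (@leq_trans (invn n.-1 * bstn n)); last exact: leq_addr.
  rewrite -cI -cB' -cardsX; apply: sub => -[a p]; rewrite in_set mem_valid /=.
  by case/andP=> /andP[aI pB] /andP[ar _]; rewrite in_setX pB andbT in_set aI.
case: f2 f0 sub => // _ sub.
apply: (@leq_trans (invn n * bstn n.-1)); last exact: leq_addl.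
rewrite -cI' -cB -cardsX; apply: sub => -[a p]; rewrite in_set mem_valid /=.
by case/andP=> /andP[aI pB] /andP[pr _]; rewrite in_setX aI in_set pB.
Qed.

End CountingCodes.

Local Open Scope classical_set_scope.
Local Open Scope ring_scope.

(** Numerator and denominator are both counted with [F] numberings and [m] roots, which cancel in
    the quotient. [P] is the number of all pairs and [T] that of the transitive ones; the factor 2
    comes from [P <= 2 * T%:R]. *)
Lemma unif_prob_le (R : realType) (a e F m g L T : nat) (C1 C2 q P : R) :
  (a * F <= m * (g + 3 * L))%N -> (m * T <= e * F)%N -> (0 < F)%N -> (0 < m)%N ->
  0 < P -> P <= 2 * T%:R -> 0 <= q -> g%:R <= C1 * q * P -> L%:R <= C2 * q * P ->
  a%:R / e%:R <= (2 * (`|C1| + 3 * `|C2|)) * q.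
Proof.
move=> h1 h2 F0 m0 P0 PT q0 hg hL.
have FR : 0 < F%:R :> R by rewrite ltr0n.
have mR : 0 < m%:R :> R by rewrite ltr0n.
have T0 : 0 < T%:R :> R by lra.
have h2' : m%:R * T%:R <= e%:R * F%:R :> R by rewrite -!natrM ler_nat.
have h1' : a%:R * F%:R <= m%:R * (g%:R + 3 * L%:R) :> R.
  by rewrite -!natrM -natrD -natrM ler_nat.
have e0 : 0 < e%:R :> R.
  by rewrite -(pmulr_lgt0 _ FR); apply: lt_le_trans h2'; rewrite mulr_gt0.
rewrite ler_pdivrMr // -(ler_pM2r FR).
have hC : g%:R + 3 * L%:R <= (`|C1| + 3 * `|C2|) * q * P.
  have qP : 0 <= q * P by rewrite mulr_ge0 // ltW.
  have := ler_wpM2r qP (ler_norm C1); have := ler_wpM2r qP (ler_norm C2).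
  by move: hg hL; rewrite -!mulrA !mulrDl -!mulrA; lra.
have C0 : 0 <= (`|C1| + 3 * `|C2|) * q by rewrite mulr_ge0 // addr_ge0 // mulr_ge0.
apply: le_trans h1' _; apply: le_trans (ler_wpM2l (ltW mR) hC) _.
move: C0; set K := (_ * q) => C0.
have -> : 2 * (`|C1| + 3 * `|C2|) * q = 2 * K by rewrite /K mulrA.
apply: (@le_trans _ _ (m%:R * (K * (2 * T%:R)))).
  by rewrite ler_wpM2l ?(ltW mR) // ler_wpM2l.
have -> : m%:R * (K * (2 * T%:R)) = 2 * K * (m%:R * T%:R) by ring.
by rewrite -[leRHS]mulrA ler_wpM2l // mulr_ge0.
Qed.

(** A family between the two classes covers both halves of the theorem: the numerator is bounded
    within all finitely generated subgroups, the denominator by the cyclically reduced ones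
    alone. *)
Lemma prob_non_parabolic_le (R : realType) (alpha : R) : 0 < alpha < 1 / 6 ->
  exists (C : R) N, forall n, (N <= n)%N -> forall E : nat -> set (set PSL2Z),
    cr_fg_subgroups n `<=` E n -> E n `<=` fg_subgroups n ->
    unif_prob R (E n) [set H | non_parabolic H] <= C * n%:R `^ (- alpha).
Proof.
move=> a01; have [C1 [N1 H1]] := card_orbits_meet a01.
have [C2 H2] := card_rooted_loops a01; have [N2 H3] := card_transitive R.
exists (2 * (`|C1| + 3 * `|C2|)), (N1 + N2).+1 => n Nn E crE Efg.
have n0 : (0 < n)%N by apply: leq_trans Nn.
have fgF := fg_subgroups_finite n0.
have EF : finite_set (E n) := sub_finite_set Efg fgF.
have crF : finite_set (cr_fg_subgroups n) := sub_finite_set crE EF.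
have le1 : (#|` fset_set (E n `&` [set H | non_parabolic H])| * n`! <=
    #|codes n|)%N.
  apply: leq_trans (card_non_parabolic n0); rewrite leq_mul2r.
  apply/orP; right; apply: fsubset_leq_card.
  rewrite -fset_set_sub; [|exact: finite_setIl|exact: finite_setIl].
  by move=> H [/Efg].
have le2 := leq_trans le1 (card_codes n).
have le3 := card_cr_subgroups n0.
have le4 : (#|` fset_set (cr_fg_subgroups n)| * n`! <= #|` fset_set (E n)| * n`!)%N.
  rewrite leq_mul2r; apply/orP; right; apply: fsubset_leq_card.
  by rewrite -fset_set_sub.
have N1n : (N1 <= n)%N by apply: leq_trans (ltnW Nn); apply: leq_addr.
have N2n : (N2 <= n)%N by apply: leq_trans (ltnW Nn); apply: leq_addl.
have le5 := H3 n N2n.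
apply: (unif_prob_le le2 (leq_trans le3 le4) (fact_gt0 n) n0
  (P := (invn n)%:R * (bstn n)%:R)).
- by rewrite mulr_gt0 ?invn_pos ?bstn_pos.
- by rewrite -!natrM ler_nat.
- exact: powR_ge0.
- exact: H1.
- exact: H2.
Qed.

Theorem corollary6p2 (R : realType) (alpha : R)
    (alpha_gt0 : 0 < alpha) (alpha_lt : alpha < 1 / 6) :
  (fun n : nat => unif_prob R (fg_subgroups n) [set H | non_parabolic H] : R^o)
    =O_\oo (fun n : nat => n%:R `^ (- alpha) : R^o) /\
  (fun n : nat =>
     unif_prob R (cr_fg_subgroups n) [set H | non_parabolic H] : R^o)
    =O_\oo (fun n : nat => n%:R `^ (- alpha) : R^o).
Proof.
have [C [N HN]] := prob_non_parabolic_le (introT andP (conj alpha_gt0 alpha_lt)).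
have bigO (E : nat -> set (set PSL2Z)) :
    (forall n, cr_fg_subgroups n `<=` E n) -> (forall n, E n `<=` fg_subgroups n) ->
  (fun n : nat => unif_prob R (E n) [set H | non_parabolic H] : R^o)
    =O_\oo (fun n : nat => n%:R `^ (- alpha) : R^o).
  move=> crE Efg; apply/eqO_exP; exists (`|C| + 1).
    by rewrite ltr_wpDl.
  exists N => // n /= Nn; rewrite [leLHS]ger0_norm ?divr_ge0 // (ger0_norm (powR_ge0 _ _)).
  apply: le_trans (HN n Nn E (crE n) (Efg n)) _.
  by rewrite ler_wpM2r ?powR_ge0 //; have := ler_norm C; lra.
by split; apply: bigO => n; first [exact: subset_refl|exact: subIsetl].
Qed.
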